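(* Consider the excited random walk with Markovian cookie stacks described in the context, fix an arbitrary initial distribution $\eta$ on $\mathcal R$, and assume $\bar p=\mu\cdot\mathbf p=1/2$. Let $\delta,\tilde\delta$ be the parameters defined in the context. Then $\delta+\tilde\delta<1$, and: - if $\delta>1$ then $P_\eta(\lim_{n\to\infty}X_n=\infty)=1$; - if $\tilde\delta>1$ then $P_\eta(\lim_{n\to\infty}X_n=-\infty)=1$; - if $\delta\le1$ and $\tilde\delta\le1$ then $P_\eta(\liminf_{n\to\infty}X_n=-\infty,\ \limsup_{n\to\infty}X_n=\infty)=1$.
   Context: Let $\mathcal R=\{1,\dots,N\}$ and let $K$ be a stochastic matrix on $\mathcal R$ such that the Markov chain with transition matrix $K$ has a unique closed irreducible subset $\mathcal R_0\subseteq\mathcal R$; let $\mu$ (a row vector) be its unique stationary distribution. Fix $p:\mathcal R\to(0,1)$ and write $\mathbf p=(p(1),\dots,p(N))^t$, $\mathbf 1$ for the all-ones column vector, $I$ for the identity matrix, $D_p$ for the diagonal matrix with $i$-th diagonal entry $p(i)$, $D_{1-p}=I-D_p$, and $\bar p=\mu\cdot\mathbf p$. For a probability distribution $\eta$ on $\mathcal R$, $\mathbb P_\eta$ denotes the law of an i.i.d. family $\{(R^x_j)_{j\ge1}\}_{x\in\mathbb Z}$ of Markov chains with transition matrix $K$ and $R^x_1\sim\eta$; the cookie environment is $\omega_x(j)=p(R^x_j)$. Given $\omega$, the excited random walk $(X_n)_{n\ge0}$ has quenched law $P_\omega$ with $X_0=0$ and $P_\omega(X_{n+1}=X_n+1\mid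 X_0,\dots,X_n)=1-P_\omega(X_{n+1}=X_n-1\mid X_0,\dots,X_n)=\omega_{X_n}(\#\{k\le n:X_k=X_n\})$; the averaged law is $P_\eta(\cdot)=\mathbb E_\eta[P_\omega(\cdot)]$. When $\bar p=1/2$ define the column vectors $\mathbf r=(I-K+2(\mathbf 1-\mathbf p)\mu D_{1-p}K)^{-1}\mathbf p-\mathbf 1$ and $\tilde{\mathbf r}=(I-K+2\mathbf p\,\mu D_pK)^{-1}(\mathbf 1-\mathbf p)-\mathbf 1$, the scalars $\nu=2+4\mu D_pK\mathbf r$ and $\tilde\nu=2+4\mu D_{1-p}K\tilde{\mathbf r}$, and $\delta=2\,\eta\cdot\mathbf r/\nu$, $\tilde\delta=2\,\eta\cdot\tilde{\mathbf r}/\tilde\nu$. *)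

(* Defs.v *)
From HB Require Import structures.
From mathcomp Require Import all_boot all_order all_algebra.
From mathcomp Require Import all_classical all_reals all_analysis.
Set Implicit Arguments. Unset Strict Implicit. Unset Printing Implicit Defensive.
Import Order.TTheory GRing.Theory Num.Theory.
Local Open Scope ring_scope.

Section ERW.
Variables (R : realType) (N : nat).

Definition stochastic (K : 'M[R]_N) : Prop :=
  (forall i j, 0 <= K i j) /\ (forall i, \sum_j K i j = 1).

Definition prob_vec (eta : 'rV[R]_N) : Prop :=
  (forall i, 0 <= eta 0 i) /\ \sum_i eta 0 i = 1.

Definition closed_set (K : 'M[R]_N) (C : {set 'I_N}) : Prop :=
  forall i j, i \in C -> 0 < K i j -> j \in C.

Definition irreducible_on (K : 'M[R]_N) (C : {set 'I_N}) : Prop :=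
  forall i j, i \in C -> j \in C -> connect [rel a b | 0 < K a b] i j.

Definition closed_irreducible (K : 'M[R]_N) (C : {set 'I_N}) : Prop :=
  C != finset.set0 /\ closed_set K C /\ irreducible_on K C.

Definition stationary (K : 'M[R]_N) (mu : 'rV[R]_N) : Prop :=
  prob_vec mu /\ mu *m K = mu.

Definition pvec (p : 'I_N -> R) : 'cV[R]_N := \col_i p i.
Definition onevec : 'cV[R]_N := const_mx 1.
Definition Dp (p : 'I_N -> R) : 'M[R]_N := diag_mx (\row_i p i).
Definition D1p (p : 'I_N -> R) : 'M[R]_N := 1%:M - Dp p.

Definition rvec (K : 'M[R]_N) (mu : 'rV[R]_N) (p : 'I_N -> R) : 'cV[R]_N :=
  invmx (1%:M - K + 2%:R *: ((onevec - pvec p) *m mu *m D1p p *m K))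
    *m pvec p - onevec.

Definition rtvec (K : 'M[R]_N) (mu : 'rV[R]_N) (p : 'I_N -> R) : 'cV[R]_N :=
  invmx (1%:M - K + 2%:R *: (pvec p *m mu *m Dp p *m K))
    *m (onevec - pvec p) - onevec.

Definition nu (K : 'M[R]_N) (mu : 'rV[R]_N) (p : 'I_N -> R) : R :=
  2%:R + 4%:R * (mu *m Dp p *m K *m rvec K mu p) 0 0.
Definition nut (K : 'M[R]_N) (mu : 'rV[R]_N) (p : 'I_N -> R) : R :=
  2%:R + 4%:R * (mu *m D1p p *m K *m rtvec K mu p) 0 0.

Definition delta (K : 'M[R]_N) (mu eta : 'rV[R]_N) (p : 'I_N -> R) : R :=
  2%:R * (eta *m rvec K mu p) 0 0 / nu K mu p.
Definition deltat (K : 'M[R]_N) (mu eta : 'rV[R]_N) (p : 'I_N -> R) : R :=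
  2%:R * (eta *m rtvec K mu p) 0 0 / nut K mu p.

(** Probability that the first m cookies of one stack are in states
    r 0, ..., r (m-1) (the stack being a K-Markov chain started from eta)
    and that the associated coins are b 0, ..., b (m-1), each coin b j
    being Bernoulli(p (r j)) given the states. (Meant for 0 < m.) *)
Definition stack_prob (K : 'M[R]_N) (eta : 'rV[R]_N) (p : 'I_N -> R)
    (r : nat -> 'I_N) (b : nat -> bool) (m : nat) : R :=
  eta 0 (r 0%N) * (\prod_(j < m.-1) K (r j) (r j.+1)) *
  \prod_(j < m) (if b j then p (r j) else 1 - p (r j)).

End ERW.

(** The walk driven by the coin environment c : for the k-th visit
    (k = 0, 1, ...) to site x the walk steps to x+1 if c x k, to x-1
    otherwise.  walk_hist c n = [:: X_0; ...; X_n]. *)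
Fixpoint walk_hist (c : int -> nat -> bool) (n : nat) : seq int :=
  match n with
  | 0%N => [:: 0%R]
  | n'.+1 =>
      let s := walk_hist c n' in
      let x := last 0%R s in
      let k := (count (pred1 x) s).-1 in
      rcons s (if c x k then (x + 1)%R else (x - 1)%R)
  end.

Definition walk (c : int -> nat -> bool) (n : nat) : int := last 0%R (walk_hist c n).

(* Main.v *)
(** Suppose the walk makes an excursion to the right of a site in which it
    steps [m] times to the right from that site.  Then the number of right steps
    from the next sites is a branching-like Markov chain: given that it equals
    [n] at a site, its value at the next one is the number [F n] of successes
    before the [n]-th failure in a fresh coin stack.  If the walk tends to
    [+oo], this chain survives for some [m], and if the walk is recurrent it dies
    for every [m]; every other behaviour is the mirror image of these.

    The column [r] solves the Poisson equation [(I - K) r = 2 p - 1], normalised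
    to have mean zero under the stationary law of the state that follows a
    failure.  So [successes - failures + r(state)] is a martingale within a
    stack, and since the chain observed at failures mixes geometrically,
    [E (F n) = n + eta r + O(1/n)], [E (F n - n)^2 = nu n + O(1)] and
    [E (F n - n)^4 = O(n^2)].  By Taylor expansion [1 / ln (F n)] is eventually a
    supermartingale when [delta > 1], so that extinction has small probability
    for large [m]; and [sqrt (ln (F n))] is one when [delta <= 1], critical case
    included, so that extinction is certain.  Finally [rt = c 1 - r] for a
    constant [c], and [delta + deltat = 1 - 2 / nu] with
    [nu = 2 + 2 c > 0] being twice the asymptotic variance of that martingale. *)
Require Import Defs.
From HB Require Import structures.
From mathcomp Require Import all_boot all_order all_algebra.
From mathcomp Require Import zify ring lra.
From mathcomp Require Import all_classical all_reals all_analysis.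
Set Implicit Arguments. Unset Strict Implicit. Unset Printing Implicit Defensive.
Import Order.TTheory GRing.Theory Num.Theory.
Local Open Scope ring_scope.

(** * Coin stacks and the walk they drive *)

(** Only the probabilities of finite cylinders are given, so no expectation under [P] is ever
    formed. Laws are the recursive weights [Qlaw] and [qlaw], and martingale arguments become
    inequalities between finite sums cut at an arbitrary [M]; optional stopping is replaced by
    supersolutions and minimum principles on the finite set of states. A Taylor bound must then hold
    at every value of [F n], far ones included. Each Lyapunov function is therefore dominated
    globally by a quartic polynomial, whose fourth-order term pays both for the cubic remainder and
    for large deviations; this is why a fourth moment is needed. At [delta = 1] the leading drift of
    [ln (F n)] vanishes. The square root contributes a concavity gain of relative order [1 / ln n],
    against errors of order [1 / (ln n)^2]. The inequality [delta + deltat < 1] also serves inside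
    the proof: when one parameter exceeds [1] the other does not, so the mirrored criterion excludes
    escape in the opposite direction. *)

Definition cnt (v : bool) (b : nat -> bool) (L : nat) : nat :=
  (\sum_(j < L) (b j == v))%N.

(** [succ_before b n k]: the coins [b] show exactly [k] successes before the
    [n]-th failure.  A relation, since a stack may contain fewer than [n] failures. *)
Definition succ_before (b : nat -> bool) (n k : nat) : bool :=
  (cnt false b (n + k) == n) && ((n + k == 0)%N || ~~ b (n + k).-1).

Lemma cntS v b L : cnt v b L.+1 = (cnt v b L + (b L == v))%N.
Proof. by rewrite /cnt big_ord_recr. Qed.

Lemma cnt0 v b : cnt v b 0 = 0%N.
Proof. by rewrite /cnt big_ord0. Qed.

Lemma cnt_recl v b L :
  cnt v b L.+1 = ((b 0%N == v) + cnt v (b \o succn) L)%N.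
Proof. by rewrite /cnt big_ord_recl. Qed.

Lemma cntTF b L : (cnt true b L + cnt false b L)%N = L.
Proof. by elim: L => [|L IH]; rewrite ?cnt0 // !cntS; case: (b L) => /=; lia. Qed.

Lemma cnt_mono v b L L' : (L <= L')%N -> (cnt v b L <= cnt v b L')%N.
Proof.
move=> h; rewrite -(subnK h); elim: (L' - L)%N => // k IH.
by rewrite addSn cntS; lia.
Qed.

(** Reading off the first coin; [Qlaw] obeys the same recursion, which is how its meaning is
    established in [stack_sum_succ_before]. *)
Lemma succ_before_cons b n k :
  succ_before b n k = match n with
  | 0%N => k == 0%N
  | n'.+1 => if b 0%N then (0 < k)%N && succ_before (b \o succn) n k.-1
             else succ_before (b \o succn) n' k end.
Proof.
rewrite /succ_before; case: n => [|n].
  rewrite add0n; case: k => [|k]; first by rewrite cnt0.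
  rewrite cntS /=; case: (b k) => /=; last by rewrite addn1 andbT; lia.
  by rewrite andbF.
rewrite addSn cnt_recl /=; case: ifP => b0 /=.
  case: k => [|k].
    rewrite addn0 /=; apply/negbTE/negP => /andP[/eqP h _].
    have := cntTF (b \o succn) n; lia.
  by rewrite /= addnS addSn /= add0n.
have -> : (1 + cnt false (b \o succn) (n + k) == n.+1)
  = (cnt false (b \o succn) (n + k) == n) by lia.
by congr andb; case: (n + k)%N => [|m] //=; rewrite b0.
Qed.

Lemma succ_before0 b k : succ_before b 0 k = (k == 0%N).
Proof. by rewrite succ_before_cons. Qed.

Lemma succ_beforeS b n k : succ_before b n.+1 k =
  if b 0%N then (0 < k)%N && succ_before (b \o succn) n.+1 k.-1 else succ_before (b \o succn) n k.
Proof. by rewrite succ_before_cons. Qed.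

(** A nonempty reading stops at a failure, so a longer one would contain an extra failure. This
    makes the events indexed by [k] disjoint. *)
Lemma succ_before_inj b n k k' : succ_before b n k -> succ_before b n k' -> k = k'.
Proof.
wlog: k k' / (k <= k')%N => [W h h'|le_k].
  case: (leqP k k') => h1; first exact: W.
  by apply/esym/W => //; apply: ltnW.
rewrite /succ_before => /andP[/eqP h1 h2] /andP[/eqP h3 h4].
case: (ltngtP k k') le_k => // lt_k _.
have E : (n + k' = (n + k').-1.+1)%N by lia.
move: h4; rewrite E /= => h4.
have := cntS false b (n + k').-1; rewrite -E h3 (negbTE h4) /=.
have := @cnt_mono false b (n + k) (n + k').-1; lia.
Qed.

Section Walk.
Variable c : int -> nat -> bool.
Local Notation X := (walk c).

Definition visits (n : nat) (x : int) : nat := (\sum_(i < n) (X i == x))%N.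

Lemma visitsS n x : visits n.+1 x = (visits n x + (X n == x))%N.
Proof. by rewrite /visits big_ord_recr. Qed.

Lemma count_hist n x : count (pred1 x) (walk_hist c n) = visits n.+1 x.
Proof.
elim: n => [|n IH]; first by rewrite visitsS /visits big_ord0 /= addn0.
by rewrite visitsS -IH /= /walk /= last_rcons -cats1 count_cat /= addn0.
Qed.

Lemma walkS n :
  X n.+1 = if c (X n) (visits n (X n)) then X n + 1 else X n - 1.
Proof.
rewrite {1}/walk /= last_rcons count_hist -/(walk c n) visitsS eqxx addn1 /=.
by [].
Qed.

Lemma walk0 : X 0 = 0. Proof. by []. Qed.

Lemma walk_step n : X n.+1 = X n + 1 \/ X n.+1 = X n - 1.
Proof. by rewrite walkS; case: ifP; [left|right]. Qed.

(** The left-hand side counts the steps from [x] to [x + 1] before time [n], and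
    [cnt false] on the right those from [x + 1] to [x]. *)
Lemma flow_right n (x : nat) :
  cnt true (c x) (visits n x)
  = (cnt false (c x.+1%:Z) (visits n x.+1%:Z) + (x.+1%:Z <= X n)%R)%N.
Proof.
elim: n => [|n IH]; first by rewrite /visits !big_ord0 !cnt0 walk0.
rewrite !visitsS walkS.
move: IH; case: (eqVneq (X n) x%:Z) => [->|h1] IH.
  have -> : (x%:Z == x.+1%:Z) = false by apply/negbTE; lia.
  rewrite addn0 addn1 cntS.
  move: IH; case: (c x (visits n x)) => /= IH; rewrite ?addn0 IH; lia.
move: IH; case: (eqVneq (X n) x.+1%:Z) => [->|h2] IH.
  rewrite addn0 addn1 cntS.
  move: IH; case: (c _ (visits n x.+1%:Z)) => /= IH; rewrite ?addn0 IH; lia.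
by rewrite !addn0 IH; congr addn; case: ifP => _; congr nat_of_bool; lia.
Qed.

(** Unit steps cannot cross [x] without a visit, so the walk stays on the side chosen by the coin of
    its last visit. *)
Lemma last_coin n x : (0 < visits n x)%N -> X n != x ->
  c x (visits n x).-1 = (x < X n)%R.
Proof.
elim: n x => [|n IH] x; first by rewrite /visits big_ord0.
rewrite visitsS walkS.
case: (eqVneq (X n) x) => [->|h1].
  by rewrite addn1 /= => _; case: (c x _) => h; lia.
rewrite addn0 => v0; rewrite (IH x) //.
by case: (c (X n) _) => h; lia.
Qed.

(** The branching-like process of right excursions from [0], started from [m]. *)
Definition dies (m : nat) : Prop :=
  exists t (v : nat -> nat), [/\ v 0%N = m, v t = 0%N &
    forall i, (i < t)%N -> succ_before (c i.+1%:Z) (v i) (v i.+1)].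

Lemma walk_bound n : (X n <= n%:Z)%R.
Proof. by elim: n => // n IH; case: (walk_step n) => ->; lia. Qed.

Lemma visits_mono n n' x : (n <= n')%N -> (visits n x <= visits n' x)%N.
Proof.
move=> h; rewrite -(subnK h); elim: (n' - n)%N => // k IH.
by rewrite addSn visitsS; lia.
Qed.

Lemma visits_gt n (x : int) : (n%:Z <= x)%R -> visits n x = 0%N.
Proof.
elim: n => [|n IH] h; first by rewrite /visits big_ord0.
rewrite visitsS IH; last lia.
by have := walk_bound n; case: eqVneq => // e; lia.
Qed.

(** Take for [m] the total number of right steps from [0]. If values [v] led to extinction, then
    [v i] would bound the right steps made from [i] at all times ([Q]), and site [t] would never be
    left to the right. *)
Lemma walk_to_pinfty_not_dies :
  (forall M : int, exists n0, forall n, (n0 <= n)%N -> M <= X n) ->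
  exists m, ~ dies m.
Proof.
move=> H; have [n1 Hn1] := H 1.
pose u n (x : nat) := cnt true (c x) (visits n x).
have umono n n' x : (n <= n')%N -> (u n x <= u n' x)%N.
  by move=> h; apply/cnt_mono/visits_mono.
exists (u n1 0%N) => -[t [v [v0 vt Hv]]].
have const0 n : (n1 <= n)%N -> visits n 0 = visits n1 0.
  move=> h; rewrite -(subnK h); elim: (n - n1)%N => // k IH.
  rewrite addSn visitsS IH.
  by have := Hn1 (k + n1)%N (leq_addl _ _); case: eqVneq => [->|_]; lia.
have Q i : (i <= t)%N -> forall n, (u n i <= v i)%N.
  elim: i => [_|i IH lt n].
    move=> n; rewrite v0; case: (leqP n n1) => h; first exact: umono.
    by rewrite /u const0 //; apply: ltnW.
  have [n2 Hn2] := H i.+2%:Z.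
  apply: (@leq_trans (u (n + n2)%N i.+1)); first by apply: umono; lia.
  have := Hn2 (n + n2)%N (leq_addl _ _); set n3 := (n + n2)%N => h.
  have := flow_right n3 i; rewrite -/(u n3 i).
  have -> : (i.+1%:Z <= X n3)%R by lia.
  move=> f; have := IH (ltnW lt) n3 => g.
  have /andP[/eqP f1 f2] := Hv i lt.
  have lt2 : (visits n3 i.+1%:Z < v i + v i.+1)%N.
    rewrite ltnNge; apply/negP => kappa_src.
    by have := cnt_mono false (c i.+1%:Z) kappa_src; lia.
  have := cnt_mono true (c i.+1%:Z) (ltnW lt2).
  by have := cntTF (c i.+1%:Z) (v i + v i.+1)%N; rewrite /u; lia.
have [n2 Hn2] := H t.+1%:Z.
have := flow_right n2 t; rewrite (Hn2 n2) //.
by have := Q t (leqnn _) n2; rewrite vt /u; lia.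
Qed.

(** At a return to [0] every right step from a site [i >= 0] has been undone: the failures read at
    [i + 1] are as many as the successes read at [i], and the last coin read there is a failure
    because the walk now lies to its left. Site [n] is still unvisited, hence extinction by then. *)
Lemma return_dies n : X n = 0 -> dies (cnt true (c 0) (visits n 0)).
Proof.
move=> Xn; exists n, (fun i => cnt true (c i%:Z) (visits n i%:Z)); split=> //.
  by rewrite visits_gt // cnt0.
move=> i _; have := flow_right n i; rewrite Xn.
have -> : (i.+1%:Z <= 0 :> int) = false by lia.
rewrite addn0 => ->; rewrite /succ_before addnC cntTF eqxx /=.
case: posnP => //= h; rewrite (last_coin h) Xn //; lia.
Qed.

Definition often (x : int) : Prop := forall n0, exists2 n, (n0 <= n)%N & X n = x.

Definition rich : Prop := forall x v j, exists2 k, (j <= k)%N & c x k = v.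

Lemma often_visits x : often x -> forall m, exists2 n, X n = x & visits n x = m.
Proof.
move=> H; elim=> [|m [n Xn vn]].
  have [n _ Xn] := H 0%N.
  have ex : exists n, X n == x by exists n; rewrite Xn.
  case: (ex_minnP ex) => k /eqP Xk mink; exists k => //.
  apply/eqP; rewrite -leqn0 /visits big1 // => i _.
  by case: eqVneq => // e; have := mink i; rewrite e eqxx; have := ltn_ord i; lia.
have [n' _ Xn'] := H n.+1.
have [n'' h'' Xn''] := H n.+1.
have ex : exists k, (n < k)%N && (X k == x) by exists n''; rewrite h'' Xn'' /=.
case: (ex_minnP ex) => k /andP[nk /eqP Xk] mink; exists k => //.
have : forall j, (n + j < k)%N -> visits (n + j.+1) x = m.+1.
  elim=> [_|j IH h]; first by rewrite addn1 visitsS Xn eqxx vn addn1.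
  rewrite addnS visitsS IH; last lia.
  case: eqVneq => [e|_]; last by rewrite addn0.
  by have := mink (n + j.+1)%N; rewrite e eqxx; lia.
move=> /(_ (k - n).-1) h; rewrite -h; last lia.
by congr visits; lia.
Qed.

Lemma cnt_unbounded (b : nat -> bool) v :
  (forall j, exists2 k, (j <= k)%N & b k = v) ->
  forall m, exists2 L, b L = v & cnt v b L = m.
Proof.
move=> H; elim=> [|m [L bL cL]].
  have [n _ bn] := H 0%N.
  have ex : exists n, b n == v by exists n; rewrite bn.
  case: (ex_minnP ex) => k /eqP Xk mink; exists k => //.
  apply/eqP; rewrite -leqn0 /cnt big1 // => i _.
  by case: eqVneq => // e; have := mink i; rewrite e eqxx; have := ltn_ord i; lia.
have [n'' h'' bn''] := H L.+1.
have ex : exists k, (L < k)%N && (b k == v) by exists n''; rewrite h'' bn'' /=.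
case: (ex_minnP ex) => k /andP[nk /eqP Xk] mink; exists k => //.
have : forall j, (L + j < k)%N -> cnt v b (L + j.+1) = m.+1.
  elim=> [_|j IH h]; first by rewrite addn1 cntS bL eqxx cL addn1.
  rewrite addnS cntS IH; last lia.
  case: eqVneq => [e|_]; last by rewrite addn0.
  by have := mink (L + j.+1)%N; rewrite e eqxx; lia.
move=> /(_ (k - L).-1) h; rewrite -h; last lia.
by congr cnt; lia.
Qed.

(** Among the visits to [0] is the one that reads the success preceded by exactly [m] others;
    [return_dies] applies at that time. *)
Lemma recurrent_dies : rich -> often 0 -> forall m, dies m.
Proof.
move=> rc of0 m.
have [L _ <-] := cnt_unbounded (rc 0 true) m.
have [n Xn <-] := often_visits of0 L.
exact: return_dies.
Qed.

Lemma often_step v x : rich -> often x -> often (if v then x + 1 else x - 1).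
Proof.
move=> rc ofx n0.
(* A coin with such an index has not been read before time [n0], so the step it triggers is a late
   one. *)
have [k hk ck] := rc x v (visits n0 x).
have [n Xn vn] := often_visits ofx k.
exists n.+1; last by rewrite walkS Xn vn ck.
rewrite leqNgt; apply/negP => h.
have := @visits_mono n.+1 n0 x (ltnW h); rewrite visitsS Xn eqxx vn; lia.
Qed.

Lemma often_all x y : rich -> often x -> often y.
Proof.
move=> rc ofx.
have up k : often (x + k%:Z).
  elim: k => [|k IH]; first by rewrite addr0.
  have -> : x + k.+1%:Z = x + k%:Z + 1 by lia.
  exact: (often_step true rc IH).
have dn k : often (x - k%:Z).
  elim: k => [|k IH]; first by rewrite subr0.
  have -> : x - k.+1%:Z = x - k%:Z - 1 by lia.
  exact: (often_step false rc IH).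
case: (lerP x y) => h.
  by have -> : y = x + `|y - x|%N%:Z by lia.
by have -> : y = x - `|x - y|%N%:Z by lia.
Qed.

Definition to_pinfty := forall M : int, exists n0, forall n, (n0 <= n)%N -> M <= X n.
Definition to_ninfty := forall M : int, exists n0, forall n, (n0 <= n)%N -> X n <= M.

Lemma not_often x : ~ often x -> exists n0, forall n, (n0 <= n)%N -> X n != x.
Proof.
move=> /existsNP[n0 h]; exists n0 => n hn; apply/eqP => Xn.
by apply: h; exists n.
Qed.

(** In a rich environment one site visited infinitely often makes all sites so. Otherwise every
    bounded interval is left for good, and unit steps then fix the sign of the walk. *)
Lemma trichotomy : rich -> [\/ often 0, to_pinfty | to_ninfty].
Proof.
move=> rc; case: (pselect (often 0)) => [of0|no]; first by apply: Or31.
have {no} H x : exists n0, forall n, (n0 <= n)%N -> X n != x.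
  by apply: not_often => ofx; apply: no; apply: often_all ofx.
have away (B : nat) : exists nb, forall n, (nb <= n)%N -> B%:Z < `|X n|.
  elim: B => [|B [nb hb]].
    by have [nb hb] := H 0; exists nb => n hn; have := hb n hn; lia.
  have [n1 h1] := H B.+1%:Z; have [n2 h2] := H (- B.+1%:Z).
  exists (nb + n1 + n2)%N => n hn.
  have := hb n ltac:(lia); have := h1 n ltac:(lia); have := h2 n ltac:(lia); lia.
have side : exists n0, (forall n, (n0 <= n)%N -> 0 <= X n) \/ (forall n, (n0 <= n)%N -> X n <= 0).
  have [n0 h0] := away 0%N; exists n0.
  case: (lerP 0 (X n0)) => hX; [left|right] => n hn; rewrite -(subnK hn);
    elim: (n - n0)%N => [|k IH]; rewrite ?add0n ?addSn; try lia;
    have := h0 (k + n0)%N (leq_addl _ _); case: (walk_step (k + n0)) => ->; lia.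
have [n0 [h0|h0]] := side; [apply: Or32|apply: Or33] => M;
  have [nb hb] := away `|M|%N; exists (n0 + nb)%N => n hn;
  have := h0 n ltac:(lia); have := hb n ltac:(lia); lia.
Qed.

End Walk.

Definition flip (c : int -> nat -> bool) : int -> nat -> bool :=
  fun x k => ~~ c (- x) k.

Lemma walk_flip c n : walk (flip c) n = - walk c n.
Proof.
have : walk_hist (flip c) n = map -%R (walk_hist c n).
  elim: n => [|n IH]; first by rewrite /= oppr0.
  rewrite /= IH map_rcons; congr rcons.
  rewrite (_ : last 0 (map -%R (walk_hist c n)) = - last 0 (walk_hist c n)); last first.
    by rewrite -[X in last X (map _ _)]oppr0 last_map.
  rewrite /flip opprK count_map.
  have -> : count (preim -%R (pred1 (- last 0 (walk_hist c n)))) (walk_hist c n)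
     = count (pred1 (last 0 (walk_hist c n))) (walk_hist c n).
    by apply: eq_count => y /=; rewrite eqr_opp.
  by case: (c _ _) => /=; lia.
by rewrite /walk => ->; rewrite -[X in last X (map _ _)]oppr0 last_map.
Qed.

(** * The Poisson equation and the parameters delta *)

Section FiniteBounds.
Variables (R : realType) (N : nat).

Lemma fin_ub (f : 'I_N -> R) : exists2 B, 0 < B & forall i, `|f i| <= B.
Proof.
exists (1 + \sum_i `|f i|) => [|i]; first by rewrite ltr_pwDl // sumr_ge0.
rewrite (bigD1 i) //= addrCA lerDl addr_ge0 // sumr_ge0 //.
Qed.

Lemma fin_lb (f : 'I_N -> R) : (forall i, 0 < f i) ->
  exists2 a, 0 < a & forall i, a <= f i.
Proof.
move=> f0; have [B B0 HB] := fin_ub (fun i => (f i)^-1).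
exists B^-1 => [|i]; first by rewrite invr_gt0.
rewrite -[leRHS]invrK lef_pV2 ?posrE ?invr_gt0 //.
by apply: le_trans (HB i); rewrite ler_norm.
Qed.

Lemma fin_argmin (f : 'I_N -> R) (i0 : 'I_N) : exists i, forall j, f i <= f j.
Proof.
have := @Order.TotalTheory.arg_minP _ R 'I_N i0 xpredT f isT.
by case=> i _ h; exists i => j; apply: h.
Qed.

Lemma unitmx_ker0 (M : 'M[R]_N) :
  (forall v : 'cV_N, M *m v = 0 -> v = 0) -> M \in unitmx.
Proof.
move=> H; rewrite -unitmx_tr -row_free_unit -kermx_eq0; apply/rowV0P => v.
move=> /sub_kermxP /(congr1 trmx); rewrite trmx_mul trmxK trmx0 => /H.
by move=> /(congr1 trmx); rewrite trmxK trmx0.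
Qed.

End FiniteBounds.

Section Chain.
Variables (R : realType) (N : nat) (K : 'M[R]_N).
Hypothesis stK : stochastic K.

Definition Kop (f : 'I_N -> R) (i : 'I_N) : R := \sum_j K i j * f j.

Lemma Kop_ext f g : f =1 g -> Kop f =1 Kop g.
Proof. by move=> h i; apply: eq_bigr => j _; rewrite h. Qed.
Lemma KopD f g i : Kop (fun j => f j + g j) i = Kop f i + Kop g i.
Proof. by rewrite /Kop -big_split; apply: eq_bigr => j _ /=; rewrite mulrDr. Qed.
Lemma KopZ a f i : Kop (fun j => a * f j) i = a * Kop f i.
Proof. by rewrite /Kop mulr_sumr; apply: eq_bigr => j _; rewrite mulrCA. Qed.
Lemma KopB f g i : Kop (fun j => f j - g j) i = Kop f i - Kop g i.
Proof. by rewrite /Kop -sumrB; apply: eq_bigr => j _ /=; rewrite mulrBr. Qed.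
Lemma Kopc a i : Kop (fun=> a) i = a.
Proof. by rewrite /Kop -mulr_suml stK.2 mul1r. Qed.
Lemma Kop_le f g : (forall i, f i <= g i) -> forall i, Kop f i <= Kop g i.
Proof. by move=> h i; apply: ler_sum => j _; apply: ler_wpM2l => //; apply: stK.1. Qed.
Lemma Kop_ge a f : (forall i, a <= f i) -> forall i, a <= Kop f i.
Proof. by move=> h i; rewrite -(Kopc a i); apply: Kop_le. Qed.
Lemma Kop_leb a f : (forall i, f i <= a) -> forall i, Kop f i <= a.
Proof. by move=> h i; rewrite -(Kopc a i); apply: Kop_le. Qed.
Lemma Kop_norm B f : (forall i, `|f i| <= B) -> forall i, `|Kop f i| <= B.
Proof.
move=> h i; rewrite ler_norml; apply/andP; split.
  by apply: Kop_ge => j; have := h j; rewrite ler_norml => /andP[].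
by apply: Kop_leb => j; have := h j; rewrite ler_norml => /andP[].
Qed.
Lemma mx_Kop (v : 'cV[R]_N) i : (K *m v) i 0 = Kop (v^~ 0) i.
Proof. by rewrite mxE. Qed.

Definition edge := [rel a b | 0 < K a b].

(** Among the states reachable from [i], one with the fewest reachable states spans a closed
    irreducible set, which by uniqueness is [C]. A state reachable from everywhere is the form in
    which uniqueness is used below. *)
Lemma exists_sink : (exists! C : {set 'I_N}, closed_irreducible K C) ->
  exists j0, forall i, connect edge i j0.
Proof.
case=> C [[/finset.set0Pn[j0 j0C] [Ccl Cir]] Cuniq]; exists j0 => i.
pose reach k := [set j | connect edge k j]%SET.
pose f k := #|reach k|.
have [k ik kmin] := @Order.TotalTheory.arg_minP _ nat 'I_N i (fun k => connect edge i k) f (connect0 _ _).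
have sub l : connect edge k l -> reach l = reach k.
  move=> kl; apply/eqP; rewrite eqEcard; apply/andP; split.
    by apply/fintype.subsetP => x; rewrite !inE; apply: connect_trans.
  by apply: kmin; apply: connect_trans kl.
have ci : closed_irreducible K (reach k).
  split; [|split].
  - by apply/finset.set0Pn; exists k; rewrite inE connect0.
  - move=> a b; rewrite !inE => ka ab; apply: (connect_trans ka).
    exact: connect1.
  - move=> a b; rewrite !inE => ka kb.
    by have := sub _ ka => /finset.setP/(_ b); rewrite !inE kb.
have kC : k \in C by rewrite (Cuniq _ ci) inE connect0.
exact: connect_trans ik (Cir _ _ kC j0C).
Qed.

Variable j0 : 'I_N.
Hypothesis sink : forall i, connect edge i j0.

(** If [f] attains its minimum at a state, it does so at all successors; the minimum thus propagates
    along a path to [j0]. *)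
Lemma harmonic_ge f : (forall i, Kop f i <= f i) -> forall i, f j0 <= f i.
Proof.
move=> h; have [m mmin] := fin_argmin f j0.
suff E : f j0 = f m by move=> i; rewrite E.
have step a b : f a = f m -> edge a b -> f b = f m.
  move=> fa /= ab; have := h a; rewrite /Kop (bigD1 b) //= fa.
  have : \sum_(j | j != b) K a j * f m <= \sum_(j | j != b) K a j * f j.
    by apply: ler_sum => j _; apply: ler_wpM2l => //; apply: stK.1.
  have := stK.2 a; rewrite (bigD1 b) //= -mulr_suml => s1.
  have -> : \sum_(j | j != b) K a j = 1 - K a b by lra.
  move=> h1 h2; have /le_trans/(_ h2) := lerD (lexx (K a b * f b)) h1.
  move=> h3; apply/eqP; rewrite eq_le mmin andbT.
  by rewrite -(ler_pM2l ab); lra.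
have /connectP[s] := sink m.
have : f m = f m by [].
elim: s {1 3 4}m => [|b s IH] a /= fa; first by move=> _ ->.
by case/andP => ab pb; apply: IH (step _ _ fa ab) pb.
Qed.

Lemma harmonic_const f : (forall i, Kop f i = f i) -> forall i, f i = f j0.
Proof.
move=> h i; apply/eqP; rewrite eq_le harmonic_ge ?andbT => [|k]; last by rewrite h.
rewrite -lerN2; apply: (@harmonic_ge (fun i => - f i)) => k.
by rewrite -[X in _ <= - X]h -(mulN1r (Kop _ _)) -KopZ; apply: Kop_le => j; rewrite mulN1r.
Qed.

Section Stationary.
Variable (mu : 'rV[R]_N).
Hypothesis stmu : stationary K mu.

Definition Em (f : 'I_N -> R) : R := \sum_i mu 0 i * f i.

Lemma Em_ext f g : f =1 g -> Em f = Em g.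
Proof. by move=> h; apply: eq_bigr => j _; rewrite h. Qed.
Lemma EmD f g : Em (fun j => f j + g j) = Em f + Em g.
Proof. by rewrite /Em -big_split; apply: eq_bigr => j _ /=; rewrite mulrDr. Qed.
Lemma EmB f g : Em (fun j => f j - g j) = Em f - Em g.
Proof. by rewrite /Em -sumrB; apply: eq_bigr => j _ /=; rewrite mulrBr. Qed.
Lemma EmZ a f : Em (fun j => a * f j) = a * Em f.
Proof. by rewrite /Em mulr_sumr; apply: eq_bigr => j _; rewrite mulrCA. Qed.
Lemma Emc a : Em (fun=> a) = a.
Proof. by rewrite /Em -mulr_suml stmu.1.2 mul1r. Qed.
Lemma Em_le f g : (forall i, f i <= g i) -> Em f <= Em g.
Proof. by move=> h; apply: ler_sum => j _; apply: ler_wpM2l => //; apply: stmu.1.1. Qed.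
Lemma EmK f : Em (Kop f) = Em f.
Proof.
rewrite /Em; under eq_bigr do rewrite /Kop mulr_sumr.
rewrite exchange_big /=; apply: eq_bigr => j _.
under eq_bigr do rewrite mulrA.
rewrite -mulr_suml; congr (_ * _).
by rewrite -[in RHS]stmu.2 mxE.
Qed.

Section Cookie.
Variable p : 'I_N -> R.
Hypothesis p01 : forall i, 0 < p i < 1.
Hypothesis mean : Em p = 2^-1.

Let M := 1%:M - K + 2%:R *: ((@onevec R N - pvec p) *m mu *m D1p p *m K).

(** Expectation under [2 mu D_{1-p} K], the stationary law of the state that
    follows a failure. *)
Definition Epi (f : 'I_N -> R) := 2 * Em (fun i => (1 - p i) * Kop f i).

Lemma Em_1p : Em (fun i => 1 - p i) = 2^-1.
Proof. by rewrite EmB Emc mean; lra. Qed.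

Lemma mulD1p (v : 'cV[R]_N) i : (D1p p *m v) i 0 = (1 - p i) * v i 0.
Proof.
by rewrite /D1p mulmxBl mul1mx mul_diag_mx !mxE mulrBl mul1r.
Qed.

Lemma mulDp (v : 'cV[R]_N) i : (Dp p *m v) i 0 = p i * v i 0.
Proof. by rewrite /Dp mul_diag_mx !mxE. Qed.

Lemma mul_mu (v : 'cV[R]_N) : (mu *m v) 0 0 = Em (v^~ 0).
Proof. by rewrite mxE. Qed.

Lemma mulM (v : 'cV[R]_N) i :
  (M *m v) i 0 = v i 0 - Kop (v^~ 0) i + (1 - p i) * Epi (v^~ 0).
Proof.
rewrite /M mulmxDl mulmxBl mul1mx -scalemxAl -!mulmxA !mxE big_ord1 -mx_Kop !mxE.
congr (_ + _); rewrite mulrCA; congr (_ * (_ * _)).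
by apply: eq_bigr => j _; rewrite mulD1p mx_Kop.
Qed.

Lemma Epic a : Epi (fun=> a) = a.
Proof.
rewrite /Epi; under Em_ext do rewrite Kopc mulrC.
by rewrite EmZ Em_1p; field.
Qed.

Lemma Epi_ext f g : f =1 g -> Epi f = Epi g.
Proof.
by move=> h; rewrite /Epi; congr (_ * _); apply: Em_ext => i; rewrite (Kop_ext h).
Qed.

Lemma EpiD f g : Epi (fun i => f i + g i) = Epi f + Epi g.
Proof.
rewrite /Epi -mulrDr -EmD; congr (_ * _); apply: Em_ext => i.
by rewrite KopD mulrDr.
Qed.

Lemma EpiB f g : Epi (fun i => f i - g i) = Epi f - Epi g.
Proof.
rewrite /Epi -mulrBr -EmB; congr (_ * _); apply: Em_ext => i.
by rewrite KopB mulrBr.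
Qed.

(** Averaging [M v = 0] under [mu] cancels [v - K v] and leaves [Epi v = 0]. So [v] is harmonic,
    hence constant, and equal to its [Epi] mean. *)
Lemma M_unit : M \in unitmx.
Proof.
apply: unitmx_ker0 => v Mv0.
have E i : v i 0 - Kop (v^~ 0) i + (1 - p i) * Epi (v^~ 0) = 0.
  by rewrite -mulM Mv0 mxE.
have pi0 : Epi (v^~ 0) = 0.
  have : Em (fun i => (v i 0 - Kop (v^~ 0) i) + Epi (v^~ 0) * (1 - p i)) = Em (fun=> 0).
    by apply: Em_ext => i; rewrite [_ * (1 - _)]mulrC E.
  rewrite EmD EmB EmK EmZ Em_1p Emc; lra.
have cst i : v i 0 = v j0 0.
  by apply: (@harmonic_const (v^~ 0)) => k; have := E k; rewrite pi0; lra.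
have : Epi (v^~ 0) = v j0 0.
  by rewrite (Epi_ext cst) Epic.
rewrite pi0 => v0; apply/matrixP => i j.
by rewrite ord1 cst -v0 mxE.
Qed.

Definition rfun (i : 'I_N) : R := rvec K mu p i 0.

(** By definition [M (r + 1) = p], and the constant [1] is harmonic with [Epi] mean [1]. *)
Lemma r_eq i : rfun i - Kop rfun i + (1 - p i) * (Epi rfun + 1) = p i.
Proof.
have : M *m (rvec K mu p + @onevec R N) = pvec p.
  by rewrite /rvec subrK mulmxA mulmxV ?mul1mx ?M_unit.
move=> /matrixP/(_ i 0); rewrite mulM [RHS]mxE => hM; rewrite -[RHS]hM.
have E : (rvec K mu p + @onevec R N)^~ 0 =1 (fun i => rfun i + 1).
  by move=> k; rewrite /= mxE [X in _ + X]mxE.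
have -> : Epi ((rvec K mu p + onevec R N)^~ 0) = Epi rfun + 1.
  by rewrite (Epi_ext E) EpiD Epic.
have /= Ei := E i; rewrite (Kop_ext E) KopD Kopc Ei; ring.
Qed.

Lemma pi_r : Epi rfun = 0.
Proof.
have : Em (fun i => (rfun i - Kop rfun i) + (Epi rfun + 1) * (1 - p i)) = Em p.
  by apply: Em_ext => i; rewrite [_ * (1 - _)]mulrC r_eq.
rewrite EmD EmB EmK EmZ Em_1p mean; lra.
Qed.

Lemma K_r i : Kop rfun i = rfun i - (2 * p i - 1).
Proof. by have := r_eq i; rewrite pi_r; lra. Qed.

(** The mean of [rfun] under the stationary law of the state that follows a success; it turns out to
    be the constant value of [r + rt]. *)
Definition cpar := 2 * Em (fun i => p i * Kop rfun i).

Lemma nuE : nu K mu p = 2 + 2 * cpar.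
Proof.
rewrite /nu -!mulmxA mul_mu /cpar.
have -> : Em ((Dp p *m (K *m rvec K mu p))^~ 0) = Em (fun i => p i * Kop rfun i).
  by apply: Em_ext => i; rewrite mulDp mx_Kop.
ring.
Qed.

(** [nu / 2] is the stationary mean of [(xi + r(R_1) - r(R_0))^2], where the
    step [xi = +-1] has variance [4 p (1 - p)] given the states. *)
Lemma nu_gt0 : 0 < nu K mu p.
Proof.
pose s i := 2 * p i - 1.
have e1 : Em (fun i => (1 - p i) * (rfun i - s i)) = 0.
  have := pi_r; rewrite /Epi => h.
  have <- : Em (fun i => (1 - p i) * Kop rfun i) = Em (fun i => (1 - p i) * (rfun i - s i)).
    by apply: Em_ext => i; rewrite K_r.
  lra.
have e2 : cpar = 2 * Em (fun i => p i * (rfun i - s i)).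
  by rewrite /cpar; congr (_ * _); apply: Em_ext => i; rewrite K_r.
have e3 : cpar = 2 * Em (fun i => s i * (rfun i - s i)).
  rewrite e2; congr (_ * _); rewrite -[RHS]addr0 -e1 -EmD; apply: Em_ext => i.
  by rewrite /s; ring.
(* The square is expanded with [K r = r - s]; stationarity identifies the means of [K (r^2)] and
   [r^2]. *)
have e4 : Em (fun i => Kop (fun j => (s i - rfun i + rfun j) ^+ 2) i)
   = Em (fun i => 2 * (s i * (rfun i - s i)) + s i ^+ 2).
  transitivity (Em (fun i => (Kop (fun j => rfun j ^+ 2) i) - (rfun i - s i) ^+ 2)).
    apply: Em_ext => i.
    transitivity (Kop (fun j => ((s i - rfun i) ^+ 2 + 2 * (s i - rfun i) * rfun j) + rfun j ^+ 2) i).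
      by apply: Kop_ext => j; ring.
    by rewrite KopD KopD KopZ Kopc K_r -/(s i); ring.
  rewrite EmB EmK -EmB; apply: Em_ext => i; ring.
have e5 : 1 + cpar = Em (fun i => 4 * (p i * (1 - p i)) + Kop (fun j => (s i - rfun i + rfun j) ^+ 2) i).
  rewrite EmD e4 -EmD e3 -EmZ -[X in X + _](Emc 1) -EmD; apply: Em_ext => i.
  by rewrite /s; ring.
have pq0 i : 0 < p i * (1 - p i).
  by have /andP[p0 p1] := p01 i; rewrite mulr_gt0 // subr_gt0.
have [a a0 ha] := fin_lb pq0.
rewrite nuE; suff : a <= 1 + cpar by lra.
rewrite e5 -(Emc a); apply: Em_le => i.
have h1 := ha i.
have : 0 <= Kop (fun j => (s i - rfun i + rfun j) ^+ 2) i.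
  by apply: Kop_ge => j; apply: sqr_ge0.
lra.
Qed.

End Cookie.

Lemma rvec_compl (p : 'I_N -> R) : rvec K mu (fun i => 1 - p i) = rtvec K mu p.
Proof.
have e1 : pvec (fun i => 1 - p i) = onevec R N - pvec p.
  by apply/matrixP => i j; rewrite !mxE.
have e2 : D1p (fun i => 1 - p i) = Dp p.
  apply/matrixP => i j; rewrite /D1p /Dp !mxE.
  by case: eqVneq => _; rewrite ?mulr1n ?mulr0n ?subr0 //=; ring.
by rewrite /rvec /rtvec e1 e2 !opprB [onevec R N + _]addrC subrK.
Qed.

Lemma Dp_compl (p : 'I_N -> R) : Dp (fun i => 1 - p i) = D1p p.
Proof.
apply/matrixP => i j; rewrite /D1p /Dp !mxE.
by case: eqVneq => _; rewrite ?mulr1n ?mulr0n ?subr0.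
Qed.

Lemma nu_compl (p : 'I_N -> R) : nu K mu (fun i => 1 - p i) = nut K mu p.
Proof. by rewrite /nu /nut Dp_compl rvec_compl. Qed.

Lemma delta_compl (eta : 'rV[R]_N) (p : 'I_N -> R) : delta K mu eta (fun i => 1 - p i) = deltat K mu eta p.
Proof. by rewrite /delta /deltat nu_compl rvec_compl. Qed.

Section Sum.
Variable p : 'I_N -> R.
Hypothesis p01 : forall i, 0 < p i < 1.
Hypothesis mean : Em p = 2^-1.
Variable eta : 'rV[R]_N.
Hypothesis eta1 : prob_vec eta.

Lemma mean_compl : Em (fun i => 1 - p i) = 2^-1.
Proof. by rewrite EmB Emc mean; lra. Qed.

Lemma delta_sum_lt1 : delta K mu eta p + deltat K mu eta p < 1.
Proof.
set p' := fun i => 1 - p i.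
have mean' := mean_compl.
(* The drifts [2 p - 1] and [1 - 2 p] of the two Poisson equations cancel, so the sum is
   harmonic. *)
have hc i : rfun p i + rfun p' i = rfun p j0 + rfun p' j0.
  apply: (@harmonic_const (fun i => rfun p i + rfun p' i)) => k.
  by rewrite KopD !K_r // /p'; ring.
set c := rfun p j0 + rfun p' j0 in hc.
(* A failure for [1 - p] is a success for [p], so the normalisation of the mirrored solution
   evaluates [cpar p]. *)
have c1 : cpar p = c.
  have /(congr1 (fun x => x / 2)) := pi_r mean'; rewrite /Epi mulrAC divff ?pnatr_eq0 // mul1r mul0r => h.
  have : Em (fun i => (1 - p' i) * Kop (rfun p') i) = Em (fun i => c * p i - p i * Kop (rfun p) i).
    apply: Em_ext => i.
    have -> : Kop (rfun p') i = c - Kop (rfun p) i.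
      by rewrite -(Kopc c i) -KopB; apply: Kop_ext => j; rewrite -(hc j); ring.
    by rewrite /p'; ring.
  rewrite h EmB EmZ mean /cpar; lra.
have c2 : cpar p' = c.
  have /(congr1 (fun x => x / 2)) := pi_r mean; rewrite /Epi mulrAC divff ?pnatr_eq0 // mul1r mul0r => h.
  have : Em (fun i => (1 - p i) * Kop (rfun p) i) = Em (fun i => c * p' i - p' i * Kop (rfun p') i).
    apply: Em_ext => i.
    have -> : Kop (rfun p) i = c - Kop (rfun p') i.
      by rewrite -(Kopc c i) -KopB; apply: Kop_ext => j; rewrite -(hc j); ring.
    by rewrite /p'; ring.
  rewrite h EmB EmZ mean' /cpar; lra.
have nu0 := nu_gt0 p01 mean.
have nuc : nu K mu p = 2 + 2 * c by rewrite nuE c1.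
rewrite -delta_compl -/p' /delta (_ : nu K mu p' = nu K mu p); last by rewrite nuc nuE c2.
have -> : (eta *m rvec K mu p') 0 0 = c - (eta *m rvec K mu p) 0 0.
  rewrite -[c]mul1r -eta1.2 mulr_suml !mxE -sumrB; apply: eq_bigr => i _.
  by rewrite -(hc i) /rfun; ring.
rewrite -mulrDl ltr_pdivrMr // nuc; lra.
Qed.

End Sum.
End Stationary.
End Chain.

(** * Moments of the number of successes before the n-th failure *)

Section Geometric.
Variable (R : realType) (t : R).
Hypothesis t01 : 0 <= t < 1.

Lemma geo_pow_ge0 n : 0 <= t ^+ n.
Proof. by rewrite exprn_ge0 //; case/andP: t01. Qed.

Lemma geo_sum_le l : \sum_(j < l) t ^+ j <= (1 - t)^-1.
Proof.
have t1 : 0 < 1 - t by have := t01; lra.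
rewrite -[leRHS]mul1r ler_pdivlMr //.
have -> : (\sum_(j < l) t ^+ j) * (1 - t) = 1 - t ^+ l.
  elim: l => [|l IH]; first by rewrite big_ord0 mul0r expr0 subrr.
  by rewrite big_ord_recr /= mulrDl IH exprS; ring.
have := geo_pow_ge0 l; lra.
Qed.

Lemma geo_lin_le n : n%:R * t ^+ n <= (1 - t)^-1.
Proof.
apply: le_trans (geo_sum_le n).
have -> : n%:R * t ^+ n = \sum_(i < n) t ^+ n by rewrite sumr_const card_ord mulr_natl.
apply: ler_sum => i _; apply: ler_wiXn2l; [by have := t01; lra|by have := t01; lra|exact: ltnW].
Qed.

(** Replaces the limit [T -> oo]: since [T * t ^+ T] is bounded, a negative [x] contradicts the
    Archimedean property. *)
Lemma geo_ge0 C x : 0 <= C -> (forall T, - (C * t ^+ T) <= x) -> 0 <= x.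
Proof.
move=> C0 h; rewrite leNgt; apply/negP => x0.
have t1 : 0 < 1 - t by have := t01; lra.
pose y := C * (1 - t)^-1 / (- x).
have y0 : 0 <= y by rewrite divr_ge0 ?mulr_ge0 ?invr_ge0 //; lra.
have := archi_boundP y0; set T := Num.bound y => hT.
have : T%:R * (- x) <= C * (1 - t)^-1.
  apply: (@le_trans _ _ (C * (T%:R * t ^+ T))).
    by rewrite mulrCA ler_wpM2l //; have := h T; lra.
  by rewrite ler_wpM2l // geo_lin_le.
have : y * (- x) < T%:R * (- x) by rewrite ltr_pM2r //; lra.
rewrite /y divfK; last by lra.
lra.
Qed.

End Geometric.

(** There is no cubic term because [cube_split] shares third-order errors between the second and the
    fourth power. *)
Definition quartic (R : realType) (x0 x1 x2 x4 z : R) : R :=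
  x0 + x1 * z + x2 * z ^+ 2 + x4 * z ^+ 4.

Section Moments.
Variables (R : realType) (N : nat) (K : 'M[R]_N) (mu : 'rV[R]_N) (p : 'I_N -> R).
Variable j0 : 'I_N.
Hypothesis stK : stochastic K.
Hypothesis sink : forall i, connect (edge K) i j0.
Hypothesis stmu : stationary K mu.
Hypothesis p01 : forall i, 0 < p i < 1.
Hypothesis mean : Em mu p = 2^-1.

Local Notation Kp := (Kop K).
Local Notation Emu := (Em mu).
Local Notation Epip := (Epi K mu p).
Local Notation r := (rfun K mu p).

Variable a : R.
Hypothesis a01 : 0 < a < 1.
Hypothesis pa : forall i, a <= 1 - p i.

Lemma pge0 i : 0 <= p i. Proof. by case/andP: (p01 i) => /ltW. Qed.
Lemma qge0 i : 0 <= 1 - p i. Proof. by have := p01 i; lra. Qed.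

(** At a minimiser [f m >= p m * f m], and [p m < 1]: a failure acts as killing. *)
Lemma min_principle f : (forall i, p i * Kp f i <= f i) -> forall i, 0 <= f i.
Proof.
move=> h; have [m mmin] := fin_argmin f j0.
suff m0 : 0 <= f m by move=> i; apply: le_trans (mmin i).
have h1 := h m; have h2 := Kop_ge stK mmin m.
have h3 : p m * f m <= p m * Kp f m by rewrite ler_wpM2l // pge0.
have : 0 <= (1 - p m) * f m by lra.
by rewrite pmulr_rge0 //; have := p01 m; lra.
Qed.

Let W := 1%:M - Dp p *m K.

Lemma mulW (v : 'cV[R]_N) i : (W *m v) i 0 = v i 0 - p i * Kp (v^~ 0) i.
Proof. by rewrite /W mulmxBl mul1mx -mulmxA !mxE -mx_Kop -mulDp !mxE. Qed.

Lemma W_unit : W \in unitmx.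
Proof.
apply: unitmx_ker0 => v Wv0.
have E i : v i 0 - p i * Kp (v^~ 0) i = 0 by rewrite -mulW Wv0 mxE.
apply/matrixP => i j; rewrite ord1 mxE; apply/eqP; rewrite eq_le; apply/andP; split.
  rewrite -oppr_ge0 -mulN1r; apply: (@min_principle (fun i => -1 * v i 0)) => k.
  by rewrite KopZ; have := E k; lra.
by apply: (@min_principle (fun i => v i 0)) => k; have := E k; lra.
Qed.

(** [Res g] is the expected sum of [g] over the states read until the first failure. *)
Definition Res (g : 'I_N -> R) (i : 'I_N) : R := (invmx W *m \col_j g j) i 0.

Lemma ResE g i : Res g i = p i * Kp (Res g) i + g i.
Proof.
have : W *m (invmx W *m \col_j g j) = \col_j g j.
  by rewrite mulmxA mulmxV ?mul1mx ?W_unit.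
move=> /matrixP/(_ i 0); rewrite mulW [RHS]mxE -/(Res g i) => <-.
by rewrite addrCA subrr addr0.
Qed.

Lemma Res_le f g : (forall i, f i - p i * Kp f i <= g i) -> forall i, f i <= Res g i.
Proof.
move=> h i; rewrite -subr_ge0; move: i.
apply: (@min_principle (fun i => Res g i - f i)) => i.
by rewrite KopB [X in _ <= X - _]ResE; have := h i; lra.
Qed.

Lemma Res_ge f g : (forall i, g i <= f i - p i * Kp f i) -> forall i, Res g i <= f i.
Proof.
move=> h i; rewrite -subr_ge0; move: i.
apply: (@min_principle (fun i => f i - Res g i)) => i.
by rewrite KopB [X in _ <= _ - X]ResE; have := h i; lra.
Qed.

Lemma Res_uniq f g : (forall i, f i = p i * Kp f i + g i) -> f =1 Res g.
Proof.
move=> h i; apply/eqP; rewrite eq_le; apply/andP; split.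
  by apply: Res_le => k; rewrite {1}h; lra.
by apply: Res_ge => k; rewrite {1}h; lra.
Qed.

Lemma Res_ext f g : f =1 g -> Res f =1 Res g.
Proof. by move=> h; apply: Res_uniq => i; rewrite ResE h. Qed.

Lemma ResD f g i : Res (fun j => f j + g j) i = Res f i + Res g i.
Proof.
symmetry; move: i; apply: (@Res_uniq (fun i => Res f i + Res g i)) => i.
by rewrite KopD {1}ResE {1}(ResE g); ring.
Qed.

Lemma ResZ b f i : Res (fun j => b * f j) i = b * Res f i.
Proof.
symmetry; move: i; apply: (@Res_uniq (fun i => b * Res f i)) => i.
by rewrite KopZ {1}ResE; ring.
Qed.

(** The constant [B / a] is a supersolution, since each cookie fails with probability at least
    [a]. *)
Lemma Res_norm B g : (forall i, `|g i| <= B) -> forall i, `|Res g i| <= B / a.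
Proof.
move=> h i; have a0 : 0 < a by have := a01; lra.
have B0 : 0 <= B by apply: le_trans (h j0).
have Ba : forall k, B <= B / a * (1 - p k).
  move=> k; rewrite mulrAC ler_pdivlMr // ler_wpM2l //.
rewrite ler_norml; apply/andP; split; move: i.
  apply: (@Res_le (fun=> - (B / a))) => k; rewrite Kopc //.
  by have := Ba k; have := h k; rewrite ler_norml; lra.
apply: (@Res_ge (fun=> B / a)) => k; rewrite Kopc //.
by have := Ba k; have := h k; rewrite ler_norml; lra.
Qed.

(** A renewal-reward identity: failures have stationary frequency [1 / 2]. Algebraically, [(1 - p) K
    (Res g) = K (Res g) - Res g + g], and [mu] cancels the first two terms. *)
Lemma pi_Res g : Epip (Res g) = 2 * Emu g.
Proof.
rewrite /Epi; congr (_ * _).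
transitivity (Emu (fun i => Kp (Res g) i - p i * Kp (Res g) i)).
  by apply: Em_ext => i; ring.
rewrite EmB (EmK stmu) -EmB; apply: Em_ext => i.
by rewrite {1}ResE; ring.
Qed.

(** Transition operator of the states that follow the successive failures. *)
Definition Gop (f : 'I_N -> R) : 'I_N -> R := Res (fun i => (1 - p i) * Kp f i).

Lemma GopE f i : Gop f i = p i * Kp (Gop f) i + (1 - p i) * Kp f i.
Proof. exact: ResE. Qed.

Lemma Gop_ext f g : f =1 g -> Gop f =1 Gop g.
Proof. by move=> h; apply: Res_ext => i; rewrite (Kop_ext K h). Qed.

Lemma GopD f g i : Gop (fun j => f j + g j) i = Gop f i + Gop g i.
Proof. by rewrite -ResD; apply: Res_ext => k; rewrite KopD mulrDr. Qed.

Lemma GopZ b f i : Gop (fun j => b * f j) i = b * Gop f i.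
Proof. by rewrite -ResZ; apply: Res_ext => k; rewrite KopZ mulrCA. Qed.

Lemma GopB f g i : Gop (fun j => f j - g j) i = Gop f i - Gop g i.
Proof.
rewrite -[in RHS]mulN1r -GopZ -GopD; apply: Gop_ext => k; ring.
Qed.

Lemma Gopc b i : Gop (fun=> b) i = b.
Proof.
symmetry; move: i; apply: (@Res_uniq (fun=> b)) => i.
by rewrite !Kopc //; ring.
Qed.

Lemma Gop_le f g : (forall i, f i <= g i) -> forall i, Gop f i <= Gop g i.
Proof.
move=> h; apply: Res_le => i; rewrite {1}GopE.
have := ler_wpM2l (qge0 i) (Kop_le stK h i); lra.
Qed.

Lemma Gop_norm B f : (forall i, `|f i| <= B) -> forall i, `|Gop f i| <= B.
Proof.
move=> h i; rewrite ler_norml; apply/andP; split.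
  by rewrite -(Gopc (- B) i); apply: Gop_le => j; have := h j; rewrite ler_norml => /andP[].
by rewrite -(Gopc B i); apply: Gop_le => j; have := h j; rewrite ler_norml => /andP[].
Qed.

Lemma pi_Gop f : Epip (Gop f) = Epip f.
Proof. by rewrite /Gop pi_Res. Qed.

Lemma pi_le f g : (forall i, f i <= g i) -> Epip f <= Epip g.
Proof.
move=> h; rewrite /Epi ler_wpM2l //; apply: (Em_le stmu) => i.
by rewrite ler_wpM2l ?qge0 //; apply: Kop_le.
Qed.

(** One failure step can cross a whole path of the chain, so no aperiodicity is needed. *)
Lemma Doeblin : exists2 c, 0 < c <= 1 &
  forall i, c <= Gop (fun j => (j == j0)%:R) i.
Proof.
set e : 'I_N -> R := fun j => (j == j0)%:R.
have e0 i : 0 <= e i by rewrite /e ler0n.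
have x0 i : 0 <= Gop e i by rewrite -(Gopc 0 i); apply: Gop_le.
have Ksum f i k : (forall j, 0 <= f j) -> K i k * f k <= Kp f i.
  move=> f0; rewrite /Kop (bigD1 k) //= lerDl sumr_ge0 // => j _.
  by rewrite mulr_ge0 //; apply: stK.1.
have step i s : path (edge K) i s -> last i s = j0 -> s != [::] -> 0 < Gop e i.
  elim: s i => [//|k s IH] i /= /andP[ik pk] lk _.
  rewrite GopE; case: s IH pk lk => [|k' s] IH pk lk.
    apply: ltr_wpDl; first by rewrite mulr_ge0 ?pge0 //; apply: Kop_ge.
    rewrite mulr_gt0 //; first by have := p01 i; lra.
    apply: lt_le_trans (Ksum _ i k e0); rewrite /e -lk /= eqxx mulr1.
    exact: ik.
  apply: ltr_wpDr; first by rewrite mulr_ge0 ?qge0 //; apply: Kop_ge.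
  rewrite mulr_gt0 //; first by have := p01 i; lra.
  apply: lt_le_trans (Ksum _ i k x0); rewrite mulr_gt0 //.
  exact: IH.
have xpos i : 0 < Gop e i.
  have [k ik] : exists k, 0 < K i k.
    apply/not_existsP => h; have := stK.2 i; rewrite big1 => [/eqP|j _].
      by rewrite eq_sym oner_eq0.
    by apply/eqP; rewrite eq_le stK.1 andbT leNgt; apply/negP; apply: h.
  have /connectP[s ps ls] := sink k.
  by apply: (step i (k :: s)) => //=; rewrite ps andbT.
have [c c0 hc] := fin_lb xpos; exists c => //; rewrite c0 /=.
apply: le_trans (hc j0) _; rewrite -[leRHS](Gopc 1 j0); apply: Gop_le => j.
by rewrite /e; case: eqP.
Qed.

(** The minorisation shrinks an interval [[u, v]] containing all values by the factor [1 - c]. Mean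
    zero under the invariant [Epi] keeps [0] in that interval, so its length bounds the values. *)
Lemma Gop_decay : exists2 t, 0 <= t < 1 & forall f, Epip f = 0 ->
  exists2 C, 0 < C & forall l i, `|iter l Gop f i| <= C * t ^+ l.
Proof.
have [c c01 hc] := Doeblin; set e := fun j => _ in hc.
exists (1 - c); first lra.
move=> f pif; have [B B0 hB] := fin_ub f; exists (2 * B); first lra.
have : forall l, exists u v, [/\ forall i, u <= iter l Gop f i <= v & v - u <= 2 * B * (1 - c) ^+ l].
  elim=> [|l [u [v [h1 h2]]]].
    exists (- B), B; split; last by rewrite expr0; lra.
    by move=> i /=; have := hB i; rewrite ler_norml.
  set g := iter l Gop f in h1.
  exists (u + c * (g j0 - u)), (v - c * (v - g j0)); split; last first.
    by rewrite exprS; have := h1 j0; nra.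
  move=> i /=; rewrite -/g; apply/andP; split.
    apply: (@le_trans _ _ (u + (g j0 - u) * Gop e i)).
      by rewrite lerD2l mulrC ler_wpM2l //; have := h1 j0; lra.
    rewrite -GopZ -[X in X + _](Gopc u i) -GopD; apply: Gop_le => j; rewrite /e.
    by case: eqP => [->|_]; rewrite ?mulr1 ?mulr0; have := h1 j; lra.
  apply: (@le_trans _ _ (v - (v - g j0) * Gop e i)).
    rewrite -GopZ -[X in X - _](Gopc v i) -GopB; apply: Gop_le => j; rewrite /e.
    by case: eqP => [->|_]; rewrite ?mulr1 ?mulr0; have := h1 j; lra.
  by rewrite lerD2l lerN2 mulrC ler_wpM2l //; have := h1 j0; lra.
move=> H l i; have [u [v [h1 h2]]] := H l.
have pi0 : Epip (iter l Gop f) = 0 by elim: (l) => //= k IH; rewrite pi_Gop.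
have u0 : u <= 0.
  rewrite -pi0 -[leLHS](Epic stK stmu mean); apply: pi_le => k.
  by have := h1 k; lra.
have v0 : 0 <= v.
  rewrite -pi0 -[leRHS](Epic stK stmu mean); apply: pi_le => k.
  by have := h1 k; lra.
apply: le_trans h2; rewrite ler_norml; have := h1 i; lra.
Qed.

(** The comparison is with [l * Epi ginf + S l], where [S l] sums the iterates of [Gop] on the
    centred source and is bounded by [Gop_decay]; the errors of the sources form a geometric sum. *)
Lemma lin_growth (t C : R) (x g : nat -> 'I_N -> R) (ginf : 'I_N -> R) :
  0 <= t < 1 -> (forall i, x 0%N i = 0) ->
  (forall l i, x l.+1 i = Gop (x l) i + g l i) ->
  (forall l i, `|g l i - ginf i| <= C * t ^+ l) ->
  exists2 C', 0 < C' & forall l i, `|x l i - l%:R * Epip ginf| <= C'.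
Proof.
move=> t01 x0 xS hg; set m := Epip ginf.
pose w i := ginf i - m.
have piw : Epip w = 0 by rewrite EpiB (Epic stK stmu mean) subrr.
have [s s01 /(_ w piw)[B B0 hB]] := Gop_decay.
pose S := fix S l := if l is l'.+1 then (fun i => Gop (S l') i + w i) else (fun=> 0).
have SE l i : S l.+1 i = S l i + iter l Gop w i.
  elim: l i => [|l IH] i; first by rewrite /= Gopc.
  rewrite [LHS]/= -/(S l.+1).
  rewrite (Gop_ext IH) GopD [in RHS]/=; ring.
have Sb l i : `|S l i| <= B / (1 - s).
  apply: (@le_trans _ _ (B * \sum_(j < l) s ^+ j)); last first.
    by rewrite ler_pM2l // geo_sum_le.
  elim: l i => [|l IH] i; first by rewrite /= normr0 big_ord0 mulr0.
  rewrite SE big_ord_recr /= mulrDr; apply: le_trans (ler_normD _ _) _.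
  by rewrite lerD.
have C0 : 0 <= C by have := hg 0%N j0; rewrite expr0 mulr1; apply: le_trans.
have key l i : `|x l i - l%:R * m - S l i| <= C * \sum_(j < l) t ^+ j.
  elim: l i => [|l IH] i; first by rewrite /= x0 mul0r !subr0 normr0 big_ord0 mulr0.
  have -> : x l.+1 i - l.+1%:R * m - S l.+1 i
    = Gop (fun j => x l j - l%:R * m - S l j) i + (g l i - ginf i).
    rewrite GopB GopB Gopc xS /= /w -natr1; ring.
  rewrite big_ord_recr /= mulrDr; apply: le_trans (ler_normD _ _) _.
  by rewrite lerD // Gop_norm.
exists (C / (1 - t) + B / (1 - s) + 1).
  have h1 : 0 <= C / (1 - t) by rewrite divr_ge0 //; lra.
  have h2 : 0 <= B / (1 - s) by rewrite divr_ge0 ?ltW //; lra.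
  by lra.
move=> l i; have := key l i; have := Sb l i.
have : C * \sum_(j < l) t ^+ j <= C / (1 - t) by rewrite ler_wpM2l // geo_sum_le.
rewrite !ler_norml; lra.
Qed.

(** * First and second moments within a stack *)

Lemma r_pi : Epip r = 0. Proof. exact: (pi_r stK sink stmu mean). Qed.
Lemma r_K i : Kp r i = r i - (2 * p i - 1).
Proof. exact: (K_r stK sink stmu mean). Qed.

(** With [z] the current value of successes minus failures and [l] failures to
    come, the final value has mean [z + rho l] and second moment
    [z^2 + 2 z rho l + kappa l]. *)
Definition rho (l : nat) (i : 'I_N) : R := r i - iter l Gop r i.
(** What one coin adds to [z^2 + 2 z rho]; the terms linear in [z] are accounted for by [rhoS]. *)
Definition kappa_src (l : nat) (i : 'I_N) : R :=
  1 + 2 * (p i * Kp (rho l.+1) i) - 2 * ((1 - p i) * Kp (rho l) i).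
Fixpoint kappa (l : nat) : 'I_N -> R :=
  if l is l'.+1 then fun i => Gop (kappa l') i + Res (kappa_src l') i else fun=> 0.

Lemma rho0 i : rho 0 i = 0. Proof. by rewrite /rho subrr. Qed.

Lemma rhoS l i :
  rho l.+1 i = p i * Kp (rho l.+1) i + (1 - p i) * Kp (rho l) i + (2 * p i - 1).
Proof.
rewrite {1}/rho [iter _ _ _ _]/= GopE /rho !KopB !r_K /=; ring.
Qed.

Lemma kappaS l i :
  kappa l.+1 i = p i * Kp (kappa l.+1) i + (1 - p i) * Kp (kappa l) i + kappa_src l i.
Proof.
rewrite /= {1}GopE {1}ResE KopD; ring.
Qed.

(** [r - rho l] is the [l]-th iterate of [Gop] on [r], which has [Epi] mean zero, so it decays
    geometrically. *)
Lemma rho_asym : exists2 C, 0 < C & forall l i, l%:R * `|rho l i - r i| <= C.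
Proof.
have [t t01 /(_ _ r_pi)[B B0 hB]] := Gop_decay.
exists (B / (1 - t)); first by rewrite divr_gt0 //; lra.
move=> l i; rewrite /rho addrC addKr normrN.
apply: (@le_trans _ _ (B * (l%:R * t ^+ l))).
  by rewrite mulrCA ler_wpM2l.
by rewrite ler_pM2l // geo_lin_le.
Qed.

(** The sources converge geometrically to [hinf], so the growth is linear with slope
    [Epi (Res hinf) = 2 Em hinf = 2 + 2 cpar]. *)
Lemma kappa_asym : exists2 C, 0 < C &
  forall l i, `|kappa l i - l%:R * nu K mu p| <= C.
Proof.
have [t t01 /(_ _ r_pi)[B B0 hB]] := Gop_decay.
pose hinf i := 1 + 2 * (p i * Kp r i) - 2 * ((1 - p i) * Kp r i).
have hd l i : `|kappa_src l i - hinf i| <= 4 * B * t ^+ l.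
  have -> : kappa_src l i - hinf i = 2 * ((1 - p i) * Kp (iter l Gop r) i)
      - 2 * (p i * Kp (iter l.+1 Gop r) i).
    by rewrite /kappa_src /hinf /rho !KopB; ring.
  have b1 := Kop_norm stK (hB l) i; have b2 := Kop_norm stK (hB l.+1) i.
  have h0 := geo_pow_ge0 t01 l.
  have b3 : B * t ^+ l.+1 <= B * t ^+ l.
    by rewrite ler_pM2l // exprS -[leRHS]mul1r ler_wpM2r //; lra.
  have b4 : `|(1 - p i) * Kp (iter l Gop r) i| <= B * t ^+ l.
    rewrite normrM (ger0_norm (qge0 i)) -[leRHS]mul1r ler_pM ?qge0 //.
    by have := p01 i; lra.
  have b5 : `|p i * Kp (iter l.+1 Gop r) i| <= B * t ^+ l.
    rewrite normrM (ger0_norm (pge0 i)) -[leRHS]mul1r ler_pM ?pge0 //.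
      by have := p01 i; lra.
    exact: le_trans b3.
  by move: b4 b5; rewrite !ler_norml; lra.
have nuE' : nu K mu p = Epip (Res hinf).
  rewrite pi_Res (nuE _ _ p) /cpar /hinf EmB EmD EmZ (Emc stmu) EmZ.
  have := r_pi; rewrite /Epi; lra.
rewrite nuE'; apply: (@lin_growth t (4 * B / a) kappa (fun l => Res (kappa_src l))) => //.
move=> l i; have -> : Res (kappa_src l) i - Res hinf i = Res (fun j => kappa_src l j - hinf j) i.
  rewrite -[in LHS]mulN1r -ResZ -ResD; apply: Res_ext => k; ring.
rewrite mulrAC; exact: Res_norm (hd l) i.
Qed.

Definition step_mean (i : 'I_N) (F : bool -> 'I_N -> R) : R :=
  p i * Kp (F true) i + (1 - p i) * Kp (F false) i.

Lemma step_mean_le i F F' : (forall b j, F b j <= F' b j) -> step_mean i F <= step_mean i F'.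
Proof.
by move=> h; apply: lerD; apply: ler_wpM2l; rewrite ?pge0 ?qge0 //; apply: Kop_le.
Qed.

Lemma step_meanD i F F' : step_mean i (fun b j => F b j + F' b j) = step_mean i F + step_mean i F'.
Proof. by rewrite /step_mean !KopD; ring. Qed.
Lemma step_meanZ i c F : step_mean i (fun b j => c * F b j) = c * step_mean i F.
Proof. by rewrite /step_mean !KopZ; ring. Qed.
Lemma step_meanc i c : step_mean i (fun _ _ => c) = c.
Proof. by rewrite /step_mean !Kopc //; ring. Qed.

Definition zeta i (b : bool) j : R := (if b then 1 else -1) + r j - r i.

Lemma step_mean_zeta i : step_mean i (zeta i) = 0.
Proof. by rewrite /step_mean /zeta !KopB !KopD !Kopc // r_K; ring. Qed.

Lemma zeta_bound : exists2 B, 1 <= B & forall i b j, `|zeta i b j| <= B /\ `|r i| <= B.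
Proof.
have [B B0 hB] := fin_ub r; exists (1 + 2 * B); first lra.
move=> i b j; have := hB i; have := hB j; rewrite /zeta !ler_norml.
by case: b; lra.
Qed.

(** * Fourth moment within a stack *)

Lemma pow_le_bound (x B : R) n : `|x| <= B -> x ^+ n <= B ^+ n.
Proof.
move=> xB; apply: le_trans (ler_norm _) _; rewrite normrX.
by apply: lerXn2r => //; rewrite nnegrE // (le_trans _ xB).
Qed.

(** The term [4 m z^3] is absorbed by [2 (m z - z^2)^2 >= 0]. The term linear in [z] is kept because
    it has mean zero for [z = zeta]. *)
Lemma pow4_le (m z B : R) : `|z| <= B ->
  (m + z) ^+ 4 <= m ^+ 4 + 4 * m ^+ 3 * z + 8 * m ^+ 2 * B ^+ 2 + 3 * B ^+ 4.
Proof.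
move=> zB; have w0 : z ^+ 2 <= B ^+ 2. by exact: pow_le_bound.
have h1 : 0 <= (m * z - z ^+ 2) ^+ 2 by apply: sqr_ge0.
have h2 : 0 <= m ^+ 2 * (B ^+ 2 - z ^+ 2) by rewrite mulr_ge0 ?sqr_ge0 //; lra.
have h3 : 0 <= (B ^+ 2 - z ^+ 2) * (B ^+ 2 + z ^+ 2).
  by apply: mulr_ge0; [lra|rewrite addr_ge0 ?sqr_ge0].
have -> : (m + z) ^+ 4 = m ^+ 4 + 4 * m ^+ 3 * z + 8 * m ^+ 2 * B ^+ 2 + 3 * B ^+ 4
  - (2 * (m * z - z ^+ 2) ^+ 2 + 8 * (m ^+ 2 * (B ^+ 2 - z ^+ 2))
     + 3 * ((B ^+ 2 - z ^+ 2) * (B ^+ 2 + z ^+ 2))) by ring.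
lra.
Qed.

Lemma pow2_le (m z B : R) : `|z| <= B ->
  (m + z) ^+ 2 <= m ^+ 2 + 2 * m * z + B ^+ 2.
Proof.
move=> zB; have w0 : z ^+ 2 <= B ^+ 2. by exact: pow_le_bound.
have -> : (m + z) ^+ 2 = m ^+ 2 + 2 * m * z + z ^+ 2 by ring.
lra.
Qed.

Lemma pow2_ge (m z B : R) : `|z| <= B -> m ^+ 2 / 2 - B ^+ 2 <= (m + z) ^+ 2.
Proof.
move=> zB; have w0 : z ^+ 2 <= B ^+ 2. by exact: pow_le_bound.
have h : 0 <= (m + 2 * z) ^+ 2 by apply: sqr_ge0.
have -> : (m + z) ^+ 2 = m ^+ 2 / 2 - z ^+ 2 + (m + 2 * z) ^+ 2 / 2 by field.
lra.
Qed.

(** Supersolution for the fourth moment; the corrections absorb, in turn, the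
    [m^2], [l] and constant terms that one step produces. *)
Definition Psi (c1 c2 c3 : R) (l : nat) (z : R) (i : 'I_N) : R :=
  (z + r i) ^+ 4 + c1 * l%:R * (z + r i) ^+ 2 + c2 * l%:R ^+ 2 + c3 * l%:R.

Lemma Psi_super : exists c1 c2 c3, [/\ 0 <= c1, 0 <= c2, 0 <= c3 &
  forall l z i, p i * Kp (Psi c1 c2 c3 l.+1 (z + 1)) i
    + (1 - p i) * Kp (Psi c1 c2 c3 l (z - 1)) i <= Psi c1 c2 c3 l.+1 z i].
Proof.
have [B B1 hB] := zeta_bound; have a0 : 0 < a by have := a01; lra.
have B0 : 0 <= B by lra.
(* A failure, of probability at least [a], lowers [l] by one. The loss this causes must cover
   [8 m^2 B^2] through [c1], the term [c1 B^2 l] through [c2] and the constants through [c3]. *)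
pose c1 := 16 * B ^+ 2 / a; pose c2 := c1 * B ^+ 2 / a.
pose c3 := (3 * B ^+ 4 + c1 * B ^+ 2) / a.
have c10 : 0 <= c1 by apply: divr_ge0; [apply: mulr_ge0 => //; apply: exprn_ge0|exact: ltW].
have c20 : 0 <= c2 by apply: divr_ge0; [apply: mulr_ge0 => //; apply: exprn_ge0|exact: ltW].
have c30 : 0 <= c3 by apply: divr_ge0; [apply: addr_ge0; apply: mulr_ge0 => //; apply: exprn_ge0|exact: ltW].
have ac1 : a * c1 = 16 * B ^+ 2 by rewrite /c1; field; lra.
have ac2 : a * c2 = c1 * B ^+ 2 by rewrite /c2; field; lra.
have ac3 : a * c3 = 3 * B ^+ 4 + c1 * B ^+ 2 by rewrite /c3; field; lra.
move: c1 c2 c3 c10 c20 c30 ac1 ac2 ac3 => c1 c2 c3 c10 c20 c30 ac1 ac2 ac3.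
exists c1, c2, c3; split=> // l z i.
set m := z + r i; set L : R := l%:R.
have L0 : 0 <= L by apply: ler0n.
pose A := m ^+ 4 + 8 * m ^+ 2 * B ^+ 2 + 3 * B ^+ 4
  + c1 * (L + 1) * (m ^+ 2 + B ^+ 2) + c2 * (L + 1) ^+ 2 + c3 * (L + 1).
pose b1 := 4 * m ^+ 3 + 2 * c1 * (L + 1) * m.
pose b2 := c1 * (m ^+ 2 / 2 - B ^+ 2) + c2 * (2 * L + 1) + c3.
pose F (b : bool) j := Psi c1 c2 c3 (if b then l.+1 else l) (z + if b then 1 else -1) j.
have -> : p i * Kp (Psi c1 c2 c3 l.+1 (z + 1)) i
    + (1 - p i) * Kp (Psi c1 c2 c3 l (z - 1)) i = step_mean i F by [].
apply: (@le_trans _ _ (step_mean i (fun b j => A + b1 * zeta i b j + (- b2) * (if b then 0 else 1)))).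
  apply: step_mean_le => b j; rewrite /F /Psi.
  have -> : z + (if b then 1 else -1) + r j = m + zeta i b j by rewrite /m /zeta; ring.
  have [zB _] := hB i b j; move: (zeta i b j) zB => w wB.
  have h4 := pow4_le m wB; have h2 := pow2_le m wB; have h2' := pow2_ge m wB.
  have g1 : 0 <= c1 * (L + 1) * (m ^+ 2 + 2 * m * w + B ^+ 2 - (m + w) ^+ 2).
    by rewrite mulr_ge0 ?mulr_ge0 //; lra.
  have g2 : 0 <= c1 * ((m + w) ^+ 2 - (m ^+ 2 / 2 - B ^+ 2)) by rewrite mulr_ge0 //; lra.
  rewrite /A /b1 /b2; case: b.
    rewrite -(natr1 l) -/L mulr0 addr0. lra.
  rewrite -/L mulr1; lra.
rewrite step_meanD step_meanD step_meanc step_meanZ step_meanZ step_mean_zeta.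
have -> : step_mean i (fun b _ => if b then 0 else 1) = 1 - p i by rewrite /step_mean !Kopc //; ring.
rewrite /Psi -/m -(natr1 l) -/L.
have q1 : 0 <= (1 - p i - a) * (c1 * (m ^+ 2 / 2) + c2 * (2 * L + 1) + c3).
  rewrite mulr_ge0 //; first by have := pa i; lra.
  have : 0 <= c1 * (m ^+ 2 / 2) by rewrite mulr_ge0 // divr_ge0 ?sqr_ge0.
  have : 0 <= c2 * (2 * L + 1) by rewrite mulr_ge0 //; lra.
  lra.
have q2 : 0 <= p i * (c1 * B ^+ 2) by rewrite mulr_ge0 ?pge0 ?mulr_ge0 ?exprn_ge0.
have q3 : 0 <= c1 * B ^+ 2 * L by rewrite !mulr_ge0 ?exprn_ge0.
have e1 : a * c1 * (m ^+ 2 / 2) = 8 * m ^+ 2 * B ^+ 2 by rewrite ac1; field.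
have e2 : a * c2 * (2 * L + 1) = c1 * B ^+ 2 * (2 * L + 1) by rewrite ac2.
have e3 : a * c3 = 3 * B ^+ 4 + c1 * B ^+ 2 := ac3.
rewrite /A /b2; lra.
Qed.

Lemma fourth_super : exists C (F4 : nat -> R -> 'I_N -> R), [/\ 0 < C,
  forall l z i, z ^+ 4 <= F4 l z i,
  forall l z i, p i * Kp (F4 l.+1 (z + 1)) i + (1 - p i) * Kp (F4 l (z - 1)) i
     <= F4 l.+1 z i &
  forall n i, F4 n.+1 0 i <= C * n.+1%:R ^+ 2].
Proof.
have [c1 [c2 [c3 [c10 c20 c30 H]]]] := Psi_super.
have [B B1 hB] := zeta_bound; have B0 : 0 <= B by lra.
pose C0 := 8 * B ^+ 4.
exists (8 * (B ^+ 4 + c1 * B ^+ 2 + c2 + c3) + C0).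
(* The bound [z^4 <= 8 (z + r)^4 + 8 r^4] removes the corrector [r], and [C0] bounds its last
   term. *)
exists (fun l z i => 8 * Psi c1 c2 c3 l z i + C0); split.
- have : 1 <= B ^+ 4 by apply: exprn_ege1.
  have : 0 <= c1 * B ^+ 2 by rewrite mulr_ge0 ?exprn_ge0.
  rewrite /C0; lra.
- move=> l z i; have [_ rB] := hB i true i.
  have h1 : r i ^+ 4 <= B ^+ 4. by exact: pow_le_bound.
  have h2 : z ^+ 4 <= 8 * ((z + r i) ^+ 4 + r i ^+ 4).
    have e1 : 0 <= (z + 2 * r i) ^+ 2 * (7 * z ^+ 2 + 4 * z * r i + 4 * r i ^+ 2).
      rewrite mulr_ge0 ?sqr_ge0 //.
      have := sqr_ge0 (z + 2 * r i); have := sqr_ge0 z; nra.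
    by rewrite -subr_ge0; apply: le_trans e1 _; rewrite le_eqVlt; apply/orP; left; apply/eqP; ring.
  have h3 : 0 <= c1 * l%:R * (z + r i) ^+ 2 + c2 * l%:R ^+ 2 + c3 * l%:R.
    apply: addr_ge0; last exact: mulr_ge0.
    by apply: addr_ge0; apply: mulr_ge0; rewrite ?sqr_ge0 //; apply: mulr_ge0.
  rewrite /Psi /C0; lra.
- move=> l z i.
  have E l' z' : Kp (fun j => 8 * Psi c1 c2 c3 l' z' j + C0) i = 8 * Kp (Psi c1 c2 c3 l' z') i + C0.
    by rewrite KopD KopZ Kopc.
  rewrite (E l.+1) (E l); have := H l z i; lra.
- move=> n i; have [_ rB] := hB i true i; rewrite /Psi add0r.
  have h1 : r i ^+ 4 <= B ^+ 4. by exact: pow_le_bound.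
  have h2 : r i ^+ 2 <= B ^+ 2. by exact: pow_le_bound.
  set L : R := n.+1%:R; have L1 : 1 <= L by rewrite ler1n.
  have L2 : L <= L ^+ 2 by rewrite expr2 ler_peMl //; lra.
  have L3 : 1 <= L ^+ 2 by lra.
  have g1 : 0 <= B ^+ 4 * (L ^+ 2 - 1) by rewrite mulr_ge0 ?exprn_ge0 //; lra.
  have g2 : c1 * L * r i ^+ 2 <= c1 * L ^+ 2 * B ^+ 2.
    apply: ler_pM => //; [by apply: mulr_ge0 => //; lra|exact: sqr_ge0|exact: ler_wpM2l].
  have g3 : 0 <= c3 * (L ^+ 2 - L) by rewrite mulr_ge0 //; lra.
  rewrite /C0; lra.
Qed.

(** [Qlaw n k i]: probability of [k] successes before the [n]-th failure, for a
    stack whose first cookie is in state [i]. *)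
Fixpoint Qlaw (n : nat) : nat -> 'I_N -> R :=
  match n with
  | 0%N => fun k _ => (k == 0%N)%:R
  | n'.+1 => fix g k := fun i => (1 - p i) * Kp (Qlaw n' k) i +
       (if k is k'.+1 then p i * Kp (g k') i else 0)
  end.

Lemma QlawSS n k i :
  Qlaw n.+1 k.+1 i = (1 - p i) * Kp (Qlaw n k.+1) i + p i * Kp (Qlaw n.+1 k) i.
Proof. by []. Qed.

Lemma QlawS0 n i : Qlaw n.+1 0 i = (1 - p i) * Kp (Qlaw n 0) i.
Proof. by rewrite /= addr0. Qed.

Lemma Kop_sum M (f : nat -> 'I_N -> R) (c : nat -> R) i :
  Kp (fun j => \sum_(k < M) f k j * c k) i = \sum_(k < M) Kp (f k) i * c k.
Proof.
rewrite /Kop; under eq_bigr do rewrite mulr_sumr.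
rewrite exchange_big /=; apply: eq_bigr => k _; rewrite mulr_suml.
by apply: eq_bigr => j _; rewrite mulrA.
Qed.

Lemma Qlaw_sum_rec n M (phi : nat -> R) i :
  \sum_(k < M.+1) Qlaw n.+1 k i * phi k =
  (1 - p i) * Kp (fun j => \sum_(k < M.+1) Qlaw n k j * phi k) i +
  p i * Kp (fun j => \sum_(k < M) Qlaw n.+1 k j * phi k.+1) i.
Proof.
rewrite (Kop_sum M.+1 (Qlaw n) phi) (Kop_sum M (Qlaw n.+1) (fun k => phi k.+1)).
rewrite [(1 - p i) * _]mulr_sumr [p i * _]mulr_sumr.
rewrite big_ord_recl [X in _ = X + _]big_ord_recl QlawS0 -mulrA -[RHS]addrA; congr (_ + _).
rewrite -big_split /=; apply: eq_bigr => k _.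
by rewrite mulrDl !mulrA.
Qed.

Lemma Qlaw_ge0 n k i : 0 <= Qlaw n k i.
Proof.
elim: n k i => [|n IH] k i; first exact: ler0n.
elim: k i => [|k IHk] i.
  by rewrite QlawS0 mulr_ge0 ?qge0 //; apply: Kop_ge.
by rewrite QlawSS addr_ge0 ?mulr_ge0 ?pge0 ?qge0 //; apply: Kop_ge.
Qed.

(** Optional stopping for the truncated sum, by induction on [n] and [M]; [Phi l s] is the value
    when [l] failures remain and [s] successes have occurred. Nonnegativity of [Phi] is what allows
    the sum to be cut. *)
Lemma Qlaw_supersolution (phi : nat -> R) (Phi : nat -> nat -> 'I_N -> R) n :
  (forall k, 0 <= phi k) ->
  (forall l s i, (l <= n)%N -> 0 <= Phi l s i) ->
  (forall s i, phi s <= Phi 0%N s i) ->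
  (forall l s i, (l < n)%N -> p i * Kp (Phi l.+1 s.+1) i
     + (1 - p i) * Kp (Phi l s) i <= Phi l.+1 s i) ->
  forall M s i, \sum_(k < M) Qlaw n k i * phi (s + k)%N <= Phi n s i.
Proof.
move=> phi0 + H0; elim: n => [|n IH] Phi0 HS.
  move=> [|M] s i; first by rewrite big_ord0 Phi0.
  rewrite big_ord_recl /= ?eqxx mul1r addn0 big1 ?addr0 // => k _.
  by rewrite mul0r.
elim=> [|M IHM] s i; first by rewrite big_ord0 Phi0.
rewrite (@Qlaw_sum_rec _ _ (fun k => phi (s + k)%N)) addrC.
apply: le_trans (HS n s i (ltnSn _)); apply: lerD.
  rewrite ler_wpM2l ?pge0 //; apply: Kop_le => // j.
  by under eq_bigr do rewrite addnS -addSn; apply: IHM.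
rewrite ler_wpM2l ?qge0 //; apply: Kop_le => // j.
by apply: IH => [l s' i' h|l s' i' h]; [apply: Phi0; apply: leqW|apply: HS; apply: leqW].
Qed.

Lemma Qlaw_sum_le1 n M i : \sum_(k < M) Qlaw n k i <= 1.
Proof.
have := @Qlaw_supersolution (fun=> 1) (fun _ _ _ => 1) n _ _ _ _ M 0%N i.
under eq_bigr do rewrite mulr1; apply=> // l s k _.
by rewrite !Kopc //; lra.
Qed.

Lemma Qlaw_tail : exists2 t, 0 <= t < 1 & exists2 B, 1 <= B &
  forall n M i, 1 - B ^+ n * t ^+ M <= \sum_(k < M) Qlaw n k i.
Proof.
(* Chosen so that [B t = B - 1], while [(1 - p) t + p B <= 1 + (1 - a) B = B - 1]; this closes the
   induction. *)
have a0 := a01; pose t := 1 - a / 2; pose B := 2 / a.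
have B1 : 2 < B by rewrite /B ltr_pdivlMr; lra.
exists t; first by rewrite /t; lra.
exists B; first lra.
elim=> [|n IH].
  move=> [|M] i; first by rewrite big_ord0; lra.
  rewrite big_ord_recl /= ?eqxx big1 => [|k _]; last by [].
  by rewrite expr0 mul1r addr0 lerBlDr lerDl exprn_ge0 // /t; lra.
elim=> [|M IHM] i.
  rewrite big_ord0 expr0 mulr1; have : 1 <= B ^+ n.+1 by rewrite exprn_ege1 //; lra.
  lra.
have := @Qlaw_sum_rec n M (fun=> 1) i.
under eq_bigr do rewrite mulr1.
move=> ->.
have h1 : 1 - B ^+ n * t ^+ M.+1 <= Kp (fun j => \sum_(k < M.+1) Qlaw n k j * 1) i.
  by apply: Kop_ge => // j; under eq_bigr do rewrite mulr1; apply: IH.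
have h2 : 1 - B ^+ n.+1 * t ^+ M <= Kp (fun j => \sum_(k < M) Qlaw n.+1 k j * 1) i.
  by apply: Kop_ge => // j; under eq_bigr do rewrite mulr1; apply: IHM.
have g1 := ler_wpM2l (qge0 i) h1; have g2 := ler_wpM2l (pge0 i) h2.
apply: le_trans (lerD g1 g2).
have t0 : 0 <= t ^+ M by rewrite exprn_ge0 // /t; lra.
have Bn : 0 <= B ^+ n by rewrite exprn_ge0 //; lra.
have P0 : 0 <= B ^+ n * t ^+ M by rewrite mulr_ge0.
set Q := B ^+ n * t ^+ M in P0 *.
have -> : B ^+ n.+1 * t ^+ M.+1 = Q * (B * t) by rewrite /Q !exprS; ring.
have -> : B ^+ n * t ^+ M.+1 = Q * t by rewrite /Q exprS; ring.
have -> : B ^+ n.+1 * t ^+ M = Q * B by rewrite /Q exprS; ring.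
suff : 0 <= Q * (B * t - (1 - p i) * t - p i * B) by lra.
apply: mulr_ge0 => //.
have aB : a * B = 2 by rewrite /B; field; lra.
have := pa i; have := p01 i => /andP[p0 p1] h3.
have e1 : B * t = B - 1 by rewrite /t mulrBr mulr1; lra.
have e2 : p i * B <= (1 - a) * B by rewrite ler_wpM2r //; lra.
have e3 : (1 - p i) * t <= 1.
  by rewrite -[leRHS]mulr1 ler_pM // /t; lra.
lra.
Qed.

(** * Expectation of a quartic polynomial of successes minus failures *)

Section Quartic.
Variables (F4 : nat -> R -> 'I_N -> R).
Hypothesis F4_ge : forall l z i, z ^+ 4 <= F4 l z i.
Hypothesis F4_super : forall l z i,
  p i * Kp (F4 l.+1 (z + 1)) i + (1 - p i) * Kp (F4 l (z - 1)) i <= F4 l.+1 z i.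
Variables (x0 x1 x2 x4 : R).
Hypothesis x4_gt0 : 0 < x4.

(** The quadratic part is an exact conditional mean, so [x1] and [x2] may have either sign; the
    fourth power is merely bounded from above, which needs [x4 > 0]. *)
Definition Phi (l : nat) (z : R) (i : 'I_N) : R :=
  x0 + x1 * (z + rho l i) + x2 * (z ^+ 2 + 2 * z * rho l i + kappa l i) + x4 * F4 l z i.

Lemma Kop_Phi l z i : Kp (Phi l z) i =
  x0 + x1 * z + x2 * z ^+ 2 + (x1 + 2 * x2 * z) * Kp (rho l) i
  + x2 * Kp (kappa l) i + x4 * Kp (F4 l z) i.
Proof.
transitivity (Kp (fun j => (x0 + x1 * z + x2 * z ^+ 2) + (x1 + 2 * x2 * z) * rho l j
  + x2 * kappa l j + x4 * F4 l z j) i).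
  by apply: Kop_ext => j; rewrite /Phi; ring.
by rewrite KopD KopD KopD KopZ KopZ KopZ Kopc.
Qed.

Lemma Phi_super l z i :
  p i * Kp (Phi l.+1 (z + 1)) i + (1 - p i) * Kp (Phi l (z - 1)) i <= Phi l.+1 z i.
Proof.
rewrite !Kop_Phi /Phi.
have := ler_wpM2l (ltW x4_gt0) (F4_super l z i).
move: (kappaS l i) (rhoS l i); rewrite /kappa_src.
move: (kappa l.+1 i) (rho l.+1 i) (Kp (kappa l.+1) i) (Kp (rho l.+1) i) (Kp (kappa l) i)
  (Kp (rho l) i) (Kp (F4 l.+1 (z + 1)) i) (Kp (F4 l (z - 1)) i) (F4 l.+1 z i) (p i).
move=> k1 r1 Kk1 Kr1 Kk Kr f1 f2 f3 q -> -> h.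
rewrite -subr_ge0 in h; rewrite -subr_ge0; apply: le_trans h _.
rewrite le_eqVlt; apply/orP; left; apply/eqP; ring.
Qed.

(** The fourth power dominates; the constant comes from completing the square in [z^2]. This crude
    bound starts the iteration in [Phi_ge0]. *)
Lemma Phi_bounded_below l : exists2 C, 0 <= C & forall z i, - C <= Phi l z i.
Proof.
have [B1 B10 hB1] := fin_ub (rho l); have [B2 B20 hB2] := fin_ub (kappa l).
pose D := `|x0| + `|x1| * (1 + B1) + `|x2| * (1 + 2 * B1 + B2).
have D0 : 0 <= D by rewrite !addr_ge0 ?mulr_ge0 //; lra.
exists (D + D ^+ 2 / (4 * x4)).
  by rewrite addr_ge0 // divr_ge0 ?sqr_ge0 // mulr_ge0 // ltW.
move=> z i.
have z2 : `|z| <= 1 + z ^+ 2.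
  have := sqr_ge0 (`|z| - 1); have := real_normK (num_real z); nra.
have w0 := sqr_ge0 z.
have n0 := normr_ge0 z.
have h1 : `|x1 * (z + rho l i)| <= `|x1| * (1 + B1) * (1 + z ^+ 2).
  rewrite normrM -mulrA ler_wpM2l //; apply: le_trans (ler_normD _ _) _.
  have := hB1 i; nra.
have h2 : `|x2 * (z ^+ 2 + 2 * z * rho l i + kappa l i)|
   <= `|x2| * (1 + 2 * B1 + B2) * (1 + z ^+ 2).
  rewrite normrM -(mulrA `|x2|) ler_wpM2l //; apply: le_trans (ler_normD _ _) _.
  have g1 : `|z ^+ 2 + 2 * z * rho l i| <= z ^+ 2 + 2 * ((1 + z ^+ 2) * B1).
    apply: le_trans (ler_normD _ _) _; rewrite (ger0_norm w0) lerD2l.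
    rewrite -mulrA normrM (ger0_norm (ler0n _ 2)) ler_wpM2l // normrM ler_pM //.
  have g2 : B2 <= B2 * (1 + z ^+ 2) by rewrite ler_peMr; lra.
  have := hB2 i; nra.
have h3 := F4_ge l z i.
have h4 : 0 <= x4 * (F4 l z i - z ^+ 4) by apply: mulr_ge0; [exact: ltW|lra].
have h5 : `|x0| <= `|x0| * (1 + z ^+ 2) by rewrite ler_peMr //; lra.
have h6 : - D * (1 + z ^+ 2) + x4 * z ^+ 4 <= Phi l z i.
  have e1 := ler_norm (- x0); rewrite normrN in e1.
  have e2 := ler_norm (- (x1 * (z + rho l i))); rewrite normrN in e2.
  have e3 := ler_norm (- (x2 * (z ^+ 2 + 2 * z * rho l i + kappa l i))); rewrite normrN in e3.
  rewrite /Phi /D; lra.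
apply: le_trans h6.
have e : 0 <= x4 * (z ^+ 2 - D / (2 * x4)) ^+ 2 by apply: mulr_ge0; [exact: ltW|exact: sqr_ge0].
have -> : - D * (1 + z ^+ 2) + x4 * z ^+ 4 = - (D + D ^+ 2 / (4 * x4))
  + x4 * (z ^+ 2 - D / (2 * x4)) ^+ 2 by have := x4_gt0 => ?; field; lra.
lra.
Qed.

Variable n : nat.
(** Successes minus failures when [s] successes have occurred and [l] of the [n] failures remain. *)
Let zs (l s : nat) : R := s%:R + l%:R - n%:R.
Hypothesis Q_ge0 : forall k : nat, 0 <= quartic x0 x1 x2 x4 (k%:R - n%:R).

Lemma Phi0_ge s i : quartic x0 x1 x2 x4 (s%:R - n%:R) <= Phi 0 (zs 0 s) i.
Proof.
have -> : zs 0 s = s%:R - n%:R by rewrite /zs addr0.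
rewrite /quartic /Phi rho0 /=; move: (s%:R - n%:R) => z.
have : 0 <= x4 * (F4 0%N z i - z ^+ 4).
  by apply: mulr_ge0; [exact: ltW|have := F4_ge 0 z i; lra].
lra.
Qed.

Lemma Phi_super_zs l s i : p i * Kp (Phi l.+1 (zs l.+1 s.+1)) i
  + (1 - p i) * Kp (Phi l (zs l s)) i <= Phi l.+1 (zs l.+1 s) i.
Proof.
have := Phi_super l (zs l.+1 s) i.
have -> : zs l.+1 s + 1 = zs l.+1 s.+1 by rewrite /zs -(natr1 s); ring.
by have -> : zs l.+1 s - 1 = zs l s by rewrite /zs -(natr1 l); ring.
Qed.

(** For [l = 0] this is the hypothesis on lattice points. For [l.+1] the lower bound [- C] gains a
    factor [p <= 1 - a] at every success, and iterating drives it to [0]. *)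
Lemma Phi_ge0 l s i : 0 <= Phi l (zs l s) i.
Proof.
elim: l s i => [|l IH] s i; first exact: le_trans (Q_ge0 s) (Phi0_ge s i).
have [C C0 hC] := Phi_bounded_below l.+1.
have t01 : 0 <= 1 - a < 1 by have := a01; lra.
apply: (geo_ge0 t01 C0) => T; elim: T s i => [|T IHT] s i.
  by rewrite expr0 mulr1.
apply: le_trans (Phi_super_zs l s i).
have h1 : 0 <= (1 - p i) * Kp (Phi l (zs l s)) i.
  by rewrite mulr_ge0 ?qge0 //; apply: Kop_ge.
have h2 : - (C * (1 - a) ^+ T) <= Kp (Phi l.+1 (zs l.+1 s.+1)) i.
  by apply: Kop_ge => // j; apply: IHT.
have h3 := ler_wpM2l (pge0 i) h2.
have h4 : 0 <= C * (1 - a) ^+ T by rewrite mulr_ge0 // geo_pow_ge0.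
have h5 : p i * (C * (1 - a) ^+ T) <= (1 - a) * (C * (1 - a) ^+ T).
  by rewrite ler_wpM2r //; have := pa i; lra.
rewrite exprS mulrCA; lra.
Qed.

Lemma Qlaw_quartic (phi : nat -> R) M i :
  (forall k : nat, 0 <= phi k <= quartic x0 x1 x2 x4 (k%:R - n%:R)) ->
  \sum_(k < M) Qlaw n k i * phi k
    <= x0 + x1 * rho n i + x2 * kappa n i + x4 * F4 n 0 i.
Proof.
move=> hphi.
have := @Qlaw_supersolution phi (fun l s => Phi l (zs l s)) n _ _ _ _ M 0%N i.
have -> : Phi n (zs n 0) i = x0 + x1 * rho n i + x2 * kappa n i + x4 * F4 n 0 i.
  have -> : zs n 0 = 0 by rewrite /zs add0r subrr.
  rewrite /Phi; ring.
apply.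
- by move=> k; have /andP[] := hphi k.
- by move=> l s k _; apply: Phi_ge0.
- by move=> s k; apply: le_trans (Phi0_ge s k); have /andP[] := hphi s.
- by move=> l s k _; apply: Phi_super_zs.
Qed.

End Quartic.

Variable eta : 'rV[R]_N.
Hypothesis eta1 : prob_vec eta.

Definition qlaw (n k : nat) : R := \sum_i eta 0 i * Qlaw n k i.

Lemma avg_le (f g : 'I_N -> R) : (forall i, f i <= g i) ->
  \sum_i eta 0 i * f i <= \sum_i eta 0 i * g i.
Proof. by move=> h; apply: ler_sum => i _; apply: ler_wpM2l => //; apply: eta1.1. Qed.

Lemma avgc c : \sum_i eta 0 i * c = c.
Proof. by rewrite -mulr_suml eta1.2 mul1r. Qed.

Lemma qlaw_ge0 n k : 0 <= qlaw n k.
Proof. by rewrite /qlaw sumr_ge0 // => i _; rewrite mulr_ge0 ?Qlaw_ge0 //; apply: eta1.1. Qed.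

Lemma qlaw_sum n M (phi : nat -> R) :
  \sum_(k < M) qlaw n k * phi k = \sum_i eta 0 i * \sum_(k < M) Qlaw n k i * phi k.
Proof.
rewrite /qlaw; under eq_bigr do rewrite mulr_suml.
rewrite exchange_big /=; apply: eq_bigr => i _; rewrite mulr_sumr.
by apply: eq_bigr => k _; rewrite mulrA.
Qed.

Lemma qlaw_sum_le1 n M : \sum_(k < M) qlaw n k <= 1.
Proof.
have := qlaw_sum n M (fun=> 1); under eq_bigr do rewrite mulr1.
move=> ->; rewrite -[leRHS]avgc; apply: avg_le => i.
by under eq_bigr do rewrite mulr1; apply: Qlaw_sum_le1.
Qed.

Lemma qlaw_tail : exists2 t, 0 <= t < 1 & exists2 B, 1 <= B &
  forall n M, 1 - B ^+ n * t ^+ M <= \sum_(k < M) qlaw n k.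
Proof.
have [t t01 [B B1 h]] := Qlaw_tail; exists t => //; exists B => // n M.
have := qlaw_sum n M (fun=> 1); under eq_bigr do rewrite mulr1.
move=> ->; rewrite -[leLHS]avgc; apply: avg_le => i.
by under eq_bigr do rewrite mulr1; apply: h.
Qed.

Lemma qlaw0_gt0 n : a ^+ n <= qlaw n 0.
Proof.
rewrite -[leLHS]avgc /qlaw; apply: avg_le => i.
elim: n i => [|n IH] i; first by rewrite expr0 /=.
rewrite QlawS0 exprS ler_pM //; first by have := a01; lra.
  by rewrite exprn_ge0 //; have := a01; lra.
exact: Kop_ge.
Qed.

Definition bpar : R := \sum_i eta 0 i * r i.

(** The three errors come from [rho_asym], [kappa_asym] and [fourth_super]. [C] is independent of
    the coefficients because the Lyapunov functions use coefficients that vary with [n]. *)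
Lemma moment_bound : exists2 C, 0 < C & forall n (phi : nat -> R) x0 x1 x2 x4 M,
  0 < x4 ->
  (forall k : nat, 0 <= phi k <= quartic x0 x1 x2 x4 (k%:R - n.+1%:R)) ->
  \sum_(k < M) qlaw n.+1 k * phi k <= x0 + x1 * bpar + x2 * nu K mu p * n.+1%:R
    + C * (`|x1| / n.+1%:R + `|x2| + x4 * n.+1%:R ^+ 2).
Proof.
have [C4 [F4 [C40 F4_ge F4_super F4_b]]] := fourth_super.
have [C1 C10 hC1] := rho_asym; have [C2 C20 hC2] := kappa_asym.
exists (C1 + C2 + C4) => [|n phi x0 x1 x2 x4 M x40 hphi]; first lra.
rewrite qlaw_sum; set L : R := n.+1%:R.
have L0 : 0 < L by rewrite ltr0n.
have E : x0 + x1 * bpar + x2 * nu K mu p * L +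
   (C1 + C2 + C4) * (`|x1| / L + `|x2| + x4 * L ^+ 2)
  = \sum_i eta 0 i * (x0 + x1 * r i + x2 * nu K mu p * L +
   (C1 + C2 + C4) * (`|x1| / L + `|x2| + x4 * L ^+ 2)).
  rewrite /bpar; under [RHS]eq_bigr do rewrite -addrA mulrDr mulrDr -addrA mulrCA.
  by rewrite !big_split /= !avgc -mulr_sumr; ring.
rewrite E; apply: avg_le => i.
have hQ (k : nat) : 0 <= quartic x0 x1 x2 x4 (k%:R - n.+1%:R).
  by have /andP[] := hphi k; apply: le_trans.
apply: le_trans (Qlaw_quartic F4_ge F4_super x40 hQ M i hphi) _.
have g1 : x1 * rho n.+1 i <= x1 * r i + C1 * (`|x1| / L).
  rewrite -lerBlDl -mulrBr; apply: le_trans (ler_norm _) _; rewrite normrM mulrCA.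
  by rewrite ler_wpM2l // ler_pdivlMr // mulrC; apply: hC1.
have g2 : x2 * kappa n.+1 i <= x2 * nu K mu p * L + C2 * `|x2|.
  rewrite -lerBlDl -mulrA -mulrBr; apply: le_trans (ler_norm _) _; rewrite normrM mulrC.
  by rewrite ler_wpM2r // [X in _ - X]mulrC; apply: hC2.
have g3 : x4 * F4 n.+1 0 i <= C4 * (x4 * L ^+ 2).
  by rewrite mulrCA ler_wpM2l ?(ltW x40).
have y1 : 0 <= `|x1| / L by rewrite divr_ge0 // ltW.
have y2 := normr_ge0 x2.
have y3 : 0 <= x4 * L ^+ 2 by apply: mulr_ge0; [exact: ltW|exact: sqr_ge0].
have z1 : 0 <= (C1 + C4) * `|x2| by rewrite mulr_ge0 //; lra.
have z2 : 0 <= (C2 + C4) * (`|x1| / L) by rewrite mulr_ge0 //; lra.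
have z3 : 0 <= (C1 + C2) * (x4 * L ^+ 2) by rewrite mulr_ge0 //; lra.
move: g1 g2 g3 z1 z2 z3; move: (`|x1| / L) `|x2| (x4 * L ^+ 2) => A B D.
move: (rho n.+1 i) (kappa n.+1 i) (x4 * F4 n.+1 0 i) (x2 * nu K mu p * L) (r i) => u v w v' s.
lra.
Qed.

End Moments.

(** * Logarithmic Lyapunov functions *)

Section LnBounds.
Import numFieldNormedType.Exports.
Variable R : realType.

Lemma le_of_derive_ge0 (f df : R -> R) (a b : R) : a <= b ->
  (forall x, a <= x <= b -> is_derive x 1 f (df x)) ->
  (forall x, a <= x <= b -> 0 <= df x) -> f a <= f b.
Proof.
move=> ab fd df0.
have [||c cab E] := @MVT_segment R f df a b ab.
- by move=> x; rewrite in_itv /= => /andP[h1 h2]; apply: fd; rewrite !ltW.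
- apply: derivable_within_continuous => x; rewrite in_itv /= => h.
  by have [] := fd x h.
rewrite -subr_ge0 E mulr_ge0 ?subr_ge0 // df0 //.
Qed.


Lemma is_derive_cubic_ln (c0 c1 c2 c3 c4 y : R) : 0 < y ->
  is_derive y 1 (fun y => c0 + c1 * y + c2 * y ^+ 2 + c3 * y ^+ 3 + c4 * ln y)
    (c1 + 2 * c2 * y + 3 * c3 * y ^+ 2 + c4 / y).
Proof.
move=> y0; have hl := is_derive1_ln y0.
pose f : R -> R := cst c0 + c1 *: id + c2 *: (id ^+ 2) + c3 *: (id ^+ 3) + c4 *: (@ln R).
have -> : (fun y => c0 + c1 * y + c2 * y ^+ 2 + c3 * y ^+ 3 + c4 * ln y) = f.
  by apply/funext => z; rewrite /f !fctE.
have h0 := is_derive_cst (c0 : R) (y : R) (1 : R).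
have h1 := is_deriveZ c1 (is_derive_id (y : R) (1 : R)).
have h2 := is_deriveZ c2 (is_deriveX 2 (is_derive_id (y : R) (1 : R))).
have h3 := is_deriveZ c3 (is_deriveX 3 (is_derive_id (y : R) (1 : R))).
have h4 := is_deriveZ c4 hl.
have H := is_deriveD (is_deriveD (is_deriveD (is_deriveD h0 h1) h2) h3) h4.
apply: (@is_derive_eq _ _ _ _ _ _ _ _ H).
have s (x z : R) : x *: z = x * z by []. 
by rewrite !s /=; field; rewrite gt_eqF.
Qed.

(** The Taylor bounds on [ln] below are all of this form with [1] as an endpoint: the sign of one
    explicit derivative decides each of them. *)
Lemma cubic_ln_le (c0 c1 c2 c3 c4 a b : R) : 0 < a -> a <= b ->
  (forall y, a <= y <= b -> 0 <= c1 + 2 * c2 * y + 3 * c3 * y ^+ 2 + c4 / y) ->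
  c0 + c1 * a + c2 * a ^+ 2 + c3 * a ^+ 3 + c4 * ln a <=
  c0 + c1 * b + c2 * b ^+ 2 + c3 * b ^+ 3 + c4 * ln b.
Proof.
move=> a0 ab h.
pose f y := c0 + c1 * y + c2 * y ^+ 2 + c3 * y ^+ 3 + c4 * ln y.
pose df y := c1 + 2 * c2 * y + 3 * c3 * y ^+ 2 + c4 / y.
suff fd : forall y, a <= y <= b -> is_derive y 1 f (df y).
  exact: (@le_of_derive_ge0 f df a b ab fd h).
move=> y /andP[ay _]; exact: is_derive_cubic_ln (lt_le_trans a0 ay).
Qed.

Lemma ln1D_ub (x : R) : -1 < x -> ln (1 + x) <= x - x ^+ 2 / 2 + x ^+ 3 / 3.
Proof.
move=> x1; set y := 1 + x; have y0 : 0 < y by rewrite /y; lra.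
have -> : x = y - 1 by rewrite /y; ring.
have der (z : R) : 0 < z -> 3 + 2 * (- (3 / 2)) * z + 3 * (1 / 3) * z ^+ 2 + (-1) / z = (z - 1) ^+ 3 / z.
  by move=> z0; field; rewrite gt_eqF.
case: (lerP 1 y) => hy.
  have h z : 1 <= z <= y -> 0 <= 3 + 2 * (- (3 / 2)) * z + 3 * (1 / 3) * z ^+ 2 + (-1) / z.
    move=> /andP[z1 _].
    rewrite der; last by lra.
    by rewrite divr_ge0 ?exprn_ge0 //; lra.
  have := @cubic_ln_le (- (11 / 6)) 3 (- (3 / 2)) (1 / 3) (-1) 1 y ltr01 hy h; rewrite ln1 !expr1n; lra.
have h z : y <= z <= 1 -> 0 <= (-3) + 2 * (3 / 2) * z + 3 * (- (1 / 3)) * z ^+ 2 + 1 / z.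
  move=> /andP[yz z1].
  have z0 : 0 < z by lra.
  have -> : -3 + 2 * (3 / 2) * z + 3 * (- (1 / 3)) * z ^+ 2 + 1 / z = (1 - z) ^+ 3 / z.
    by field; rewrite gt_eqF.
  by rewrite divr_ge0 ?exprn_ge0 //; lra.
have := @cubic_ln_le (11 / 6) (-3) (3 / 2) (- (1 / 3)) 1 y 1 y0 (ltW hy) h; rewrite ln1 !expr1n; lra.
Qed.

Lemma ln1D_lb_pos (x : R) : 0 <= x -> x - x ^+ 2 / 2 <= ln (1 + x).
Proof.
move=> x0; set y := 1 + x; have y1 : 1 <= y by rewrite /y; lra.
have -> : x = y - 1 by rewrite /y; ring.
have h z : 1 <= z <= y -> 0 <= (-2) + 2 * (1 / 2) * z + 3 * 0 * z ^+ 2 + 1 / z.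
  move=> /andP[z1 _].
  have -> : -2 + 2 * (1 / 2) * z + 3 * 0 * z ^+ 2 + 1 / z = (z - 1) ^+ 2 / z.
    by field; rewrite gt_eqF //; lra.
  by rewrite divr_ge0 ?sqr_ge0 //; lra.
have := @cubic_ln_le (3 / 2) (-2) (1 / 2) 0 1 1 y ltr01 y1 h; rewrite ln1 !expr1n; lra.
Qed.

Lemma ln1D_lb_neg (x : R) : - (1 / 2) <= x <= 0 -> x - x ^+ 2 / 2 + x ^+ 3 <= ln (1 + x).
Proof.
move=> /andP[x1 x0]; set y := 1 + x.
have y0 : 0 < y by rewrite /y; lra. have y1 : y <= 1 by rewrite /y; lra.
have y2 : 1 / 2 <= y by rewrite /y; lra.
have -> : x = y - 1 by rewrite /y; ring.
have h z : y <= z <= 1 -> 0 <= 5 + 2 * (- (7 / 2)) * z + 3 * 1 * z ^+ 2 + (-1) / z.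
  move=> /andP[z1 _].
  have z0 : 0 < z by lra.
  have -> : 5 + 2 * (- (7 / 2)) * z + 3 * 1 * z ^+ 2 + (-1) / z = (z - 1) ^+ 2 * (3 * z - 1) / z.
    by field; rewrite gt_eqF.
  by apply: divr_ge0; [apply: mulr_ge0; [exact: sqr_ge0|lra]|lra].
have := @cubic_ln_le (- (5 / 2)) 5 (- (7 / 2)) 1 (-1) y 1 y0 y1 h; rewrite ln1 !expr1n; lra.
Qed.

Lemma ln4_ge1 : 1 <= ln (4 : R).
Proof.
have h : 1 / 2 <= ln (1 + 1 : R).
  by have := @ln1D_lb_pos 1 ler01; rewrite expr1n; lra.
have -> : (4 : R) = (1 + 1) * (1 + 1) by ring.
by rewrite lnM ?posrE //; lra.
Qed.

(** A weighted AM-GM inequality. With [e = L^-3] the quadratic share is negligible against the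
    coefficients of order [L^-2] that decide the drift. *)
Lemma cube_split (x e : R) : 0 < e -> `|x| ^+ 3 <= e * x ^+ 2 + x ^+ 4 / e.
Proof.
move=> e0; have x0 := normr_ge0 x.
have -> : x ^+ 2 = `|x| ^+ 2 by rewrite real_normK // num_real.
have -> : x ^+ 4 = `|x| ^+ 4 by rewrite (exprM x 2 2) (exprM `|x| 2 2) real_normK // num_real.
move: `|x| x0 => y y0.
have -> : e * y ^+ 2 + y ^+ 4 / e = y ^+ 3 + (y ^+ 2 / e) * ((y - e / 2) ^+ 2 + 3 / 4 * e ^+ 2).
  by field; rewrite gt_eqF.
rewrite lerDl mulr_ge0 ?divr_ge0 ?sqr_ge0 ?(ltW e0) //.
by rewrite addr_ge0 ?sqr_ge0 // mulr_ge0 ?sqr_ge0 //; lra.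
Qed.

Lemma inv_ln_quartic (L x : R) : 1 <= L -> -1 < x -> 1 <= L + ln (1 + x) ->
  (L + ln (1 + x))^-1 <= L^-1 - L^-2 * x + (1 / 2 + 13 / L) * L^-2 * x ^+ 2
     + 28 * L ^+ 3 * x ^+ 4.
Proof.
move=> L1 x1; set u := ln (1 + x) => Lu1.
have L0 : 0 < L by lra.
set i := L^-1; have i0 : 0 < i by rewrite invr_gt0.
have iL : i * L = 1 by rewrite /i mulVf // gt_eqF.
have i1 : i <= 1 by rewrite -iL ler_peMr //; lra.
have -> : L^-2 = i ^+ 2 by rewrite exprVn.
rewrite -/i.
have x40 : 0 <= x ^+ 4 by rewrite exprn_even_ge0.
have L30 : 1 <= L ^+ 3 by rewrite exprn_ege1.
have x20 := sqr_ge0 x.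
(* For [x < -1/2] the left side is at most [1], while [x^4 >= 1 / 16] makes the quartic term exceed
   [28 / 16]. *)
case: (lerP (- (1 / 2)) x) => hx; last first.
  have h1 : (L + u)^-1 <= 1 by rewrite invf_le1; lra.
  have h2 : 1 / 4 <= x ^+ 2.
    have : 0 <= (- x - 1 / 2) * (- x + 1 / 2) by apply: mulr_ge0; lra.
    lra.
  have h3 : 1 / 16 <= x ^+ 4.
    have -> : x ^+ 4 = x ^+ 2 * x ^+ 2 by ring.
    have -> : 1 / 16 = (1 / 4) * (1 / 4) :> R by field.
    by rewrite ler_pM //; lra.
  have h4 : x ^+ 4 <= L ^+ 3 * x ^+ 4 by rewrite ler_peMl.
  have h5 : 0 <= i ^+ 2 * (- x) by rewrite mulr_ge0 ?sqr_ge0 //; lra.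
  have h6 : 0 <= (1 / 2 + 13 * i) * i ^+ 2 * x ^+ 2.
    by apply: mulr_ge0 => //; apply: mulr_ge0; [lra|exact: sqr_ge0].
  lra.
(* Expansion to third order with exact remainder. The cubic errors amount to at most
   [1 + 3 + 8 = 12] times [|x|^3]; once split they add [12] to the [1] coming from [u^2], hence
   [13]. *)
have key : (L + u)^-1 = i - i ^+ 2 * u + i ^+ 3 * u ^+ 2 + i ^+ 3 * (L + u)^-1 * (- u ^+ 3).
  by rewrite /i; field; rewrite !gt_eqF //; lra.
set w := (L + u)^-1 in key *.
have w0 : 0 < w by rewrite invr_gt0; lra.
have w1 : w <= 1 by rewrite invf_le1; lra.
have n0 := normr_ge0 x; set y := `|x| in n0.
have c3 : 0 <= y ^+ 3 by rewrite exprn_ge0.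
have b1 : - u <= - x + x ^+ 2 / 2 + y ^+ 3.
  case: (lerP 0 x) => h0; first by have := ln1D_lb_pos h0; rewrite -/u; lra.
  have kappa_src : - (1 / 2) <= x <= 0 by lra.
  have := ln1D_lb_neg kappa_src; rewrite -/u /y ltr0_norm //.
  have -> : (- x) ^+ 3 = - x ^+ 3 by ring.
  lra.
have b2 : u ^+ 2 <= x ^+ 2 + 3 * y ^+ 3 /\ - u ^+ 3 <= 8 * y ^+ 3.
  case: (lerP 0 x) => h0.
    have u0 : 0 <= u by apply: ln_ge0; lra.
    have ux : u <= x by apply: le_ln1Dx.
    split; last by have : 0 <= u ^+ 3 by [apply: exprn_ge0]; lra.
    have : u ^+ 2 <= x ^+ 2 by rewrite lerXn2r.
    lra.
  have kappa_src : - (1 / 2) <= x <= 0 by lra.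
  have u0 : u < 0 by apply: ln_lt0; lra.
  have yx : y = - x by rewrite /y ltr0_norm.
  have hy : y <= 1 / 2 by lra.
  have uy : - u <= y + y ^+ 2.
    have := ln1D_lb_neg kappa_src; rewrite -/u (_ : x = - y); last by lra.
    have -> : (- y) ^+ 3 = - y ^+ 3 by ring.
    have -> : (- y) ^+ 2 = y ^+ 2 by ring.
    have : y ^+ 3 <= y ^+ 2 / 2.
      have -> : y ^+ 3 = y ^+ 2 * y by ring.
      by rewrite ler_wpM2l ?sqr_ge0 //; lra.
    lra.
  have y2 : y ^+ 2 <= y / 2 by rewrite expr2 ler_wpM2l //; lra.
  have y4 : y ^+ 4 <= y ^+ 3.
    have -> : y ^+ 4 = y ^+ 3 * y by ring.
    by rewrite ler_piMr //; lra.
  split.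
    have : (- u) ^+ 2 <= (y + y ^+ 2) ^+ 2 by rewrite lerXn2r ?nnegrE //; lra.
    have -> : (- u) ^+ 2 = u ^+ 2 by ring.
    have -> : (y + y ^+ 2) ^+ 2 = y ^+ 2 + 2 * y ^+ 3 + y ^+ 4 by ring.
    have -> : x ^+ 2 = y ^+ 2 by rewrite yx; ring.
    lra.
  have : (- u) ^+ 3 <= (2 * y) ^+ 3 by rewrite lerXn2r ?nnegrE //; lra.
  have -> : (- u) ^+ 3 = - u ^+ 3 by ring.
  have -> : (2 * y) ^+ 3 = 8 * y ^+ 3 by ring.
  by [].
have [b21 b22] := b2.
have i2 : 0 <= i ^+ 2 by apply: sqr_ge0.
have i2' : i ^+ 2 <= 1 by rewrite exprn_ile1 //; lra.
have i3 : 0 <= i ^+ 3 by apply: exprn_ge0; lra.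
have i3' : i ^+ 3 <= 1 by rewrite exprn_ile1 //; lra.
have e1 := ler_wpM2l i2 b1.
have e2 := ler_wpM2l i3 b21.
have e3 : i ^+ 3 * w * (- u ^+ 3) <= 8 * y ^+ 3.
  have iw0 : 0 <= i ^+ 3 * w by rewrite mulr_ge0 // ltW.
  have iw1 : i ^+ 3 * w <= 1 by rewrite mulr_ile1 // ltW.
  apply: le_trans (ler_wpM2l iw0 b22) _.
  by rewrite ler_piMl // mulr_ge0.
have e4 : i ^+ 2 * y ^+ 3 <= y ^+ 3 by rewrite ler_piMl.
have e5 : i ^+ 3 * y ^+ 3 <= y ^+ 3 by rewrite ler_piMl.
have i30 : 0 < i ^+ 3 by rewrite exprn_gt0.
have e6 := cube_split x i30; rewrite -/y in e6.
have e7 : x ^+ 4 / i ^+ 3 = L ^+ 3 * x ^+ 4 by rewrite /i; field; rewrite gt_eqF.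
rewrite e7 in e6.
have e8 : 0 <= L ^+ 3 * x ^+ 4 by rewrite mulr_ge0 //; lra.
have e9 : i * i ^+ 2 * x ^+ 2 = i ^+ 3 * x ^+ 2 by ring.
rewrite key; lra.
Qed.

(** The bound [P] is the cubic Taylor polynomial, and [P^2 - (1 + y)] is [y^4] times a positive
    quadratic. *)
Lemma sqrt1D_ub (y : R) : -1 <= y -> Num.sqrt (1 + y) <= 1 + y / 2 - y ^+ 2 / 8 + y ^+ 3 / 16.
Proof.
move=> y1; set P := 1 + _ - _ + _.
have P0 : 0 <= P.
  have -> : P = (1 + y) * ((y - 3 / 2) ^+ 2 / 16 + 35 / 64) + 5 / 16 by rewrite /P; field.
  apply: addr_ge0; last lra.
  by apply: mulr_ge0; [lra|apply: addr_ge0; [apply: divr_ge0; [exact: sqr_ge0|lra]|lra]].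
rewrite -(ger0_norm P0) -sqrtr_sqr ler_wsqrtr // -subr_ge0.
have E : P ^+ 2 - (1 + y) = y ^+ 4 * ((y - 2) ^+ 2 * (1 / 256) + 1 / 16) by rewrite /P; field.
rewrite E; apply: mulr_ge0; first by apply: exprn_even_ge0.
by apply: addr_ge0; [apply: mulr_ge0; [exact: sqr_ge0|lra]|lra].
Qed.

(** The term [1 / (4 L)] comes from the concavity of [ln], [1 / (8 L^2)] from that of the square
    root, and [- 1 / L^3] pays for the cubic errors. *)
Lemma sqrt_ln_quartic (L x : R) : 1 <= L -> -1 < x -> 0 <= L + ln (1 + x) ->
  Num.sqrt (L + ln (1 + x)) <= Num.sqrt L * (1 + x / (2 * L)
    - (1 / (4 * L) + 1 / (8 * L ^+ 2) - 1 / L ^+ 3) * x ^+ 2 + L ^+ 3 * x ^+ 4).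
Proof.
move=> L1 x1; set u := ln (1 + x) => Lu0.
have L0 : 0 < L by lra.
set i := L^-1; have i0 : 0 < i by rewrite invr_gt0.
have iL : i * L = 1 by rewrite /i mulVf // gt_eqF.
have i1 : i <= 1 by rewrite -iL ler_peMr //; lra.
have -> : L + u = L * (1 + i * u) by rewrite mulrDr mulr1 mulrA [L * i]mulrC iL mul1r.
rewrite sqrtrM; last by lra.
rewrite ler_wpM2l ?sqrtr_ge0 //.
have y1 : -1 <= i * u.
  rewrite -(ler_pM2l L0) mulrA [L * i]mulrC iL; lra.
apply: le_trans (sqrt1D_ub y1) _.
have -> : x / (2 * L) = i * (x / 2) by rewrite /i; field; rewrite gt_eqF.
have -> : 1 / (4 * L) + 1 / (8 * L ^+ 2) - 1 / L ^+ 3 = i / 4 + i ^+ 2 / 8 - i ^+ 3.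
  by rewrite /i; field; rewrite gt_eqF.
set y := `|x|; have n0 : 0 <= y := normr_ge0 x.
have c3 : 0 <= y ^+ 3 by rewrite exprn_ge0.
have b0 : x ^+ 3 <= y ^+ 3 by rewrite /y -normrX ler_norm.
have b1 := ln1D_ub x1; rewrite -/u in b1.
have b2 : x ^+ 2 - y ^+ 3 <= u ^+ 2.
  case: (lerP 0 x) => h0.
    have u0 : 0 <= u by apply: ln_ge0; lra.
    have yx : y = x by rewrite /y ger0_norm.
    have h := ln1D_lb_pos h0; rewrite -/u in h.
    case: (lerP x 2) => h2.
      have : (x - x ^+ 2 / 2) ^+ 2 <= u ^+ 2.
        rewrite lerXn2r ?nnegrE //.
        have -> : x - x ^+ 2 / 2 = x * (1 - x / 2) by ring.
        by rewrite mulr_ge0 //; lra.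
      have -> : (x - x ^+ 2 / 2) ^+ 2 = x ^+ 2 - x ^+ 3 + (x ^+ 2) ^+ 2 / 4 by field.
      by have := sqr_ge0 (x ^+ 2); rewrite yx; lra.
    have : 0 <= x ^+ 2 * (x - 1) by rewrite mulr_ge0 ?sqr_ge0 //; lra.
    by have := sqr_ge0 u; rewrite yx; lra.
  have ux : u <= x by apply: le_ln1Dx.
  have : (- x) ^+ 2 <= (- u) ^+ 2 by rewrite lerXn2r ?nnegrE //; lra.
  have -> : (- x) ^+ 2 = x ^+ 2 by ring.
  have -> : (- u) ^+ 2 = u ^+ 2 by ring.
  lra.
have b3 : u ^+ 3 <= y ^+ 3.
  case: (lerP 0 x) => h0.
    have u0 : 0 <= u by apply: ln_ge0; lra.
    have ux : u <= x by apply: le_ln1Dx.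
    by rewrite lerXn2r ?nnegrE // /y ger0_norm.
  have u0 : u < 0 by apply: ln_lt0; lra.
  have : 0 <= (- u) ^+ 3 by apply: exprn_ge0; lra.
  have -> : (- u) ^+ 3 = - u ^+ 3 by ring.
  lra.
have i2 : 0 <= i ^+ 2 by apply: sqr_ge0.
have i2' : i ^+ 2 <= 1 by rewrite exprn_ile1 //; lra.
have i3 : 0 <= i ^+ 3 by apply: exprn_ge0; lra.
have i3' : i ^+ 3 <= 1 by rewrite exprn_ile1 //; lra.
have e1 := ler_wpM2l (ltW i0) b1.
have e2 := ler_wpM2l i2 b2.
have e3 := ler_wpM2l i3 b3.
have f1 : i * x ^+ 3 <= y ^+ 3.
  by apply: le_trans (ler_wpM2l (ltW i0) b0) _; rewrite ler_piMl.
have f2 : i ^+ 2 * y ^+ 3 <= y ^+ 3 by rewrite ler_piMl.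
have f3 : i ^+ 3 * y ^+ 3 <= y ^+ 3 by rewrite ler_piMl.
have i30 : 0 < i ^+ 3 by rewrite exprn_gt0.
have e6 := cube_split x i30; rewrite -/y in e6.
have e7 : x ^+ 4 / i ^+ 3 = L ^+ 3 * x ^+ 4 by rewrite /i; field; rewrite gt_eqF.
rewrite e7 in e6.
have -> : (i * u) ^+ 2 = i ^+ 2 * u ^+ 2 by ring.
have -> : (i * u) ^+ 3 = i ^+ 3 * u ^+ 3 by ring.
lra.
Qed.

(** The sixth power is what the drift estimates need: it gives [L^5 / N <= 1 / L] in the transient
    case and [L^4 / N <= 1 / L^2] in the recurrent one. *)
Lemma ln_growth (A : R) : exists n0, forall m, (n0 <= m)%N ->
  A <= ln (m%:R + 4 : R) /\ ln (m%:R + 4) ^+ 6 <= (m%:R + 4 : R).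
Proof.
have [c c0 hc] : exists2 c : R, 0 < c & forall L : R, 0 <= L -> 1 + L ^+ 7 / c <= expR L.
  exists 7`!%:R => [|L L0]; first by rewrite ltr0n fact_gt0.
  exact: (expR_ge1Dxn 6 L0).
pose B := Num.max A c.
have e0 : 0 <= expR B by apply: expR_ge0.
exists (Num.bound (expR B)) => m hm.
have h1 : expR B <= m%:R + 4.
  have := archi_boundP e0; have : (Num.bound (expR B))%:R <= m%:R :> R by rewrite ler_nat.
  lra.
have N0 : 0 < m%:R + 4 :> R by apply: ltr_wpDl.
have h2 : B <= ln (m%:R + 4) by rewrite -[B]expRK ler_ln ?posrE ?expR_gt0.
set L := ln _ in h2 *.
have [h3 h4] : A <= L /\ c <= L by move: h2; rewrite /B ge_max => /andP.
split=> //.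
have L0 : 0 <= L by lra.
have := hc L L0; rewrite {2}/L lnK ?posrE // => h5.
have h6 : L ^+ 6 <= L ^+ 7 / c.
  by rewrite ler_pdivlMr // (exprSr L 6) ler_wpM2l ?exprn_ge0.
lra.
Qed.
End LnBounds.

Section Lyapunov.
Variables (R : realType) (q : nat -> nat -> R) (b v : R).

Definition moments_ok : Prop := exists2 C, 0 < C &
  forall n (phi : nat -> R) x0 x1 x2 x4 M, 0 < x4 ->
  (forall k : nat, 0 <= phi k <= quartic x0 x1 x2 x4 (k%:R - n.+1%:R)) ->
  \sum_(k < M) q n.+1 k * phi k <= x0 + x1 * b + x2 * v * n.+1%:R
    + C * (`|x1| / n.+1%:R + `|x2| + x4 * n.+1%:R ^+ 2).

Hypothesis MB : moments_ok.
Hypothesis v0 : 0 < v.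

(** The shift by [4] makes [lnk] at least [1]. *)
Definition lnk (k : nat) : R := ln (k%:R + 4).

Lemma lnk_ge1 k : 1 <= lnk k.
Proof.
apply: le_trans (ln4_ge1 R) _; have k0 : 0 <= k%:R :> R by [].
by rewrite ler_ln ?posrE; lra.
Qed.

Lemma lnkE n k : let x := (k%:R - n%:R) / (n%:R + 4) in
  -1 < x /\ lnk k = lnk n + ln (1 + x).
Proof.
move=> x; have k0 : 0 <= k%:R :> R by []; have n0 : 0 <= n%:R :> R by [].
have N0 : 0 < n%:R + 4 :> R by lra.
have x1 : 1 + x = (k%:R + 4) / (n%:R + 4) by rewrite /x; field; lra.
have x0 : 0 < 1 + x by rewrite x1 divr_gt0 //; lra.
split; first lra.
rewrite /lnk -lnM ?posrE //; congr ln; rewrite x1; field; lra.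
Qed.

Lemma lyapunov_transient : v / 2 < b ->
  exists n0, forall n M, (n0 <= n)%N -> \sum_(k < M) q n k * (lnk k)^-1 <= (lnk n)^-1.
Proof.
move=> vb; have vpos := v0; have [C C0 hMB] := MB.
(* The errors in the drift sum to at most [(13 v + 44 C) / L], where [44 = 2 + 14 + 28]; [A] keeps
   them below the gap [b - v / 2]. *)
pose A := (13 * v + 44 * C) / (b - v / 2) + 1.
(* The shift by [4] ensures [m >= 4], hence [1 / m <= 2 / N]. *)
have [n0 hn0] := ln_growth A; exists (n0 + 4)%N => -[|n] M hn; first by lia.
set m := n.+1; have [hA h6] := hn0 m ltac:(lia).
rewrite -/(lnk m) in hA h6; set L := lnk m in hA h6 *; set N : R := m%:R + 4 in h6.
have L1 : 1 <= L by apply: lnk_ge1.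
have m4 : 4 <= m%:R :> R by rewrite (ler_nat _ 4); lia.
have N0 : 0 < N by rewrite /N; lra.
have L0 : 0 < L by lra.
pose x0 := L^-1; pose x1 := - (L^-2 / N).
pose x2 := (1 / 2 + 13 / L) * L^-2 / N ^+ 2; pose x4 := 28 * L ^+ 3 / N ^+ 4.
have x40 : 0 < x4 by rewrite /x4 divr_gt0 ?mulr_gt0 ?exprn_gt0 //.
have x20 : 0 < x2.
  have h13 : 0 < 13 / L by rewrite divr_gt0.
  by apply: divr_gt0; [apply: divr_gt0; [lra|exact: exprn_gt0]|exact: exprn_gt0].
have x10 : `|x1| = L^-2 / N by rewrite /x1 normrN gtr0_norm // divr_gt0 // invr_gt0 exprn_gt0.
have hphi k : 0 <= (lnk k)^-1 <= quartic x0 x1 x2 x4 (k%:R - m%:R).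
  apply/andP; split; first by rewrite invr_ge0; have := lnk_ge1 k; lra.
  have := lnkE m k; rewrite -/L -/N; set x := _ / N => -[x1' E].
  have hk := lnk_ge1 k; rewrite E in hk *.
  apply: le_trans (inv_ln_quartic L1 x1' hk) _.
  rewrite le_eqVlt; apply/orP; left; apply/eqP.
  by rewrite /quartic /x0 /x1 /x2 /x4 /x; field; rewrite !gt_eqF.
apply: le_trans (hMB n (fun k => (lnk k)^-1) x0 x1 x2 x4 M x40 hphi) _.
rewrite -/m x10 (gtr0_norm x20) /x0 /x1 /x2 /x4.
set i := L^-1; have i0 : 0 < i by rewrite invr_gt0.
have iL : i * L = 1 by rewrite /i mulVf // gt_eqF.
have i1 : i <= 1 by rewrite -iL ler_peMr //; lra.
pose t := m%:R / N; pose s := (m%:R)^-1 : R; pose w := N^-1; pose z := L ^+ 5 / N.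
have w0 : 0 < w by rewrite invr_gt0.
have t0 : 0 < t by rewrite divr_gt0 //; lra.
have t1 : t <= 1 by rewrite ler_pdivrMr // mul1r /N; lra.
have wi : w <= i.
  rewrite /w /i lef_pV2 ?posrE //; apply: le_trans h6.
  by rewrite exprS ler_peMr ?exprn_ege1 // ltW.
have z0 : 0 < z by rewrite divr_gt0 // exprn_gt0.
have zi : z <= i.
  rewrite /z ler_pdivrMr // -(ler_pM2l L0) [L * (i * N)]mulrA [L * i]mulrC iL mul1r.
  by rewrite -exprS.
have s0 : 0 < s by rewrite invr_gt0; lra.
have sw : s <= 2 * w.
  rewrite /s /w -[leRHS]/(2 / N) ler_pdivlMr // mulrC ler_pdivrMr; last by lra.
  by rewrite /N; lra.
have E : i - L^-2 / N * b + (1 / 2 + 13 / L) * L^-2 / N ^+ 2 * v * m%:R +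
  C * (L^-2 / N / m%:R + (1 / 2 + 13 / L) * L^-2 / N ^+ 2 + 28 * L ^+ 3 / N ^+ 4 * m%:R ^+ 2)
  = i + L^-2 / N * (- b + (1 / 2 + 13 * i) * v * t
      + C * (s + (1 / 2 + 13 * i) * w + 28 * (z * t ^+ 2))).
  by rewrite /i /s /w /z /t; field; rewrite !gt_eqF //; lra.
rewrite mulNr E -[leRHS]addr0 lerD2l.
apply: mulr_ge0_le0; first by rewrite divr_ge0 ?invr_ge0 ?exprn_ge0 // ltW.
have e1 : (1 / 2 + 13 * i) * v * t <= (1 / 2 + 13 * i) * v.
  by rewrite ler_piMr // mulr_ge0 ?ltW //; lra.
have e2 : (1 / 2 + 13 * i) * w <= 14 * i.
  by apply: ler_pM => //; lra.
have e3 : z * t ^+ 2 <= i.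
  by apply: le_trans zi; apply: ler_piMr; [exact: ltW|rewrite exprn_ile1 // ltW].
have e4 : C * (s + (1 / 2 + 13 * i) * w + 28 * (z * t ^+ 2)) <= C * (44 * i).
  by rewrite ler_pM2l //; lra.
have e5 : (13 * v + 44 * C) * i <= b - v / 2.
  rewrite /i ler_pdivrMr //.
  have d0 : 0 < b - v / 2 by lra.
  have : (13 * v + 44 * C) / (b - v / 2) <= L by rewrite /A in hA; lra.
  by rewrite ler_pdivrMr // [L * _]mulrC.
lra.
Qed.

Lemma lyapunov_recurrent : b <= v / 2 ->
  exists n0, forall n M, (n0 <= n)%N ->
    \sum_(k < M) q n k * Num.sqrt (lnk k) <= Num.sqrt (lnk n).
Proof.
move=> vb; have vpos := v0; have [C C0 hMB] := MB.
(* In the worst case [b = v / 2] only the gain [v / (4 L)] due to the square root is left. [D / L^2]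
   collects the errors, and [A] makes the gain prevail; its summand [4] gives [L >= 4], hence
   [0 < g <= 1]. *)
pose D := 6 * v + 5 * C; pose A := 4 * D / v + 4.
have [n0 hn0] := ln_growth A; exists (n0 + 4)%N => -[|n] M hn; first by lia.
set m := n.+1; have [hA h6] := hn0 m ltac:(lia).
rewrite -/(lnk m) in hA h6; set L := lnk m in hA h6 *; set N : R := m%:R + 4 in h6.
have m4 : 4 <= m%:R :> R by rewrite (ler_nat _ 4); lia.
have N0 : 0 < N by rewrite /N; lra.
have D0 : 0 < D by rewrite /D; lra.
have L4 : 4 <= L by rewrite /A in hA; have : 0 < 4 * D / v by [rewrite divr_gt0 // mulr_gt0]; lra.
have L0 : 0 < L by lra.
have L1 : 1 <= L by lra.
set i := L^-1; have i0 : 0 < i by rewrite invr_gt0.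
have iL : i * L = 1 by rewrite /i mulVf // gt_eqF.
have i4 : i <= 1 / 4 by rewrite -(ler_pM2r L0) iL; lra.
pose S := Num.sqrt L.
have S0 : 0 < S by rewrite sqrtr_gt0.
pose c2 := 1 / (4 * L) + 1 / (8 * L ^+ 2) - 1 / L ^+ 3.
pose g := 1 / 2 + i / 4 - 2 * i ^+ 2.
have c2E : c2 = i / 2 * g by rewrite /c2 /g /i; field; rewrite gt_eqF.
have i2 : i ^+ 2 <= i / 4 by rewrite expr2; have := ler_wpM2l (ltW i0) i4; lra.
have g0 : 0 < g by rewrite /g; lra.
have g1 : g <= 1 by rewrite /g; have := sqr_ge0 i; lra.
pose x1 := S * i / 2 / N; pose x2 := - (S * c2 / N ^+ 2); pose x4 := S * L ^+ 3 / N ^+ 4.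
have c20 : 0 < c2 by rewrite c2E mulr_gt0 //; lra.
have x40 : 0 < x4 by rewrite /x4 divr_gt0 ?mulr_gt0 ?exprn_gt0 //.
have x10 : 0 < x1 by rewrite /x1 divr_gt0 ?mulr_gt0 //.
have x2n : `|x2| = S * c2 / N ^+ 2.
  by rewrite /x2 normrN gtr0_norm // divr_gt0 ?mulr_gt0 ?exprn_gt0.
have hphi k : 0 <= Num.sqrt (lnk k) <= quartic S x1 x2 x4 (k%:R - m%:R).
  apply/andP; split; first by rewrite sqrtr_ge0.
  have := lnkE m k; rewrite -/L -/N; set x := _ / N => -[x1' E].
  have hk := lnk_ge1 k; rewrite E in hk *.
  have hk0 : 0 <= L + ln (1 + x) by lra.
  apply: le_trans (sqrt_ln_quartic L1 x1' hk0) _.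
  rewrite -/c2 -/S le_eqVlt; apply/orP; left; apply/eqP.
  by rewrite /quartic /x1 /x2 /x4 /x /i; field; rewrite !gt_eqF.
apply: le_trans (hMB n (fun k => Num.sqrt (lnk k)) S x1 x2 x4 M x40 hphi) _.
rewrite -/m -/S (gtr0_norm x10) x2n /x1 /x2 /x4 c2E.
pose t := m%:R / N; pose s := (m%:R)^-1 : R; pose w := N^-1; pose z := L ^+ 4 / N.
have w0 : 0 < w by rewrite invr_gt0.
have t0 : 0 < t by rewrite divr_gt0 //; lra.
have t1 : t <= 1 by rewrite ler_pdivrMr // mul1r /N; lra.
have tE : t = 1 - 4 * w by rewrite /t /w /N; field; rewrite gt_eqF.
have i20 : 0 <= i ^+ 2 by apply: sqr_ge0.
have i2L : i ^+ 2 * L ^+ 2 = 1 by rewrite -exprMn iL expr1n.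
have LL4 : 1 <= L ^+ 4 by apply: exprn_ege1.
have z0 : 0 < z by rewrite divr_gt0 // exprn_gt0.
have zi : z <= i ^+ 2.
  have L20 : 0 < L ^+ 2 by rewrite exprn_gt0.
  rewrite /z ler_pdivrMr // -(ler_pM2l L20) [L ^+ 2 * (i ^+ 2 * N)]mulrA [L ^+ 2 * i ^+ 2]mulrC i2L mul1r.
  by rewrite -exprD.
have wi : w <= i ^+ 2.
  apply: le_trans zi; rewrite /z /w -[leLHS]mul1r ler_wpM2r //.
  by rewrite invr_ge0 ltW.
have s0 : 0 < s by rewrite invr_gt0; lra.
have sw : s <= 2 * w.
  rewrite /s /w -[leRHS]/(2 / N) ler_pdivlMr // mulrC ler_pdivrMr; last by lra.
  by rewrite /N; lra.
have E : S + S * i / 2 / N * b + - (S * (i / 2 * g) / N ^+ 2) * v * m%:R +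
  C * (S * i / 2 / N / m%:R + S * (i / 2 * g) / N ^+ 2 + S * L ^+ 3 / N ^+ 4 * m%:R ^+ 2)
  = S + S * i / 2 / N * (b - g * v * t + C * (s + g * w + 2 * (z * t ^+ 2))).
  by rewrite /i /s /w /z /t; field; rewrite !gt_eqF //; lra.
rewrite E -[leRHS]addr0 lerD2l.
apply: mulr_ge0_le0; first by rewrite !mulr_ge0 ?invr_ge0 // ltW.
have gv0 : 0 < g * v by rewrite mulr_gt0.
have e1 : g * v * (4 * w) <= 4 * v * i ^+ 2.
  have : g * v * (4 * w) <= 1 * v * (4 * i ^+ 2).
    apply: ler_pM; [lra|lra| |lra].
    by rewrite ler_pM2r.
  lra.
have e2 : g * w <= i ^+ 2.
  by rewrite -[leRHS]mul1r; apply: ler_pM => //; rewrite ltW.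
have e3 : z * t ^+ 2 <= i ^+ 2.
  by apply: le_trans zi; apply: ler_piMr; [exact: ltW|rewrite exprn_ile1 // ltW].
have e4 : C * (s + g * w + 2 * (z * t ^+ 2)) <= C * (5 * i ^+ 2).
  by rewrite ler_pM2l //; lra.
have e5 : D * i ^+ 2 <= v * i / 4.
  have : 4 * D / v <= L by rewrite /A in hA; lra.
  rewrite ler_pdivrMr // => h.
  have := ler_wpM2l i20 h; rewrite [i ^+ 2 * (L * v)]mulrA (_ : i ^+ 2 * L = i); first by lra.
  by rewrite expr2 -mulrA iL mulr1.
rewrite /D in e5.
have e6 : g * v = v / 2 + v * i / 4 - 2 * v * i ^+ 2 by rewrite /g; ring.
have e7 : g * v * t = g * v - g * v * (4 * w) by rewrite tE; ring.
rewrite e7; lra.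
Qed.

End Lyapunov.

(** * Extinction of the branching-like process *)

Local Open Scope classical_set_scope.

Section Death.
Variables (R : realType) (q : nat -> nat -> R).
Hypothesis q0 : forall n k, 0 <= q n k.
Hypothesis q1 : forall n M, \sum_(k < M) q n k <= 1.
Hypothesis q00 : q 0 0 = 1.

(** Probability that the process started from [m] is at [0] after [t] steps,
    all taken inside [0, M). *)
Fixpoint death (M t m : nat) : R :=
  if t is t'.+1 then \sum_(k < M) q m k * death M t' k else (m == 0%N)%:R.

Lemma death_ge0 M t m : 0 <= death M t m.
Proof.
elim: t m => [|t IH] m /=; first exact: ler0n.
by apply: sumr_ge0 => k _; rewrite mulr_ge0.
Qed.

Lemma death_le (g : nat -> R) : 1 <= g 0%N -> (forall m, 0 <= g m) ->
  (forall m M, \sum_(k < M) q m k * g k <= g m) ->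
  forall M t m, death M t m <= g m.
Proof.
move=> g1 g0 h M; elim=> [|t IH] m /=; first by case: eqP => [->|].
by apply: le_trans (h m M); apply: ler_sum => k _; rewrite ler_wpM2l.
Qed.

Lemma death_le1 M t m : death M t m <= 1.
Proof. by apply: (@death_le (fun=> 1)) => // n k; under eq_bigr do rewrite mulr1. Qed.

Lemma lnk_mono m n : (m <= n)%N -> lnk R m <= lnk R n.
Proof.
move=> mn; have : m%:R <= n%:R :> R by rewrite ler_nat.
have : 0 <= m%:R :> R by [].
by move=> h1 h2; rewrite /lnk ler_ln ?posrE; lra.
Qed.

Lemma lnk_gt0 m : 0 < lnk R m. Proof. by apply: lt_le_trans (lnk_ge1 R m). Qed.

(** Capping [lnk n0 / lnk m] at [1] makes it a supersolution below [n0] too, where the cap is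
    attained. It dominates the extinction probability and tends to [0]. *)
Lemma death_transient n0 :
  (forall n M, (n0 <= n)%N -> \sum_(k < M) q n k * (lnk R k)^-1 <= (lnk R n)^-1) ->
  forall e, 0 < e -> exists m, forall M t, death M t m <= e.
Proof.
move=> hq e e0; pose g m : R := Num.min 1 (lnk R n0 / lnk R m).
have hg m M : \sum_(k < M) q m k * g k <= g m.
  rewrite /g le_min; apply/andP; split.
    apply: le_trans (q1 m M); apply: ler_sum => k _.
    by rewrite ler_piMr // ge_min lexx.
  case: (leqP n0 m) => hm.
    rewrite mulrC; apply: (@le_trans _ _ ((\sum_(k < M) q m k * (lnk R k)^-1) * lnk R n0)).
      rewrite mulr_suml; apply: ler_sum => k _; rewrite -mulrA ler_wpM2l //.
      by rewrite ge_min [_^-1 * _]mulrC lexx orbT.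
    by rewrite ler_pM2r ?lnk_gt0 //; apply: hq.
  apply: (@le_trans _ _ 1); last first.
    by rewrite ler_pdivlMr ?lnk_gt0 // mul1r lnk_mono // ltnW.
  apply: le_trans (q1 m M); apply: ler_sum => k _.
  by rewrite ler_piMr // ge_min lexx.
have g0 m : 0 <= g m.
  by rewrite le_min ler01 divr_ge0 // ltW // lnk_gt0.
have g1 : 1 <= g 0%N.
  by rewrite le_min lexx /= ler_pdivlMr ?lnk_gt0 // mul1r lnk_mono.
have [m0 hm0] := ln_growth (lnk R n0 / e).
exists m0 => M t; apply: le_trans (death_le g1 g0 hg M t m0) _.
rewrite ge_min; apply/orP; right.
rewrite ler_pdivrMr ?lnk_gt0 // mulrC -ler_pdivrMr //.
by have [] := hm0 m0 (leqnn _).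
Qed.

Lemma death_monoM M M' t m : (M <= M')%N -> death M t m <= death M' t m.
Proof.
move=> h; elim: t m => [//|t IH] m /=.
rewrite (big_ord_widen M' (fun k => q m k * death M t k)) // big_mkcond /=.
apply: ler_sum => k _; case: ifP => _; first by rewrite ler_wpM2l.
by rewrite mulr_ge0 ?death_ge0.
Qed.

Lemma death_monot M t t' m : (0 < M)%N -> (t <= t')%N -> death M t m <= death M t' m.
Proof.
move=> M0 h; rewrite -(subnK h); elim: (t' - t)%N => [//|s IH]; rewrite addSn.
apply: le_trans IH _; move: (s + t)%N => r {h t t' s}; elim: r m => [|r IH] m.
  have h0 : 0 <= death M 1 m by apply: death_ge0.
  rewrite /= ; case: eqP => [->|//].
  by case: M M0 h0 => // M _ _; rewrite big_ord_recl /= q00 mulr1 lerDl sumr_ge0 // => k _; rewrite mulr_ge0.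
by apply: ler_sum => k _; rewrite ler_wpM2l //; apply: IH.
Qed.

Let Ds m := [set x | exists M t, x = death M t m].
Definition death_sup m : R := sup (Ds m).

Lemma death_has_sup m : has_sup (Ds m).
Proof.
split; first by exists (death 0 0 m), 0%N, 0%N.
by exists 1 => _ [M [t ->]]; apply: death_le1.
Qed.

Lemma death_le_sup M t m : death M t m <= death_sup m.
Proof. by apply: sup_upper_bound; [apply: death_has_sup|exists M, t]. Qed.

Lemma death_sup_le1 m : death_sup m <= 1.
Proof.
apply: ge_sup; first by exists (death 0 0 m), 0%N, 0%N.
by move=> _ [M [t ->]]; apply: death_le1.
Qed.

Lemma death_sup0 : death_sup 0 = 1.
Proof. by apply/eqP; rewrite eq_le death_sup_le1; have := death_le_sup 0 0 0. Qed.

Lemma death_sup_ge0 m : 0 <= death_sup m.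
Proof. exact: le_trans (death_ge0 0 0 m) (death_le_sup 0 0 m). Qed.

Lemma death_sup_approx (B : nat) e : 0 < e -> exists M t, [/\ (0 < M)%N, (B <= M)%N &
  forall k, (k < B)%N -> death_sup k - e <= death M t k].
Proof.
move=> e0; elim: B => [|B [M [t [M0 BM h]]]]; first by exists 1%N, 0%N.
have [_ [M' [t' ->]] h'] := sup_adherent e0 (death_has_sup B).
exists (M + M' + B.+1)%N, (t + t')%N; split; [by lia|by lia|].
move=> k; rewrite ltnS leq_eqVlt => /orP[/eqP ->|kB].
  apply: le_trans (ltW h') _; apply: (@le_trans _ _ (death (M + M' + B.+1) t' B)).
    by apply: death_monoM; lia.
  by apply: death_monot; lia.
apply: le_trans (h k kB) _; apply: (@le_trans _ _ (death (M + M' + B.+1) t k)).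
  by apply: death_monoM; lia.
by apply: death_monot; lia.
Qed.

Lemma death_sup_super m B : \sum_(k < B) q m k * death_sup k <= death_sup m.
Proof.
apply/ler_addgt0Pr => e e0.
have [M [t [M0 BM h]]] := death_sup_approx B e0.
apply: (@le_trans _ _ (death M t.+1 m + e)); last by rewrite lerD2r death_le_sup.
apply: (@le_trans _ _ (\sum_(k < B) q m k * death M t k + e)).
  rewrite -lerBlDl -sumrB; apply: (@le_trans _ _ (\sum_(k < B) q m k * e)).
    apply: ler_sum => k _; rewrite -mulrBr ler_wpM2l //.
    by have := h k (ltn_ord k); lra.
  by rewrite -mulr_suml ler_piMl // ltW.
rewrite lerD2r /= (big_ord_widen M (fun k => q m k * death M t k)) // big_mkcond /=.
by apply: ler_sum => k _; case: ifP => // _; rewrite mulr_ge0 ?death_ge0.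
Qed.

Lemma nat_argmax (f : nat -> R) n : exists2 k, (k <= n)%N & forall j, (j <= n)%N -> f j <= f k.
Proof.
elim: n => [|n [k kn h]]; first by exists 0%N => // j; rewrite leqn0 => /eqP ->.
case: (lerP (f n.+1) (f k)) => hf.
  exists k; first exact: leqW.
  by move=> j; rewrite leq_eqVlt => /orP[/eqP -> //|]; rewrite ltnS => /h.
exists n.+1 => // j; rewrite leq_eqVlt => /orP[/eqP -> //|]; rewrite ltnS => /h.
by move/le_trans; apply; apply: ltW.
Qed.

Hypothesis qtail : exists2 t, 0 <= t < 1 & exists2 B, 1 <= B &
  forall n M, 1 - B ^+ n * t ^+ M <= \sum_(k < M) q n k.
Hypothesis qpos : forall n, 0 < q n 0.

(** Expresses without an infinite sum that [q n] has total mass [1]: the mass beyond [M]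
    vanishes. *)
Lemma tail_le0 n (x : R) : (forall M, (0 < M)%N -> x <= 1 - \sum_(k < M) q n k) -> x <= 0.
Proof.
have [t t01 [B B1 ht]] := qtail; move=> h; rewrite -oppr_ge0.
have C0 : 0 <= B ^+ n * t by rewrite mulr_ge0 ?exprn_ge0 //; lra.
apply: (geo_ge0 t01 C0) => T; have := h T.+1 isT; have := ht n T.+1.
by rewrite exprS mulrA; lra.
Qed.

(** Maximum principle for the survival probability [h]: with [f = sqrt lnk] the
    difference [h - max_{k <= n0} h - e f] cannot have a positive maximum beyond
    [n0] because [q m 0 > 0]; let [e] tend to [0], then compare at an argmax. *)
Lemma death_recurrent n0 :
  (forall n M, (n0 <= n)%N ->
    \sum_(k < M) q n k * Num.sqrt (lnk R k) <= Num.sqrt (lnk R n)) ->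
  forall m, death_sup m = 1.
Proof.
move=> hq; pose h m := 1 - death_sup m.
have h01 m : 0 <= h m <= 1 by rewrite /h; have := death_sup_le1 m; have := death_sup_ge0 m; lra.
have h0 : h 0%N = 0 by rewrite /h death_sup0 subrr.
have hsub m M : h m <= \sum_(k < M) q m k * h k + (1 - \sum_(k < M) q m k).
  have := death_sup_super m M.
  have -> : \sum_(k < M) q m k * h k = \sum_(k < M) q m k - \sum_(k < M) q m k * death_sup k.
    by rewrite -sumrB; apply: eq_bigr => k _; rewrite /h mulrBr mulr1.
  by rewrite /h; lra.
(* If the maximum [U] is attained at [m], the jump to [0], where [u <= 0], loses at least
   [U * q m 0]. This loss is at most the mass beyond [M], for every [M]. *)
have step (u : nat -> R) (U : R) m : 0 <= U -> u 0%N <= 0 -> (forall k, u k <= U) ->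
  (forall M, (0 < M)%N -> U <= \sum_(k < M) q m k * u k + (1 - \sum_(k < M) q m k)) -> U <= 0.
  move=> U0 u0 uU hM; have : U * q m 0 <= 0.
    apply: (@tail_le0 m) => M M0; have := hM M M0.
    case: M M0 => // M _; rewrite big_ord_recl /= [in X in _ -> _ <= X]big_ord_recl => h1.
    have : \sum_(i < M) q m (lift ord0 i) * u (lift ord0 i) <= U * \sum_(i < M) q m (lift ord0 i).
      by rewrite mulr_sumr; apply: ler_sum => k _; rewrite mulrC ler_wpM2r.
    have : \sum_(i < M) q m (lift ord0 i) <= 1 - q m 0.
      by have := q1 m M.+1; rewrite big_ord_recl /=; lra.
    move: h1; rewrite [in X in X -> _]big_ord_recl /=.
    set S1 := \sum_(i < M) q m _ * _; set S2 := \sum_(i < M) q m _ => h1 h2 h3.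
    have h4 : U * S2 <= U * (1 - q m 0) by rewrite ler_wpM2l.
    have h5 : q m 0 * u 0%N <= 0 by rewrite mulr_ge0_le0.
    lra.
  by rewrite pmulr_lle0.
have [k0 k0n hk0] := nat_argmax h n0; set H0 := h k0 in hk0.
have H00 : 0 <= H0 by have := h01 k0; rewrite -/H0; lra.
pose f k := Num.sqrt (lnk R k).
have f0 k : 0 <= f k by apply: sqrtr_ge0.
have hH m : h m <= H0.
  apply/ler_addgt0Pr => e e0; have : 0 < e / f m.
    by rewrite divr_gt0 // sqrtr_gt0 lnk_gt0.
  set e' := e / f m => e'0.
  suff : h m - H0 - e' * f m <= 0.
    by rewrite /e' divfK; [lra|rewrite gt_eqF // sqrtr_gt0 lnk_gt0].
  pose u k := h k - H0 - e' * f k.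
  have ulow k : (k <= n0)%N -> u k <= 0.
    move=> kn; have := hk0 k kn; have : 0 <= e' * f k by rewrite mulr_ge0 // ltW.
    by rewrite /u; lra.
  (* [f] is unbounded: beyond [B], [e' * f >= 1 >= h], so a positive maximum of [u] is attained on a
     finite range. *)
  have [B hB] := ln_growth (e'^-1 ^+ 2).
  have uhigh k : (B <= k)%N -> u k <= 0.
    move=> Bk; have [h1 _] := hB k Bk.
    have : e'^-1 <= f k.
      rewrite -(ger0_norm (ltW (_ : 0 < e'^-1))) ?invr_gt0 // -sqrtr_sqr.
      by rewrite /f ler_wsqrtr.
    rewrite -[e'^-1]mul1r ler_pdivrMr // mulrC => h2.
    by have := h01 k; rewrite /u; lra.
  have [k1 k1n hk1] := nat_argmax u (m + B).
  apply: le_trans (hk1 m (leq_addr _ _)) _.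
  rewrite leNgt; apply/negP => U0.
  have k1n0 : (n0 <= k1)%N.
    by rewrite leqNgt; apply/negP => /ltnW/ulow; rewrite leNgt U0.
  have uU k : u k <= u k1.
    case: (leqP k (m + B)) => hk; first exact: hk1.
    by apply: le_trans (ltW U0); apply: uhigh; lia.
  suff : u k1 <= 0 by rewrite leNgt U0.
  apply: (@step u (u k1) k1) => //; [exact: ltW|exact: ulow|].
  move=> M _.
  have -> : \sum_(k < M) q k1 k * u k = \sum_(k < M) q k1 k * h k
     - H0 * (\sum_(k < M) q k1 k) - e' * \sum_(k < M) q k1 k * f k.
    rewrite !mulr_sumr -!sumrB; apply: eq_bigr => k _; rewrite /u; ring.
  have g1 := hsub k1 M.
  have g2 : H0 * \sum_(k < M) q k1 k <= H0 by rewrite ler_piMr.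
  have g3 : e' * \sum_(k < M) q k1 k * f k <= e' * f k1.
    by rewrite ler_wpM2l ?(ltW e'0) //; apply: hq.
  rewrite {1}/u; lra.
have H0le : H0 <= 0.
  apply: (@step h H0 k0) => //; first by rewrite h0.
  by move=> M _; apply: hsub.
move=> m; have := hH m; have := death_sup_le1 m; rewrite /h => h1 h2.
by apply/eqP; rewrite eq_le h1 /=; lra.
Qed.

End Death.

(** * The law of the coin stacks *)

Section BoolEvents.
Variables (d : measure_display) (T : measurableType d) (R : realType) (P : probability T R).

Definition mevent (f : T -> bool) : Prop := measurable [set w | f w].

Lemma mevent_ext f g : f =1 g -> mevent f -> mevent g.
Proof. by move=> h; rewrite /mevent (_ : [set w | f w] = [set w | g w]) //; apply/seteqP; split=> w /=; rewrite h. Qed.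

Lemma mevent_not f : mevent f -> mevent (fun w => ~~ f w).
Proof.
move=> mf; rewrite /mevent (_ : [set w | ~~ f w] = ~` [set w | f w]); first exact: measurableC.
by apply/seteqP; split=> w /=; [move/negP|move/negP].
Qed.

Lemma mevent_and f g : mevent f -> mevent g -> mevent (fun w => f w && g w).
Proof.
move=> mf mg; rewrite /mevent (_ : [set w | f w && g w] = [set w | f w] `&` [set w | g w]).
  exact: measurableI.
by apply/seteqP; split=> w /=; [move/andP|move=> [-> ->]].
Qed.

Lemma mevent_or f g : mevent f -> mevent g -> mevent (fun w => f w || g w).
Proof.
move=> mf mg; apply: (@mevent_ext (fun w => ~~ (~~ f w && ~~ g w))).
  by move=> w; rewrite negb_and !negbK.
by apply/mevent_not/mevent_and; apply: mevent_not.
Qed.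

Lemma mevent_cst b : mevent (fun=> b).
Proof.
case: b; rewrite /mevent.
  by rewrite (_ : [set _ | true] = setT); [exact: measurableT|apply/seteqP; split].
by rewrite (_ : [set _ | false] = set0); [exact: measurable0|apply/seteqP; split].
Qed.

Lemma mevent_if f g h : mevent f -> mevent g -> mevent h -> mevent (fun w => if f w then g w else h w).
Proof.
move=> mf mg mh; apply: (@mevent_ext (fun w => (f w && g w) || (~~ f w && h w))).
  by move=> w; case: (f w); rewrite /= ?orbF.
by apply: mevent_or; apply: mevent_and => //; apply: mevent_not.
Qed.

Lemma mevent_has (I : Type) (l : seq I) (g : I -> T -> bool) :
  (forall i, mevent (g i)) -> mevent (fun w => has (g^~ w) l).
Proof. by move=> mg; elim: l => [|i l IH] /=; [exact: mevent_cst|exact: mevent_or]. Qed.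

Lemma mevent_all (I : Type) (l : seq I) (g : I -> T -> bool) :
  (forall i, mevent (g i)) -> mevent (fun w => all (g^~ w) l).
Proof. by move=> mg; elim: l => [|i l IH] /=; [exact: mevent_cst|exact: mevent_and]. Qed.

Lemma P_ext (f g : T -> bool) : f =1 g -> P [set w | f w] = P [set w | g w].
Proof. by move=> h; congr (P _); apply/seteqP; split=> w /=; rewrite h. Qed.

Lemma P_partition (I : finType) (f : T -> bool) (g : I -> T -> bool) (c : I -> R) :
  (forall i, mevent (g i)) -> (forall w, f w = has (g^~ w) (enum I)) ->
  (forall i j w, g i w -> g j w -> i = j) ->
  (forall i, P [set w | g i w] = (c i)%:E) ->
  P [set w | f w] = (\sum_i c i)%:E.
Proof.
move=> mg fE dis hc; rewrite (P_ext fE) -big_enum /=.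
elim: (enum I) (enum_uniq I) => [_|i l IH /= /andP[il ul]].
  by rewrite big_nil /= (_ : [set _ | false] = set0) ?measure0 //; apply/seteqP; split.
rewrite big_cons EFinD -IH // -hc.
rewrite (_ : [set w | g i w || has (g^~ w) l] = [set w | g i w] `|` [set w | has (g^~ w) l]).
  apply: measureU; [exact: mg|exact: mevent_has|].
  apply/seteqP; split=> // w /= [gi /hasP[j jl gj]].
  by move: il; rewrite (dis _ _ _ gi gj) jl.
by apply/seteqP; split=> w /=; [move/orP|move=> h; apply/orP].
Qed.

End BoolEvents.

Section TupleSum.
Variables (R : realType) (X : finType).

Lemma sum_tuple_cons n (F : n.+1.-tuple X -> R) :
  \sum_(t : n.+1.-tuple X) F t = \sum_x \sum_(t : n.-tuple X) F [tuple of x :: t].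
Proof.
rewrite pair_big (reindex (fun xt : X * n.-tuple X => [tuple of xt.1 :: xt.2])) //=.
exists (fun t => (thead t, [tuple of behead t])) => [[x t] _|t _] /=.
  by rewrite theadE; congr pair; apply: val_inj.
by rewrite [RHS](tuple_eta t).
Qed.

Lemma sum_tuple0 (F : 0.-tuple X -> R) : \sum_(t : 0.-tuple X) F t = F [tuple].
Proof.
rewrite (big_pred1 [tuple]) // => t /=; apply/esym/eqP; exact: tuple0.
Qed.

Lemma sum_pairE (I J : finType) (F : I * J -> R) :
  \sum_x F x = \sum_i \sum_j F (i, j).
Proof. by rewrite pair_bigA; apply: eq_bigr => -[]. Qed.

End TupleSum.

Section StackLaw.
Variables (R : realType) (N : nat) (K : 'M[R]_N) (p : 'I_N -> R) (i0 : 'I_N).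
Hypothesis stK : stochastic K.

Let X := ('I_N * bool)%type.
Definition tuple_state (m : nat) (t : m.-tuple X) (j : nat) : 'I_N := (nth (i0, true) t j).1.
Definition tuple_coin (m : nat) (t : m.-tuple X) (j : nat) : bool := (nth (i0, true) t j).2.

(** Coins beyond the [m]-th default to successes; this is harmless for tests [A] that read at most
    [m] coins. *)
Definition stack_sum (eta : 'rV[R]_N) (m : nat) (A : (nat -> bool) -> bool) : R :=
  \sum_(t : m.-tuple X) (A (tuple_coin t))%:R * stack_prob K eta p (tuple_state t) (tuple_coin t) m.

Lemma stack_sum1 eta A : stack_sum eta 1 A =
  \sum_i eta 0 i * (p i * (A (tuple_coin [tuple (i, true)]))%:R
     + (1 - p i) * (A (tuple_coin [tuple (i, false)]))%:R).
Proof.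
rewrite /stack_sum sum_tuple_cons sum_pairE.
apply: eq_bigr => i _; rewrite big_bool /= !sum_tuple0 /stack_prob /= !big_ord0 !big_ord1 /=.
by rewrite !mulr1 /tuple_state /=; ring.
Qed.

(** Markov property: past its first cookie, a stack is a stack started from a row of [K]. The tail
    must be nonempty for [stack_prob] to be meaningful, hence [m.+2]. *)
Lemma stack_probS eta r b m : stack_prob K eta p r b m.+2 =
  eta 0 (r 0%N) * (if b 0%N then p (r 0%N) else 1 - p (r 0%N)) *
  stack_prob K (row (r 0%N) K) p (r \o succn) (b \o succn) m.+1.
Proof.
rewrite /stack_prob /= big_ord_recl [\prod_(j < m.+2) _]big_ord_recl /= mxE.
set B1 := \prod_(j < m) _; set B2 := \prod_(j < m.+1) _.
move: (eta 0 _) (K _ _) => x y; case: (b 0%N); ring.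
Qed.

Lemma stack_sumS eta m A : stack_sum eta m.+2 A =
  \sum_i eta 0 i * (p i * stack_sum (row i K) m.+1 (fun b => A (fun j => if j is j'.+1 then b j' else true))
     + (1 - p i) * stack_sum (row i K) m.+1 (fun b => A (fun j => if j is j'.+1 then b j' else false))).
Proof.
rewrite {1}/stack_sum sum_tuple_cons sum_pairE.
apply: eq_bigr => i _.
have E b : \sum_(t : m.+1.-tuple X) (A (tuple_coin [tuple of (i, b) :: t]))%:R *
   stack_prob K eta p (tuple_state [tuple of (i, b) :: t]) (tuple_coin [tuple of (i, b) :: t]) m.+2
   = eta 0 i * ((if b then p i else 1 - p i) *
     stack_sum (row i K) m.+1 (fun c => A (fun j => if j is j'.+1 then c j' else b))).
  rewrite /stack_sum !mulr_sumr; apply: eq_bigr => t _.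
  have -> : tuple_coin [tuple of (i, b) :: t] = (fun j => if j is j'.+1 then tuple_coin t j' else b).
    by apply/funext => -[|j].
  rewrite stack_probS [stack_prob _ _ _ _ _ m.+1](_ : _ = stack_prob K (row i K) p (tuple_state t) (tuple_coin t) m.+1) //.
  by rewrite /tuple_state /=; ring.
by rewrite big_bool /= !E; ring.
Qed.

(** Both sides obey the same recursion in the first coin, which replaces the initial law by a row of
    [K]; hence an induction on [m] for all [eta]. The bound on [n + k] ensures that the prefix
    decides the event. *)
Lemma stack_sum_succ_before (eta : 'rV[R]_N) m n k : \sum_i eta 0 i = 1 -> (n + k <= m.+1)%N ->
  stack_sum eta m.+1 (fun b => succ_before b n k) = \sum_i eta 0 i * Qlaw K p n k i.
Proof.
have cE (b : nat -> bool) c : (fun j => if j is j'.+1 then b j' else c) \o succn = b by apply/funext.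
have Krow i f : \sum_j row i K 0 j * f j = Kop K f i.
  by apply: eq_bigr => j _; rewrite mxE.
have row1 i : \sum_j row i K 0 j = 1.
  by rewrite -(stK.2 i); apply: eq_bigr => j _; rewrite mxE.
elim: m eta n k => [|m IH] eta n k eta1 nk.
  rewrite stack_sum1; apply: eq_bigr => i _; congr (_ * _).
  case: n nk => [|[|n]]; last by [].
    move=> _; rewrite !succ_before0 /=; ring.
  rewrite addSn ltnS leqn0 add0n => /eqP ->.
  rewrite (succ_beforeS (tuple_coin [tuple (i, true)])) (succ_beforeS (tuple_coin [tuple (i, false)])) /= succ_before0 /= Kopc //; ring.
rewrite stack_sumS; apply: eq_bigr => i _; congr (_ * _).
case: n nk => [|n] nk.
  (* With [n = 0] the test ignores the coins; the induction hypothesis at [k = 0] supplies the total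
     mass [1]. *)
  have E c : stack_sum (row i K) m.+1 (fun b => succ_before (fun j => if j is j'.+1 then b j' else c) 0 k)
     = (k == 0%N)%:R.
    case: (eqVneq k 0%N) => [->|k0].
      have := IH (row i K) 0%N 0%N (row1 i) isT.
      rewrite /= -mulr_suml row1 mulr1 => <-.
      by congr (stack_sum _ _ _); apply/funext => b; rewrite !succ_before0.
    rewrite /stack_sum big1 // => t _; rewrite succ_before0 (negbTE k0) mul0r //.
  rewrite !E /=; ring.
have E0 : stack_sum (row i K) m.+1 (fun b => succ_before (fun j => if j is j'.+1 then b j' else false) n.+1 k)
  = Kop K (Qlaw K p n k) i.
  rewrite -Krow -(IH (row i K) n k (row1 i)); last by lia.
  by congr (stack_sum _ _ _); apply/funext => b; rewrite succ_beforeS cE.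
rewrite E0; case: k nk {E0} => [|k] nk.
  rewrite [X in p i * X](_ : _ = 0); first by rewrite QlawS0; ring.
  by rewrite /stack_sum big1 // => t _; rewrite succ_beforeS /= mul0r.
rewrite QlawSS addrC; congr (_ + _ * _).
rewrite -Krow -(IH (row i K) n.+1 k (row1 i)); last by lia.
by congr (stack_sum _ _ _); apply/funext => b; rewrite succ_beforeS cE.
Qed.

End StackLaw.

Lemma succ_before_prefix b b' n k : (forall j, (j < n + k)%N -> b j = b' j) -> succ_before b n k = succ_before b' n k.
Proof.
move=> h; have E L : (L <= n + k)%N -> cnt false b L = cnt false b' L.
  move=> hL; rewrite /cnt; apply: eq_bigr => j _.
  by rewrite h //; apply: leq_trans hL.
rewrite /succ_before E //; case: (posnP (n + k)%N) => [//|h0] /=.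
by rewrite h // prednK.
Qed.

Definition upd (V : Type) (f : int -> V) (x : int) (v : V) : int -> V :=
  fun y => if y == x then v else f y.

Lemma updx V (f : int -> V) x v : upd f x v x = v.
Proof. by rewrite /upd eqxx. Qed.
Lemma upd_ne V (f : int -> V) x v y : y != x -> upd f x v y = f y.
Proof. by rewrite /upd => /negbTE ->. Qed.

(** A truncated, decidable form of [dies], from generation [a] on. Being a finite test, it is
    measurable, and its probability is computed by [death]. *)
Fixpoint dies_within (c : int -> nat -> bool) (M t a m : nat) : bool :=
  if t is t'.+1 then has (fun k : 'I_M => succ_before (c a.+1%:Z) m k && dies_within c M t' a.+1 k) (enum 'I_M)
  else m == 0%N.

Lemma dies_within_path c M t a m : dies_within c M t a m -> exists v : nat -> nat,
  [/\ v 0%N = m, v t = 0%N & forall i, (i < t)%N -> succ_before (c (a + i).+1%:Z) (v i) (v i.+1)].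
Proof.
elim: t a m => [|t IH] a m /=; first by move/eqP=> ->; exists (fun=> 0%N).
case/hasP => k _ /andP[f /IH[v [v0 vt hv]]].
exists (fun i => if i is i'.+1 then v i' else m); split=> // -[|i] it.
  by rewrite v0 addn0.
by have := hv i it; rewrite addSnnS.
Qed.

Lemma dies_within_dies c M t m : dies_within c M t 0 m -> dies c m.
Proof. by move=> /dies_within_path[v hv]; exists t, v. Qed.

Lemma path_dies_within c M t a (v : nat -> nat) : v t = 0%N -> (forall i, (i <= t)%N -> (v i < M)%N) ->
  (forall i, (i < t)%N -> succ_before (c (a + i).+1%:Z) (v i) (v i.+1)) -> dies_within c M t a (v 0%N).
Proof.
elim: t a v => [|t IH] a v vt vM hv /=; first by rewrite vt.
apply/hasP; have v1 := vM 1%N isT; exists (Ordinal v1); first by rewrite mem_enum.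
rewrite /= -[a.+1%:Z](_ : (a + 0).+1%:Z = _) ?addn0 //; apply/andP; split.
  by have := hv 0%N isT; rewrite addn0.
apply: (IH a.+1 (fun i => v i.+1)) => // i it; first exact: vM.
by rewrite addSnnS; apply: hv.
Qed.

Lemma dies_within_mono c M M' t t' a m : (0 < M')%N -> (M <= M')%N -> (t <= t')%N ->
  dies_within c M t a m -> dies_within c M' t' a m.
Proof.
move=> M'0 MM'; elim: t t' a m => [|t IH] t' a m tt'.
  move=> /eqP ->; elim: t' a {tt'} => [//|t' IH'] a /=.
  by apply/hasP; exists (Ordinal M'0); rewrite ?mem_enum //= succ_before0 eqxx IH'.
case: t' tt' => // t' tt' /= /hasP[k _ /andP[f h]].
apply/hasP; exists (widen_ord MM' k); first by rewrite mem_enum.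
by rewrite /= f; apply: IH h.
Qed.

(** One parameter bounds both the duration and the sizes, so [dies] becomes an increasing countable
    union. *)
Lemma dies_dies_within c m : dies c m -> exists n, dies_within c n.+1 n 0 m.
Proof.
case=> t [v [v0 vt hv]].
have [B hB] : exists B, forall i, (i <= t)%N -> (v i < B)%N.
  elim: (t) => [|s [B hB]]; first by exists (v 0%N).+1 => i; rewrite leqn0 => /eqP ->.
  exists (maxn B (v s.+1).+1) => i; rewrite leq_eqVlt => /orP[/eqP ->|].
    by rewrite leq_max leqnn orbT.
  by rewrite ltnS => /hB h; rewrite leq_max h.
exists (B + t)%N; rewrite -v0.
have := @path_dies_within c B t 0%N v vt hB hv.
by apply: dies_within_mono => //; lia.
Qed.

(** * Almost sure extinction and survival *)

Section Prob.
Variables (R : realType) (N : nat) (K : 'M[R]_N) (eta : 'rV[R]_N) (p : 'I_N -> R).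
Variables (d : measure_display) (T : measurableType d) (P : probability T R).
Variables (Rst : int -> nat -> T -> 'I_N) (Coin : int -> nat -> T -> bool).
Variable i0 : 'I_N.
Hypothesis stK : stochastic K.
Hypothesis eta1 : prob_vec eta.
Hypothesis mR : forall x j r, measurable [set w | Rst x j w = r].
Hypothesis mC : forall x j b, measurable [set w | Coin x j w = b].
Hypothesis law : forall (s : seq int) (m : nat) (r : int -> nat -> 'I_N) (b : int -> nat -> bool),
  uniq s -> (0 < m)%N ->
  P [set w | forall x, x \in s -> forall j, (j < m)%N -> Rst x j w = r x j /\ Coin x j w = b x j]
  = (\prod_(x <- s) stack_prob K eta p (r x) (b x) m)%:E.

Local Notation q := (qlaw K p eta).

Definition env (w : T) (x : int) (j : nat) : bool := Coin x j w.

Lemma mevent_coin x j : mevent (fun w => env w x j).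
Proof. exact: (mC x j true). Qed.

Lemma mevent_succ_before x n k : mevent (fun w => succ_before (env w x) n k).
Proof.
suff H s : mevent (fun w => succ_before (fun j => env w x (j + s)) n k).
  apply: mevent_ext (H 0%N) => w; congr succ_before; apply/funext => j; by rewrite addn0.
have [l] := ubnP (n + k)%N; elim: l n k s => // l IH [|n] k s nkl.
  by apply: mevent_ext (@mevent_cst _ T (k == 0%N)) => w; rewrite succ_before0.
have sh w : (fun j => env w x (j + s)) \o succn = fun j => env w x (j + s.+1).
  by apply/funext => j /=; rewrite addSnnS.
apply: (@mevent_ext _ _ (fun w => if env w x s
   then (0 < k)%N && succ_before (fun j => env w x (j + s.+1)) n.+1 k.-1
   else succ_before (fun j => env w x (j + s.+1)) n k)).
  by move=> w; rewrite -(sh w) [RHS]succ_beforeS.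
apply: mevent_if; [exact: mevent_coin| |by apply: IH; lia].
case: k nkl => [|k] nkl; first exact: mevent_cst.
by apply: mevent_and; [exact: mevent_cst|apply: IH => /=; lia].
Qed.

Lemma mevent_dies_within M t a m : mevent (fun w => dies_within (env w) M t a m).
Proof.
elim: t a m => [|t IH] a m /=; first exact: mevent_cst.
apply: (@mevent_has _ T 'I_M (enum 'I_M)
  (fun k w => succ_before (env w a.+1%:Z) m k && dies_within (env w) M t a.+1 k)) => k.
by apply: mevent_and; [exact: mevent_succ_before|exact: IH].
Qed.

Definition fixed_config (M : nat) (s : seq int) (r : int -> nat -> 'I_N) (b : int -> nat -> bool) (w : T) :=
  all (fun x => all (fun j => (Rst x j w == r x j) && (env w x j == b x j)) (iota 0 M.+1)) s.

Definition all_succ_before (s : seq int) (nn kk : int -> nat) (w : T) :=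
  all (fun x => succ_before (env w x) (nn x) (kk x)) s.

Lemma mevent_fixed_config M s r b : mevent (fixed_config M s r b).
Proof.
apply: (@mevent_all _ T int s (fun x w => all (fun j => (Rst x j w == r x j) && (env w x j == b x j)) (iota 0 M.+1))) => x.
apply: (@mevent_all _ T nat _ (fun j w => (Rst x j w == r x j) && (env w x j == b x j))) => j.
apply: mevent_and.
  rewrite /mevent (_ : [set w | _] = [set w | Rst x j w = r x j]) //.
  by apply/seteqP; split=> w /=; [move/eqP|move=> ->].
rewrite /mevent (_ : [set w | _] = [set w | Coin x j w = b x j]) //.
by apply/seteqP; split=> w /=; [move/eqP|move=> h; apply/eqP].
Qed.

Lemma mevent_all_succ_before s nn kk : mevent (all_succ_before s nn kk).
Proof.
apply: (@mevent_all _ T int s (fun x w => succ_before (env w x) (nn x) (kk x))) => x; exact: mevent_succ_before.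
Qed.

Lemma fixed_configP M s r b w : reflect (forall x, x \in s -> forall j, (j < M.+1)%N ->
   Rst x j w = r x j /\ Coin x j w = b x j) (fixed_config M s r b w).
Proof.
apply: (iffP allP) => h x xs.
  move=> j jM; have /allP/(_ j) := h x xs.
  by rewrite mem_iota => /(_ jM)/andP[/eqP -> /eqP].
apply/allP => j; rewrite mem_iota => /= jM.
by have [-> hb] := h x xs j jM; rewrite eqxx /env hb /=.
Qed.

(** Sites are moved one by one from [s2] to [s1] by conditioning on the first
    [M.+1] cookies and coins of their stack. *)
Lemma P_mixed M s2 s1 nn kk r b : uniq (s1 ++ s2) ->
  (forall x, x \in s2 -> (nn x + kk x <= M.+1)%N) ->
  P [set w | fixed_config M s1 r b w && all_succ_before s2 nn kk w] =
  (\prod_(x <- s1) stack_prob K eta p (r x) (b x) M.+1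
     * \prod_(x <- s2) q (nn x) (kk x))%:E.
Proof.
elim: s2 s1 r b => [|x s2 IH] s1 r b us hs.
  rewrite cats0 in us; rewrite big_nil mulr1 -law //; congr (P _).
  by apply/seteqP; split=> w /=; [rewrite andbT => /fixed_configP|move=> h; rewrite andbT; apply/fixed_configP].
have xs1 : x \notin s1.
  by move: us; rewrite cat_uniq /= => /and3P[_ /norP[]].
have us' : uniq ((x :: s1) ++ s2).
  by rewrite -(perm_uniq (_ : perm_eq (s1 ++ [:: x] ++ s2) ([:: x] ++ s1 ++ s2))) // perm_catCA.
pose I := (M.+1.-tuple ('I_N * bool))%type.
pose r' (t : I) := upd r x (tuple_state i0 t); pose b' (t : I) := upd b x (tuple_coin i0 t).
pose g (t : I) w := succ_before (tuple_coin i0 t) (nn x) (kk x) &&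
  (fixed_config M (x :: s1) (r' t) (b' t) w && all_succ_before s2 nn kk w).
have fix_s1 t w : fixed_config M s1 (r' t) (b' t) w = fixed_config M s1 r b w.
  apply: eq_in_all => y ys1; have yx : y != x.
    by apply: contraNneq xs1 => <-.
  by apply: eq_all => j; rewrite /r' /b' !upd_ne.
have fix_x t w : fixed_config M (x :: s1) (r' t) (b' t) w =
    all (fun j => (Rst x j w == tuple_state i0 t j) && (env w x j == tuple_coin i0 t j)) (iota 0 M.+1)
    && fixed_config M s1 r b w.
  rewrite -(fix_s1 t w) /fixed_config /=; congr andb; congr andb.
    by rewrite /r' /b' !updx.
  by apply: eq_all => j; rewrite /r' /b' !updx.
have succ_beforeE (t : I) w : all (fun j => (Rst x j w == tuple_state i0 t j) && (env w x j == tuple_coin i0 t j)) (iota 0 M.+1) ->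
   succ_before (env w x) (nn x) (kk x) = succ_before (tuple_coin i0 t) (nn x) (kk x).
  move=> /allP h; apply: succ_before_prefix => j jnk.
  have /h/andP[_ /eqP] : j \in iota 0 M.+1.
    by rewrite mem_iota /=; apply: leq_trans jnk (hs x _); rewrite mem_head.
  by [].
pose c (t : I) := (\prod_(y <- s1) stack_prob K eta p (r y) (b y) M.+1 * \prod_(y <- s2) q (nn y) (kk y))
   * ((succ_before (tuple_coin i0 t) (nn x) (kk x))%:R * stack_prob K eta p (tuple_state i0 t) (tuple_coin i0 t) M.+1).
rewrite (@P_partition _ _ _ P I _ g c).
- congr (_%:E); rewrite /c -mulr_sumr big_cons mulrCA mulrC; congr (_ * _).
  rewrite /qlaw -(stack_sum_succ_before p i0 stK eta1.2 (m := M)) //.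
  by apply: hs; rewrite mem_head.
- move=> t; apply: mevent_and; first exact: mevent_cst.
  by apply: mevent_and; [exact: mevent_fixed_config|exact: mevent_all_succ_before].
- move=> w; apply/idP/hasP.
    rewrite /all_succ_before /= => /and3P[h1 h2 h3].
    pose t : I := [tuple (Rst x j w, env w x j) | j < M.+1].
    have tE j : (j < M.+1)%N -> nth (i0, true) t j = (Rst x j w, env w x j).
      by move=> jM; rewrite -[j]/(val (Ordinal jM)) -tnth_nth tnth_mktuple.
    have ht : all (fun j => (Rst x j w == tuple_state i0 t j) && (env w x j == tuple_coin i0 t j)) (iota 0 M.+1).
      by apply/allP => j; rewrite mem_iota /= => jM; rewrite /tuple_state /tuple_coin tE // !eqxx.
    exists t; first by rewrite mem_enum.
    by rewrite /g -(succ_beforeE t w) // h2 fix_x ht h1; exact: h3.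
  case=> t _; rewrite /g fix_x => /andP[h1 /andP[/andP[h2 h3] h4]].
  by rewrite h3 /all_succ_before /= (succ_beforeE t w) // h1.
- move=> t t' w; rewrite /g !fix_x => /and3P[_ /andP[h _] _] /and3P[_ /andP[h' _] _].
  apply: val_inj; apply: (@eq_from_nth _ (i0, true)); rewrite ?size_tuple // => j jM.
  have jm : j \in iota 0 M.+1 by rewrite mem_iota.
  have /allP/(_ j jm)/andP[/eqP e1 /eqP e2] := h.
  have /allP/(_ j jm)/andP[/eqP e3 /eqP e4] := h'.
  move: e1 e2; rewrite e3 e4 /tuple_state /tuple_coin => e1 e2.
  by rewrite [LHS]surjective_pairing -e1 -e2 -surjective_pairing.
- move=> t; rewrite /g /c; case: (succ_before (tuple_coin i0 t) (nn x) (kk x)); last first.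
    rewrite mul0r mulr0 (_ : [set w | _] = set0) ?measure0 //.
    by apply/seteqP; split.
  have hs2 y : y \in s2 -> (nn y + kk y <= M.+1)%N.
    by move=> ys; apply: hs; rewrite inE ys orbT.
  apply: etrans (IH (x :: s1) (r' t) (b' t) us' hs2) _.
  congr (_%:E); rewrite big_cons /r' /b' !updx mul1r.
  rewrite (_ : \prod_(y <- s1) stack_prob K eta p (upd r x (tuple_state i0 t) y) (upd b x (tuple_coin i0 t) y) M.+1
     = \prod_(y <- s1) stack_prob K eta p (r y) (b y) M.+1); first by ring.
  by apply: eq_big_seq => y ys1; rewrite !upd_ne //; apply: contraNneq xs1 => <-.
Qed.

Lemma P_cyl s nn kk : uniq s ->
  P [set w | all_succ_before s nn kk w] = (\prod_(x <- s) q (nn x) (kk x))%:E.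
Proof.
move=> us; have [M hM] : exists M, forall x, x \in s -> (nn x + kk x <= M)%N.
  elim: (s) => [|x l [M hM]]; first by exists 0%N.
  exists (maxn M (nn x + kk x)) => y; rewrite inE => /orP[/eqP ->|/hM h].
    by rewrite leq_max leqnn orbT.
  by rewrite leq_max h.
have := @P_mixed M s [::] nn kk (fun _ _ => i0) (fun _ _ => true) us
  (fun x xs => leqW (hM x xs)).
by rewrite big_nil mul1r.
Qed.

(** The sites in [s] lie at or below [a], so the next generation reads a fresh stack, that of
    [a.+1]; splitting on its outcome [k] moves this site into [s]. The Markov property of the
    generations is thus obtained from cylinders alone. *)
Lemma P_succ_before_dies_within M t a s nn kk m : uniq s -> (forall x, x \in s -> x <= a%:Z) ->
  P [set w | all_succ_before s nn kk w && dies_within (env w) M t a m] =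
  ((\prod_(x <- s) q (nn x) (kk x)) * death q M t m)%:E.
Proof.
elim: t a s nn kk m => [|t IH] a s nn kk m us hs.
  rewrite /=; case: eqP => _.
    rewrite mulr1 -P_cyl //; congr (P _).
    by apply/seteqP; split=> w /=; rewrite andbT.
  by rewrite mulr0 (_ : [set w | _] = set0) ?measure0 //; apply/seteqP; split=> w //=; rewrite andbF.
set x := a.+1%:Z; have xs : x \notin s.
  by apply/negP => /hs; rewrite /x; lia.
pose nn' := upd nn x m; pose kk' k := upd kk x k.
pose g (k : 'I_M) w := all_succ_before (x :: s) nn' (kk' k) w && dies_within (env w) M t a.+1 k.
have gE (k : 'I_M) w : g k w = succ_before (env w x) m k && all_succ_before s nn kk w && dies_within (env w) M t a.+1 k.
  rewrite /g /all_succ_before /= /nn' /kk' !updx; congr (_ && _ && _).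
  by apply: eq_in_all => y ys; rewrite !upd_ne //; apply: contraNneq xs => <-.
rewrite (@P_partition _ _ _ P 'I_M _ g (fun k => (\prod_(x <- s) q (nn x) (kk x)) * (q m k * death q M t k))).
- by congr (_%:E); rewrite mulr_sumr.
- by move=> k; apply: mevent_and; [exact: mevent_all_succ_before|exact: mevent_dies_within].
- move=> w /=; apply/idP/hasP.
    case/andP => h /hasP[k ke /andP[h1 h2]]; exists k => //.
    by rewrite gE h h1 h2.
  case=> k ke; rewrite gE => /andP[/andP[h1 ->] h2] /=.
  by apply/hasP; exists k => //; rewrite h1 h2.
- move=> k k' w; rewrite !gE => /andP[/andP[h1 _] _] /andP[/andP[h2 _] _].
  by apply: val_inj; apply: succ_before_inj h1 h2.
- move=> k; rewrite /g IH /=; last 2 first.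
    by rewrite xs.
    by move=> y; rewrite inE => /orP[/eqP ->|/hs]; rewrite /x; lia.
  congr (_%:E); rewrite big_cons /nn' /kk' !updx.
  rewrite (_ : \prod_(y <- s) q (upd nn x m y) (upd kk x (k : nat) y) = \prod_(y <- s) q (nn y) (kk y)).
    by ring.
  by apply: eq_big_seq => y ys; rewrite !upd_ne //; apply: contraNneq xs => <-.
Qed.

Lemma P_dies_within M t m : P [set w | dies_within (env w) M t 0 m] = (death q M t m)%:E.
Proof.
have := @P_succ_before_dies_within M t 0 [::] (fun=> 0%N) (fun=> 0%N) m isT (fun _ => ltac:(by [])).
by rewrite big_nil mul1r.
Qed.

Lemma ae_exists (f : nat -> T -> bool) : (forall i, mevent (f i)) ->
  (forall e : R, 0 < e -> exists i, ((1 - e)%:E <= P [set w | f i w])%E) ->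
  {ae P, forall w, exists i, f i w}.
Proof.
move=> mf hf; pose A := \bigcup_i [set w | f i w].
have mA : measurable A by apply: bigcupT_measurable => i; exact: mf.
apply: (@negligibleS _ _ _ _ (~` A)).
  by move=> w /= h [i _ fi]; apply: h; exists i.
apply/negligibleP; first exact: measurableC.
have P1 : (1%:E <= P A)%E.
  apply/lee_addgt0Pr => e e0; have [i hi] := hf e e0.
  rewrite -leeBlDr // -EFinB; apply: le_trans hi _.
  apply: le_measure; rewrite ?inE //; first exact: mf.
  by move=> w fw; exists i.
have PA : P A = 1%E by apply/eqP; rewrite eq_le probability_le1.
by have := probability_setC P mA; rewrite PA subee.
Qed.

(** Since [q n] has total mass [1], almost surely some [k] satisfies [succ_before (env w x) n k];
    and [j.+1] failures cannot all precede index [j]. Successes come later, from the mirrored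
    environment. *)
Lemma ae_rich : (forall n (e : R), 0 < e -> exists M, 1 - e <= \sum_(k < M) q n k) ->
  {ae P, forall w, forall x j, exists2 k, (j <= k)%N & env w x k = false}.
Proof.
move=> hq.
have H x n : {ae P, forall w, exists M : nat, has (fun k : 'I_M => succ_before (env w x) n k) (enum 'I_M)}.
  apply: ae_exists.
    move=> M; apply: (@mevent_has _ T 'I_M (enum 'I_M) (fun k w => succ_before (env w x) n k)) => k.
    exact: mevent_succ_before.
  move=> e e0; have [M hM] := hq n e e0; exists M.
  rewrite (@P_partition _ _ _ P 'I_M _ (fun (k : 'I_M) w => succ_before (env w x) n k) (fun k => q n k)) //.
  - by move=> k; exact: mevent_succ_before.
  - by move=> k k' w h1 h2; apply: val_inj; apply: succ_before_inj h1 h2.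
  - move=> k; have := @P_cyl [:: x] (fun=> n) (fun=> k : nat) isT.
    rewrite big_seq1 => <-; congr (P _).
    by apply/seteqP; split=> w /=; rewrite /all_succ_before /= andbT.
have H' x : {ae P, forall w, forall j, exists2 k, (j <= k)%N & env w x k = false}.
  apply: (filterS _ (ae_foralln (fun n => H x n))) => w h j.
  have [M /hasP[k _ /andP[/eqP hk _]]] := h j.+1.
  apply: contrapT => /forall2NP hn.
  have : (cnt false (env w x) (j.+1 + k) <= j)%N.
    have hc L : (cnt false (env w x) L <= j)%N.
      elim: L => [|L IH]; first by rewrite cnt0.
      rewrite cntS; case: (leqP j L) => jL.
        have [/negP|] := hn L; first by rewrite jL.
        by case: (env w x L) => // _; rewrite addn0.
      have := cntTF (env w x) L; case: (env w x L) => /=; lia.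
    exact: hc.
  by rewrite hk ltnn.
have Hp := ae_foralln (fun n : nat => H' n%:Z).
have Hn := ae_foralln (fun n : nat => H' (- n%:Z)).
apply: (filterS2 _ _ Hp Hn) => w hp hn x.
case: (lerP 0 x) => hx; first by have -> : x = `|x|%N%:Z by lia.
by have -> : x = - `|x|%N%:Z by lia.
Qed.

Hypothesis q00 : q 0 0 = 1.
Hypothesis q0 : forall n k, 0 <= q n k.
Hypothesis q1 : forall n M, \sum_(k < M) q n k <= 1.

Lemma ae_dies : (forall m, death_sup q m = 1) -> {ae P, forall w, forall m, dies (env w) m}.
Proof.
move=> h; apply: ae_foralln => m.
apply: (filterS _ (@ae_exists (fun n w => dies_within (env w) n.+1 n 0 m) _ _)).
- by move=> w [n]; apply: dies_within_dies.
- by move=> n; apply: mevent_dies_within.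
- move=> e e0; have [M [t [M0 mM hd]]] := death_sup_approx q0 q1 q00 m.+1 e0.
  exists (M + t)%N; rewrite P_dies_within lee_fin.
  apply: le_trans (_ : death q M t m <= _); first by have := hd m (ltnSn m); rewrite h.
  apply: (@le_trans _ _ (death q (M + t).+1 t m)); first by apply: death_monoM => //; lia.
  by apply: death_monot => //; lia.
Qed.

(** The event that extinction occurs from every [m] lies in each [A m], and continuity from below
    gives [P (A m) <= e] for a suitable [m]. *)
Lemma ae_not_dies : (forall e, 0 < e -> exists m, forall M t, death q M t m <= e) ->
  {ae P, forall w, ~ (forall m, dies (env w) m)}.
Proof.
move=> h; pose F m n := [set w | dies_within (env w) n.+1 n 0 m].
have mF m n : measurable (F m n) by apply: mevent_dies_within.
pose A m := \bigcup_n F m n.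
have mA m : measurable (A m) by apply: bigcupT_measurable.
have PA e : 0 < e -> exists m, (P (A m) <= e%:E)%E.
  move=> e0; have [m hm] := h e e0; exists m.
  have ndF : nondecreasing_seq (F m).
    move=> n n' nn'; apply/subsetPset => w; apply: dies_within_mono => //.
  have cv := nondecreasing_cvg_mu (mu := P) (mF m) (mA m) ndF.
  rewrite -(cvg_lim _ cv) //; apply: lime_le; first by apply/cvg_ex; eexists; exact: cv.
  by apply: nearW => n /=; rewrite P_dies_within lee_fin.
apply: (@negligibleS _ _ _ _ (\bigcap_m A m)).
  move=> w /= /contrapT hw m _; have [n hn] := dies_dies_within (hw m).
  by exists n.
apply/negligibleP; first exact: bigcapT_measurable.
apply/eqP; rewrite -measure_le0; apply/lee_addgt0Pr => e e0.
have [m hm] := PA e e0; rewrite add0e; apply: le_trans hm.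
apply: le_measure; rewrite ?inE //; first exact: bigcapT_measurable.
by move=> w; apply.
Qed.

End Prob.

(** * The theorem *)

Section MeasurablePredicates.
Variables (d : measure_display) (T : measurableType d).

Lemma measurable_ex (U : countType) (Q : U -> T -> Prop) :
  (forall u, measurable [set w | Q u w]) -> measurable [set w | exists u, Q u w].
Proof.
move=> mQ; rewrite (_ : [set w | _] = \bigcup_u [set w | Q u w]).
  by apply: countable_bigcupT_measurable => //; exact: countableP.
by apply/seteqP; split=> w /= [u]; [exists u|exists u].
Qed.

Lemma measurable_all (U : countType) (Q : U -> T -> Prop) :
  (forall u, measurable [set w | Q u w]) -> measurable [set w | forall u, Q u w].
Proof.
move=> mQ; rewrite (_ : [set w | _] = ~` [set w | exists u, ~ Q u w]).
  by apply: measurableC; apply: measurable_ex => u; exact: (measurableC (mQ u)).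
by apply/seteqP; split=> w /=; [move=> h [u]; apply|move/forallNP => h u; apply: contrapT].
Qed.

Lemma measurable_imp (A : Prop) (Q : T -> Prop) :
  measurable [set w | Q w] -> measurable [set w | A -> Q w].
Proof.
move=> mQ; case: (pselect A) => a.
  by rewrite (_ : [set w | A -> Q w] = [set w | Q w]) //; apply/seteqP; split=> w /=; [apply|].
by rewrite (_ : [set w | A -> Q w] = setT); [exact: measurableT|apply/seteqP; split=> w //= _ /a].
Qed.

Lemma measurable_ex2 (U : countType) (A : U -> Prop) (Q : U -> T -> Prop) :
  (forall u, measurable [set w | Q u w]) -> measurable [set w | exists2 u, A u & Q u w].
Proof.
move=> mQ; rewrite (_ : [set w | _] = [set w | exists u, ~ (A u -> ~ Q u w)]).
  apply: measurable_ex => u; apply: measurableC; apply: measurable_imp; exact: (measurableC (mQ u)).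
apply/seteqP; split=> w /= [u]; first by move=> au qu; exists u => h; apply: h.
by move=> /not_implyP[au /contrapT qu]; exists u.
Qed.

Lemma ae_probability1 (R : realType) (P : probability T R) (A : T -> Prop) :
  measurable [set w | A w] -> {ae P, forall w, A w} -> P [set w | A w] = 1%E.
Proof.
move=> mA /(measure_negligible (measurableC mA)) h0.
by have := probability_setC P (measurableC mA); rewrite setCK h0 sube0.
Qed.

End MeasurablePredicates.

Section WalkMeasurable.
Variables (d : measure_display) (T : measurableType d) (Coin : int -> nat -> T -> bool).
Hypothesis mC : forall x j b, measurable [set w | Coin x j w = b].

(** A fixed history determines the site and the index of the next coin, so each step tests a single
    coin; histories form a countable type. *)
Lemma mevent_hist n s : mevent (fun w => walk_hist (env Coin w) n == s).
Proof.
elim: n s => [|n IH] s; first by apply: mevent_ext (@mevent_cst _ T ([:: 0] == s)).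
case/lastP: s => [|s y].
  by apply: mevent_ext (@mevent_cst _ T false) => w /=; case: (walk_hist _ n).
apply: (@mevent_ext _ _ (fun w => (walk_hist (env Coin w) n == s) &&
  (if env Coin w (last 0 s) (count (pred1 (last 0 s)) s).-1 then last 0 s + 1 == y else last 0 s - 1 == y))).
  move=> w /=; rewrite eqseq_rcons; case: eqP => [->|] //=.
  by case: (env _ _ _ _).
by apply: mevent_and => //; apply: mevent_if; [exact: mevent_coin|exact: mevent_cst|exact: mevent_cst].
Qed.

Lemma measurable_walk n (A : int -> bool) : measurable [set w | A (walk (env Coin w) n)].
Proof.
rewrite (_ : [set w | _] = [set w | exists s, (walk_hist (env Coin w) n == s) && A (last 0 s)]).
  by apply: measurable_ex => s; apply: mevent_and; [exact: mevent_hist|exact: mevent_cst].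
apply/seteqP; split=> w /=; first by exists (walk_hist (env Coin w) n); rewrite eqxx.
by case=> s /andP[/eqP <-].
Qed.

End WalkMeasurable.

Section OneSided.
Variables (R : realType) (N : nat) (K : 'M[R]_N) (mu eta : 'rV[R]_N) (p : 'I_N -> R).
Variables (d : measure_display) (T : measurableType d) (P : probability T R).
Variables (Rst : int -> nat -> T -> 'I_N) (Coin : int -> nat -> T -> bool).
Variable j0 : 'I_N.
Hypothesis stK : stochastic K.
Hypothesis sink : forall i, connect (edge K) i j0.
Hypothesis stmu : stationary K mu.
Hypothesis p01 : forall i, 0 < p i < 1.
Hypothesis eta1 : prob_vec eta.
Hypothesis mean : Em mu p = 2^-1.
Hypothesis mR : forall x j r, measurable [set w | Rst x j w = r].
Hypothesis mC : forall x j b, measurable [set w | Coin x j w = b].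
Hypothesis law : forall (s : seq int) (m : nat) (r : int -> nat -> 'I_N) (b : int -> nat -> bool),
  uniq s -> (0 < m)%N ->
  P [set w | forall x, x \in s -> forall j, (j < m)%N -> Rst x j w = r x j /\ Coin x j w = b x j]
  = (\prod_(x <- s) stack_prob K eta p (r x) (b x) m)%:E.

Local Notation c := (env Coin).

Lemma delta_bpar : delta K mu eta p = 2 * bpar K mu p eta / nu K mu p.
Proof. by rewrite /delta /bpar mxE. Qed.

(** The first two conclusions leave escape to [-oo] open. They decide the behaviour only together
    with their mirror images, obtained for [1 - p] and the reflected environment. *)
Lemma one_sided :
  [/\ delta K mu eta p <= 1 -> {ae P, forall w, ~ to_pinfty (c w)},
      1 < delta K mu eta p -> {ae P, forall w, ~ (rich (c w) /\ often (c w) 0)} &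
      {ae P, forall w, forall x j, exists2 k, (j <= k)%N & c w x k = false}].
Proof.
have q1i i : 0 < 1 - p i by have := p01 i; lra.
have [a a0 pa] := fin_lb q1i.
have a01 : 0 < a < 1 by have := pa j0; have := p01 j0; lra.
have v0 := nu_gt0 stK sink stmu p01 mean.
have MB : moments_ok (qlaw K p eta) (bpar K mu p eta) (nu K mu p).
  exact: (moment_bound stK sink stmu p01 mean a01 pa eta1).
have q0 := qlaw_ge0 stK p01 eta1.
have qs1 := qlaw_sum_le1 stK p01 eta1.
have qt := qlaw_tail stK p01 a01 pa eta1.
have q00 : qlaw K p eta 0 0 = 1.
  by rewrite /qlaw /= -[RHS]eta1.2; apply: eq_bigr => i _; rewrite mulr1.
have qpos n : 0 < qlaw K p eta n 0.
  by apply: lt_le_trans (exprn_gt0 n a0) _; exact: (qlaw0_gt0 stK a01 pa eta1).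
split.
- move=> d1; have bv : bpar K mu p eta <= nu K mu p / 2.
    by move: d1; rewrite delta_bpar ler_pdivrMr // mul1r; lra.
  have [n0 hn0] := lyapunov_recurrent MB v0 bv.
  have ds := death_recurrent q0 qs1 q00 qt qpos hn0.
  have := ae_dies j0 stK eta1 mR mC law q00 q0 qs1 ds.
  apply: filterS => w h tp; have [m hm] := walk_to_pinfty_not_dies tp.
  exact: hm (h m).
- move=> d1; have bv : nu K mu p / 2 < bpar K mu p eta.
    by move: d1; rewrite delta_bpar ltr_pdivlMr // mul1r; lra.
  have [n0 hn0] := lyapunov_transient MB v0 bv.
  have ds := death_transient q0 qs1 hn0.
  have := ae_not_dies j0 stK eta1 mR mC law ds.
  by apply: filterS => w h [rc of0]; apply: h; apply: recurrent_dies.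
- apply: (ae_rich j0 stK eta1 mR mC law) => n e e0.
  have [t t01 [B B1 hB]] := qt.
  apply: contrapT => /forallNP hM.
  have C0 : 0 <= B ^+ n by rewrite exprn_ge0 //; lra.
  suff : 0 <= - e by lra.
  apply: (geo_ge0 t01 C0) => M; have := hB n M; have /negP := hM M.
  by rewrite -ltNge; lra.
Qed.

End OneSided.

Lemma stack_prob_compl (R : realType) (N : nat) (K : 'M[R]_N) (eta : 'rV[R]_N)
    (p : 'I_N -> R) (r : nat -> 'I_N) (b : nat -> bool) (m : nat) :
  stack_prob K eta (fun i => 1 - p i) r b m = stack_prob K eta p r (fun j => ~~ b j) m.
Proof.
rewrite /stack_prob; congr (_ * _); apply: eq_bigr => j _.
by case: (b j) => //=; ring.
Qed.

Theorem theorem1p3 (R : realType) (N : nat)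
  (K : 'M[R]_N) (mu eta : 'rV[R]_N) (p : 'I_N -> R)
  (d : measure_display) (T : measurableType d) (P : probability T R)
  (Rst : int -> nat -> T -> 'I_N) (Coin : int -> nat -> T -> bool) :
  stochastic K ->
  (exists! C : {set 'I_N}, closed_irreducible K C) ->
  stationary K mu ->
  (forall i, 0 < p i < 1) ->
  prob_vec eta ->
  \sum_i mu 0 i * p i = 2%:R^-1 ->
  (forall x j r, measurable [set w | Rst x j w = r]) ->
  (forall x j b, measurable [set w | Coin x j w = b]) ->
  (forall (s : seq int) (m : nat) (r : int -> nat -> 'I_N) (b : int -> nat -> bool),
      uniq s -> (0 < m)%N ->
      P [set w | forall x, x \in s -> forall j, (j < m)%N ->
                   Rst x j w = r x j /\ Coin x j w = b x j]
      = (\prod_(x <- s) stack_prob K eta p (r x) (b x) m)%:E) ->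
  let X := fun (n : nat) (w : T) => walk (fun x j => Coin x j w) n in
  delta K mu eta p + deltat K mu eta p < 1 /\
  (1 < delta K mu eta p ->
     P [set w | forall M : int, exists n0, forall n, (n0 <= n)%N -> M <= X n w] = 1%E) /\
  (1 < deltat K mu eta p ->
     P [set w | forall M : int, exists n0, forall n, (n0 <= n)%N -> X n w <= M] = 1%E) /\
  (delta K mu eta p <= 1 -> deltat K mu eta p <= 1 ->
     P [set w | (forall M : int, forall n0, exists2 n, (n0 <= n)%N & X n w <= M) /\
                (forall M : int, forall n0, exists2 n, (n0 <= n)%N & M <= X n w)] = 1%E).
Proof.
move=> stK uniqC stmu p01 eta1 mean mR mC law X.
have [j0 sink] := exists_sink uniqC.
have sum1 := delta_sum_lt1 stK sink stmu p01 mean eta1.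
have [Rr Tr Fr] := one_sided stK sink stmu p01 eta1 mean mR mC law.
pose p' i := 1 - p i.
(* The environment reflected in space, with its coins negated, drives [- X] and has success
   probabilities [1 - p]. *)
pose Rst' x j w := Rst (- x) j w; pose Coin' x j w := ~~ Coin (- x) j w.
have p01' i : 0 < p' i < 1 by rewrite /p'; have := p01 i; lra.
have mean' : Em mu p' = 2^-1 := mean_compl stmu mean.
have mC' x j b : measurable [set w | Coin' x j w = b].
  rewrite (_ : [set w | _] = [set w | Coin (- x) j w = ~~ b]) //.
  by apply/seteqP; split=> w /=; rewrite /Coin'; case: (Coin _ _ w); case: b.
have law' (s : seq int) (m : nat) (r : int -> nat -> 'I_N) (b : int -> nat -> bool) :
  uniq s -> (0 < m)%N ->
  P [set w | forall x, x \in s -> forall j, (j < m)%N -> Rst' x j w = r x j /\ Coin' x j w = b x j]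
  = (\prod_(x <- s) stack_prob K eta p' (r x) (b x) m)%:E.
  move=> us m0; have := law (map -%R s) m (fun x => r (- x)) (fun x j => ~~ b (- x) j).
  rewrite map_inj_uniq; last exact: oppr_inj.
  move=> /(_ us m0); rewrite big_map.
  under eq_bigr do rewrite opprK -stack_prob_compl.
  move=> <-; congr (P _); apply/seteqP; split=> w /= h x.
    case/mapP => y ys -> j jm; rewrite opprK; have [<- <-] := h y ys j jm.
    by rewrite /Rst' /Coin' negbK.
  move=> xs j jm; have [] := h (- x) (map_f _ xs) j jm; rewrite opprK /Rst' /Coin' => -> ->.
  by rewrite negbK.
have [Rl Tl Fl] := one_sided stK sink stmu p01' eta1 mean' (fun x => mR (- x)) mC' law'.
rewrite delta_compl in Rl Tl.
have envE w : env Coin' w = flip (env Coin w) by [].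
(* Failures in the mirrored stacks are successes in the original ones. *)
have ae_rc : {ae P, forall w, rich (env Coin w)}.
  apply: (filterS2 _ _ Fr Fl) => w hr hl x [] j; last exact: hr.
  have [k jk] := hl (- x) j; rewrite /env /Coin' opprK => /negbFE h.
  by exists k.
have ninf w : to_ninfty (env Coin w) -> to_pinfty (env Coin' w).
  move=> h M; have [n0 hn0] := h (- M); exists n0 => n hn.
  by rewrite envE walk_flip lerNr; apply: hn0.
have mX n (A : int -> bool) : measurable [set w | A (X n w)].
  exact: (measurable_walk mC n A).
split; first exact: sum1.
split; [|split].
- move=> d1; apply: ae_probability1.
    apply: measurable_all => M; apply: measurable_ex => n0.
    by apply: measurable_all => n; apply: measurable_imp; exact: (mX n (fun x => M <= x)).
  (* Because [delta + deltat < 1], the mirrored walk does not escape to [+oo], which excludes [-oo]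
     here; [Tr] excludes recurrence. *)
  have dt1 : deltat K mu eta p <= 1 by lra.
  apply: (filterS3 _ _ ae_rc (Tr d1) (Rl dt1)) => w rc h1 h2.
  case: (trichotomy rc) => [of0|//|/ninf//].
  by case: h1.
- move=> d1; apply: ae_probability1.
    apply: measurable_all => M; apply: measurable_ex => n0.
    by apply: measurable_all => n; apply: measurable_imp; exact: (mX n (fun x => x <= M)).
  have dr1 : delta K mu eta p <= 1 by lra.
  apply: (filterS3 _ _ ae_rc (Tl d1) (Rr dr1)) => w rc h1 h2.
  case: (trichotomy rc) => [of0|//|//].
  case: h1; split.
    move=> x v j; have [k jk ck] := rc (- x) (~~ v) j; exists k => //.
    by rewrite envE /flip ck negbK.
  by move=> n0; have [n hn Xn] := of0 n0; exists n => //; rewrite envE walk_flip Xn oppr0.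
- move=> dr1 dt1; apply: ae_probability1.
    apply: measurableI.
      apply: measurable_all => M; apply: measurable_all => n0.
      by apply: measurable_ex2 => n; exact: (mX n (fun x => x <= M)).
    apply: measurable_all => M; apply: measurable_all => n0.
    by apply: measurable_ex2 => n; exact: (mX n (fun x => M <= x)).
  apply: (filterS3 _ _ ae_rc (Rr dr1) (Rl dt1)) => w rc h1 h2.
  case: (trichotomy rc) => [of0|//|/ninf//].
  (* Recurrence of [0] spreads to every site, so the level [M] itself is hit after any time [n0] and
     witnesses both bounds. *)
  split=> M n0; have [n hn Xn] := often_all M rc of0 n0; exists n => //.
    by have <- : walk (env Coin w) n = M by [].
  by have <- : walk (env Coin w) n = M by [].
Qed.
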